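(* Let $H\in(0,1)$ and $\Delta>0$, and let $Y$ be the solution of $Y_t=x+\int_0^t b(Y_s)\,ds+\sigma B_t$, $t\ge 0$, where $B$ is a $d$-dimensional fractional Brownian motion with Hurst parameter $H$, $\sigma$ is a real $d\times d$ matrix, $x\in\mathbb{R}^d$, and $b:\mathbb{R}^d\to\mathbb{R}^d$ is continuous and such that, for some constants $\alpha,L>0$, $\langle b(y)-b(z),y-z\rangle\le-\alpha|y-z|^2$ and $|b(y)-b(z)|\le L|y-z|$ for all $y,z\in\mathbb{R}^d$. Set $t_k=k\Delta$ for $k\ge1$. Then: (i) there exists a constant $C_{H,\Delta,\sigma}>0$ such that for all $n\in\mathbb{N}^*$, all Lipschitz functions $f:(\mathbb{R}^d,|\cdot|)\to(\mathbb{R},|\cdot|)$ and all $r\ge 0$, $$\mathbb{P}\left(\frac1n\sum_{k=1}^n\left(f(Y_{t_k})-\mathbb{E}[f(Y_{t_k})]\right)>r\right)\le\exp\left(-\frac{r^2 n^{2-(2H\vee 1)}}{4C_{H,\Delta,\sigma}\|f\|_{\rm Lip}^2}\right);$$ (ii) there exists a constant $\tilde C_{H,\sigma}>0$ such that for all $T\ge 1$, all Lipschitz functions $f:(\mathbb{R}^d,|\cdot|)\to(\mathbb{R},|\cdot|)$ and all $r\ge 0$, $$\mathbb{P}\left(\frac1T\int_0^T\left(f(Y_t)-\mathbb{E}[f(Y_t)]\right)dt>r\right)\le\exp\left(-\frac{r^2 T^{2-(2H\vee 1)}}{4\tilde C_{H,\sigma}\|f\|_{\rm Lip}^2}\right)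.$$
   Context: $|\cdot|$ is the Euclidean norm on $\mathbb{R}^d$ or the absolute value on $\mathbb{R}$, and $\langle\cdot,\cdot\rangle$ the scalar product on $\mathbb{R}^d$; $a\vee b=\max(a,b)$; $\mathbb{N}^*=\{1,2,\dots\}$. $\|f\|_{\rm Lip}=\sup_{x\ne y}|f(x)-f(y)|/|x-y|$. When $\|f\|_{\rm Lip}=0$, the right-hand sides are read as $0$ for $r>0$ and $1$ for $r=0$. A $d$-dimensional fractional Brownian motion with Hurst parameter $H$ has independent components that are continuous centered Gaussian processes with covariance $\frac12(t^{2H}+s^{2H}-|t-s|^{2H})$. The dimension $d$ and the drift $b$ are fixed data, on which constants may depend; apart from these, $C_{H,\Delta,\sigma}$ depends only on $H,\Delta,\sigma$, and $\tilde C_{H,\sigma}$ only on $H,\sigma$. *)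

(* Defs.v *)
From mathcomp Require Export all_boot all_order all_algebra.
From mathcomp Require Export all_classical all_reals all_analysis.
Export Order.TTheory GRing.Theory Num.Theory.
Export numFieldNormedType.Exports.

Set Implicit Arguments.
Unset Strict Implicit.
Unset Printing Implicit Defensive.

Local Open Scope classical_set_scope.
Local Open Scope ring_scope.

Section Euclidean.
Context {R : realType} {d : nat}.
Implicit Types (x y : 'cV[R]_d) (f : 'cV[R]_d -> R).

Definition dotcv x y : R := \sum_(i < d) x i 0 * y i 0.

(* The library norm on matrices is the sup norm. *)
Definition enorm x : R := Num.sqrt (dotcv x x).

Definition lipschitz_fun f :=
  exists K : R, forall x y, `|f x - f y| <= K * enorm (x - y).

Definition lip f : R :=
  sup [set q | exists x y, x != y /\ q = `|f x - f y| / enorm (x - y)].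

(* [N] is the sample size n, or the time horizon T.  The degenerate case is
   separate because division by 0 gives 0, hence a bound of 1 for every r. *)
Definition conc_bound (H C N : R) f (r : R) : R :=
  if lip f == 0 then (if r == 0 then 1 else 0)
  else expR (- (r ^+ 2 * N `^ (2 - Num.max (2 * H) 1) / (4 * C * lip f ^+ 2))).

End Euclidean.

Section Processes.
Context {disp : measure_display} {Omega : measurableType disp} {R : realType}.
Variable P : probability Omega R.

(* Processes are indexed by R, but only times t >= 0 are ever constrained. *)

(* Point masses are included: a Gaussian variable may have variance 0, and
   [normal_prob m 0] is not the Dirac mass at m. *)
Definition gaussian_rv (X : Omega -> R) :=
  (exists m s : R, 0 < s /\
     forall A : set R, measurable A -> P (X @^-1` A) = normal_prob m s A) \/
  (exists m : R,
     forall A : set R, measurable A -> P (X @^-1` A) = \d_m A).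

Definition gaussian_process (X : R -> {RV P >-> R}) :=
  forall (n : nat) (t c : 'I_n -> R), (forall k, 0 <= t k) ->
    gaussian_rv (fun w => \sum_(k < n) c k * X (t k) w).

Definition fbm_cov (H s t : R) : R :=
  2^-1 * (t `^ (2 * H) + s `^ (2 * H) - `|t - s| `^ (2 * H)).

Record is_fbm1 (H : R) (X : R -> {RV P >-> R}) : Prop := {
  fbm1_gaussian : gaussian_process X;
  fbm1_centered : forall t : R, 0 <= t -> ('E_P[X t] = 0)%E;
  fbm1_covariance : forall s t : R, 0 <= s -> 0 <= t ->
    covariance P (X s) (X t) = (fbm_cov H s t)%:E;
  fbm1_continuous : forall w, {within `[0, +oo[, continuous (fun t : R => X t w)} }.

Definition sigma_process (X : R -> {RV P >-> R}) : set (set Omega) :=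
  <<s [set E | exists (t : R) (A : set R),
         [/\ 0 <= t, measurable A & E = X t @^-1` A]] >>.

(* The product rule on the full family gives it on every subfamily, by taking
   the other events equal to [setT]. *)
Definition independent_processes (d : nat) (X : 'I_d -> R -> {RV P >-> R}) :=
  forall E : 'I_d -> set Omega, (forall i, sigma_process (X i) (E i)) ->
    P (\bigcap_i E i) = (\prod_(i < d) P (E i))%E.

Definition is_fbm (d : nat) (H : R) (B : 'I_d -> R -> {RV P >-> R}) :=
  (forall i, is_fbm1 H (B i)) /\ independent_processes B.

Definition vecp (d : nat) (X : 'I_d -> R -> {RV P >-> R}) (t : R) (w : Omega)
  : 'cV[R]_d := \col_i X i t w.

Record is_sde_solution (d : nat) (b : 'cV[R]_d -> 'cV[R]_d) (sigma : 'M[R]_d)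
    (x : 'cV[R]_d) (B Y : 'I_d -> R -> {RV P >-> R}) : Prop := {
  sde_continuous : forall i w, {within `[0, +oo[, continuous (fun t : R => Y i t w)};
  sde_eq : forall (t : R) w, 0 <= t ->
    vecp Y t w =
      x + \col_i (\int[lebesgue_measure]_(s in `[0, t]) (b (vecp Y s w) i 0))
        + sigma *m vecp B t w }.

Definition centered_obs (d : nat) (Y : 'I_d -> R -> {RV P >-> R})
    (f : 'cV[R]_d -> R) (t : R) (w : Omega) : R :=
  f (vecp Y t w) - fine ('E_P[fun w' => f (vecp Y t w')])%E.

End Processes.

(* Main.v *)
(* The solution is approximated by the Euler scheme with p steps per block of
   length Delta.  The time average of f along the scheme is a Lipschitz function
   F of the Gaussian vector of noise values on the grid, with covariance S.
   Since b is contractive, shifting the noise by S g moves the average by at most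
   a constant times l / n times the sum over the n blocks of the oscillations
   of S g.  By Cauchy-Schwarz this sum is at most sqrt(a^T S a) sqrt(g^T S g) for
   a vector a of signed increments, and a^T S a is of order n^(max(2H,1)), because
   covariances of fractional increments over distinct blocks have a constant
   sign.  So F is Lipschitz in the Cameron-Martin directions with constant of
   order n^(max(2H,1)/2 - 1).
   Rotating the Gaussian vector into an independent copy (Maurey-Pisier) turns
   this into a sub-Gaussian bound on the Laplace transform of F, first for
   semiconcave F, obtained by inf-convolution.  Fatou's lemma carries the bound
   over to the solution as the mesh goes to 0, then to unbounded f by truncation,
   and Chernoff's inequality concludes.  For continuous time averages the
   block length is T / n with n the integer part of T. *)

From HB Require Import structures.
Require Import Defs.
From mathcomp Require Import measurable_realfun ring lra.

Set Implicit Arguments.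
Unset Strict Implicit.
Unset Printing Implicit Defensive.

Local Open Scope classical_set_scope.
Local Open Scope ring_scope.

(** The observables are only Lipschitz, and the covariance on the grid is degenerate because the
    noise vanishes at time 0, so no gradient and no Gaussian density can be relied on. The Gaussian
    vector enters only through its characteristic function and an upper bound on its Laplace
    transform. Its invariance under rotation is an equality of characteristic functions, carried
    over to bounded Lipschitz functions by Bernstein polynomials in [sin (x / L)]. Increments along
    the rotation need only be bounded from above; this is why semiconcavity, a one-sided
    second-order bound, can replace differentiability. The quarter circle has length [pi / 2 <= 2],
    so that, given the starting point, the linear parts have variance at most [4 * l ^+ 2 * K ^+ 2]
    in the limit, whence the factor [expR (2 * l ^+ 2 * K ^+ 2)]. Integrability of an unbounded
    observable is not assumed: it comes from a first-moment bound on the scheme, again by Fatou's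
    lemma. For time averages [T / n] stays in [[1, 2]] and [euler_const] decreases with the block
    length, which makes the constant independent of [T]. *)

(** * Expectations of real random variables *)

Section Expectation.
Context {disp : measure_display} {T : measurableType disp} {R : realType}.
Variable P : probability T R.
Implicit Types u v g : T -> R.

(** A real number even when the integral diverges, in which case it is a junk value; [int1]
    therefore accompanies it throughout. *)
Definition Ex u : R := \int[P]_w u w.
Definition int1 u := P.-integrable setT (EFin \o u).

Lemma int1_measurable u : int1 u -> measurable_fun setT u.
Proof. by move=> /measurable_int/measurable_EFinP. Qed.

Lemma int1_bounded u M : measurable_fun setT u -> (forall w, `|u w| <= M) ->
  int1 u.
Proof.
move=> mu uM; apply: (@le_integrable _ _ _ P _ _ _ (EFin \o cst M)) => //.
- exact/measurable_EFinP.
- by move=> w _ /=; rewrite lee_fin (le_trans (uM w)) ?ler_norm.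
- by apply: finite_measure_integrable_cst.
Qed.

Lemma int1_cst c : int1 (fun=> c).
Proof. exact: finite_measure_integrable_cst. Qed.

Lemma int1_le u g : measurable_fun setT u -> (forall w, `|u w| <= g w) ->
  int1 g -> int1 u.
Proof.
move=> mu ug; apply: le_integrable => //; first exact/measurable_EFinP.
by move=> w _ /=; rewrite lee_fin (le_trans (ug w)) ?ler_norm.
Qed.

Lemma int1D u v : int1 u -> int1 v -> int1 (fun w => u w + v w).
Proof. by move=> iu iv; exact: (integrableD measurableT iu iv). Qed.

Lemma int1Z c u : int1 u -> int1 (fun w => c * u w).
Proof. by move=> iu; exact: (integrableZl measurableT c iu). Qed.

Lemma int1N u : int1 u -> int1 (fun w => - u w).
Proof. by move=> iu; exact: (integrableN iu). Qed.

Lemma int1B u v : int1 u -> int1 v -> int1 (fun w => u w - v w).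
Proof. by move=> iu iv; apply: int1D => //; exact: int1N. Qed.

Lemma int1_norm u : int1 u -> int1 (fun w => `|u w|).
Proof. by move=> iu; exact: (integrable_abse iu). Qed.

Lemma int1_sum (I : eqType) (s : seq I) (u : I -> T -> R) :
  (forall i, i \in s -> int1 (u i)) -> int1 (fun w => \sum_(i <- s) u i w).
Proof.
elim: s => [|i s IH] us.
  by rewrite (_ : (fun _ => _) = fun=> 0); [exact: int1_cst
    |apply/funext=> w; rewrite big_nil].
rewrite (_ : (fun _ => _) = fun w => u i w + \sum_(i <- s) u i w); last first.
  by apply/funext=> w; rewrite big_cons.
apply: int1D; first by apply: us; rewrite inE eqxx.
by apply: IH => j js; apply: us; rewrite inE js orbT.
Qed.

Lemma ExD u v : int1 u -> int1 v -> Ex (fun w => u w + v w) = Ex u + Ex v.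
Proof. by move=> iu iv; exact: RintegralD. Qed.

Lemma ExB u v : int1 u -> int1 v -> Ex (fun w => u w - v w) = Ex u - Ex v.
Proof. by move=> iu iv; exact: RintegralB. Qed.

Lemma ExZ c u : int1 u -> Ex (fun w => c * u w) = c * Ex u.
Proof. by move=> iu; exact: RintegralZl. Qed.

Lemma Ex_cst c : Ex (fun=> c) = c.
Proof.
rewrite /Ex Rintegral_cst//.
by rewrite (_ : fine _ = 1) ?mulr1//; have := @probability_setT _ _ _ P => /= ->.
Qed.

Lemma le_Ex u v : int1 u -> int1 v -> (forall w, u w <= v w) -> Ex u <= Ex v.
Proof. by move=> iu iv uv; apply: le_Rintegral => // w _; exact: uv. Qed.

Lemma Ex_ge0 u : (forall w, 0 <= u w) -> 0 <= Ex u.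
Proof. by move=> u0; apply: Rintegral_ge0. Qed.

Lemma Ex_norm u : int1 u -> `|Ex u| <= Ex (fun w => `|u w|).
Proof. exact: le_normr_Rintegral. Qed.

Lemma eq_Ex u v : u =1 v -> Ex u = Ex v.
Proof. by move=> uv; congr Ex; exact/funext. Qed.

Lemma Ex_sum (I : eqType) (s : seq I) (u : I -> T -> R) :
  (forall i, i \in s -> int1 (u i)) ->
  Ex (fun w => \sum_(i <- s) u i w) = \sum_(i <- s) Ex (u i).
Proof.
elim: s => [|i s IH] us.
  by rewrite big_nil -[RHS](Ex_cst 0); apply: eq_Ex => w; rewrite big_nil.
rewrite big_cons -IH; last by move=> j js; apply: us; rewrite inE js orbT.
rewrite -ExD.
- by apply: eq_Ex => w; rewrite big_cons.
- by apply: us; rewrite inE eqxx.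
- by apply: int1_sum => j js; apply: us; rewrite inE js orbT.
Qed.

Lemma EFin_Ex u : int1 u -> (Ex u)%:E = (\int[P]_w (u w)%:E)%E.
Proof. by move=> iu; rewrite /Ex /Rintegral fineK//; exact: integrable_fin_num. Qed.

Lemma int1_ge0_fin u r : measurable_fun setT u -> (forall w, 0 <= u w) ->
  (\int[P]_w (u w)%:E <= r%:E)%E -> int1 u.
Proof.
move=> mu u0 ur; apply/integrableP; split; first exact/measurable_EFinP.
apply: (@le_lt_trans _ _ r%:E); last by rewrite ltry.
apply: le_trans ur; rewrite le_eqVlt; apply/orP; left; apply/eqP.
by apply: eq_integral => w _ /=; rewrite ger0_norm.
Qed.

Lemma Ex_cvg (f_ : nat -> T -> R) f g :
  (forall n, measurable_fun setT (f_ n)) ->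
  (forall w, f_ ^~ w @ \oo --> f w) -> int1 g ->
  (forall n w, `|f_ n w| <= g w) ->
  int1 f /\ (Ex (f_ n) @[n --> \oo] --> Ex f).
Proof.
move=> mf ff ig fg.
have mf' n : measurable_fun setT (EFin \o f_ n) by exact/measurable_EFinP.
have := @dominated_convergence _ T R P setT measurableT (fun n => EFin \o f_ n)
  (EFin \o f) (EFin \o g) mf'.
case.
- apply/measurable_EFinP; apply: (measurable_fun_cvg mf) => x _; exact: ff.
- apply: aeW => w _; apply: cvg_EFin; first exact: nearW.
  exact: ff.
- exact: ig.
- by apply: aeW => w n _; rewrite lee_fin.
move=> i1 _ i3; split; first exact: i1.
apply: fine_cvg; rewrite /Rintegral fineK//; exact: integrable_fin_num.
Qed.

End Expectation.

(** * Lipschitz functions of finitely many coordinates *)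

Section Lip1.
Context {R : realType} {I : finType}.
Implicit Types (x y : I -> R) (F : (I -> R) -> R).

Definition l1 x y : R := \sum_i `|x i - y i|.
Definition lip1 (Q : R) F := 0 <= Q /\ forall x y, `|F x - F y| <= Q * l1 x y.

Lemma l1_ge0 x y : 0 <= l1 x y.
Proof. by apply: sumr_ge0. Qed.

Lemma lip1_ub Q F x y : lip1 Q F -> F x <= F y + Q * l1 x y.
Proof. by case=> _ /(_ x y); rewrite ler_norml => /andP[_]; rewrite lerBlDl. Qed.

(* The dense sequence through which infima of Lipschitz functions are seen to
   be measurable. *)
Definition ratpt (k : nat) : I -> R :=
  if (unpickle k : option {ffun I -> rat}) is Some f then (fun i => ratr (f i))
  else (fun=> 0).

Lemma ratpt_dense x (e : R) : 0 < e -> exists k, l1 x (ratpt k) <= e.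
Proof.
move=> e0; pose c := e / (#|I|.+1)%:R.
have c0 : 0 < c by rewrite divr_gt0.
have H i : exists q : rat, `|x i - ratr q| <= c.
  have : x i < x i + c by rewrite ltrDl.
  move=> /rat_in_itvoo[q]; rewrite in_itv/= => /andP[h1 h2]; exists q.
  by rewrite ler_norml; apply/andP; split; lra.
pose f : {ffun I -> rat} := [ffun i => sval (cid (H i))].
exists (pickle f); rewrite /ratpt pickleK /l1.
apply: (@le_trans _ _ (\sum_(i : I) c)).
  by apply: ler_sum => i _; rewrite ffunE; case: cid.
rewrite sumr_const -mulr_natr mulrC /c mulrCA.
by rewrite ger_pMr// ler_pdivrMr// mul1r ler_nat.
Qed.

(** Every cone [F q + Q * l1 x q] lies above [F] by the Lipschitz bound. If its apex [q] is within
    [e / (2 * Q + 1)] of [x], the change of [F] and the slope of the cone each cost [Q] times that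
    distance, so the cone is within [e] of [F x]. *)
Lemma lip1_inf Q F x : lip1 Q F ->
  infs (fun k => F (ratpt k) + Q * l1 x (ratpt k)) 0 = F x.
Proof.
move=> LF; have Q0 := LF.1; apply/eqP; rewrite eq_le; apply/andP; split.
- apply/ler_addgt0Pr => e e0.
  have Q1 : 0 < 2 * Q + 1 by rewrite ltr_wpDl // mulr_ge0.
  have [k xk] := ratpt_dense x (divr_gt0 e0 Q1).
  have : F (ratpt k) + Q * l1 x (ratpt k) <= F x + e.
    have := lip1_ub (ratpt k) x LF.
    have -> : l1 (ratpt k) x = l1 x (ratpt k).
      by apply: eq_bigr => i _; rewrite distrC.
    move=> h; apply: (le_trans (lerD h (lexx _))).
    rewrite -addrA lerD2l -mulrDr.
    rewrite -mulr2n -mulr_natl mulrCA mulrA.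
    apply: (@le_trans _ _ ((2 * Q + 1) * (e / (2 * Q + 1)))).
      by apply: ler_pM => //; rewrite ?mulr_ge0 ?l1_ge0 // lerDl.
    by rewrite mulrCA divff ?mulr1// gt_eqF.
  apply: le_trans; apply: ge_inf; last by exists k.
  exists (F x) => _ [j _ <-].
  exact: lip1_ub.
- apply: lb_le_inf; first by eexists; exists 0.
  by move=> _ [j _ <-]; exact: lip1_ub.
Qed.

(** A countable infimum of cones is measurable as soon as the coordinates are, without a
    sigma-algebra on [I -> R]. *)
Lemma lip1_measurable d (T : measurableType d) Q F (X : I -> T -> R) :
  lip1 Q F -> (forall i, measurable_fun setT (X i)) ->
  measurable_fun setT (fun w => F (X ^~ w)).
Proof.
move=> LF mX.
rewrite (_ : (fun _ => _) = fun w =>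
    infs (fun k => F (ratpt k) + Q * l1 (X ^~ w) (ratpt k)) 0); last first.
  by apply/funext => w; rewrite (lip1_inf _ LF).
apply: (measurable_fun_infs (h := fun k w => F (ratpt k) + Q * l1 (X ^~ w) (ratpt k))).
- by move=> w _; exists (F (X ^~ w)) => _ [j _ <-]; exact: lip1_ub.
- move=> k; apply: measurable_funD => //; apply: measurable_funM => //.
  apply: (@measurable_sum _ _ _ _ _ _ (fun i w => `|X i w - ratpt k i|)) => i.
  by apply: measurableT_comp => //; exact: measurable_funB.
Qed.

End Lip1.

Lemma integral_cst_prob d (T : measurableType d) (R : realType)
  (P : probability T R) (c : \bar R) : (\int[P]_w c = c)%E.
Proof.
rewrite integral_cst// -[RHS]mule1; congr (_ * _)%E; exact: probability_setT.
Qed.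

(** * Product of two probability spaces *)

Section Product.
Context {d1 d2 : measure_display} {T1 : measurableType d1}
  {T2 : measurableType d2} {R : realType}.
Variables (P1 : probability T1 R) (P2 : probability T2 R).

(** The product measure receives a name of its own so that the probability structure can be attached
    to it. *)
Definition prodm : set (T1 * T2) -> \bar R := (P1 \x P2)%E.

HB.instance Definition _ := Measure.on prodm.

Lemma prodm_setT : prodm setT = 1%E.
Proof.
rewrite /prodm -setXTT product_measure1E// -[RHS]mule1.
by congr (_ * _)%E; exact: probability_setT.
Qed.

HB.instance Definition _ := Measure_isProbability.Build _ _ _ prodm prodm_setT.

Definition prodP : probability (T1 * T2)%type R := prodm.

Lemma prodP_tonelli (u : T1 * T2 -> R) : measurable_fun setT u ->
  (forall z, 0 <= u z) ->
  (\int[prodP]_z (u z)%:E = \int[P1]_a \int[P2]_b (u (a, b))%:E)%E.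
Proof.
move=> mu u0; rewrite /prodP /prodm.
rewrite (@fubini_tonelli1 _ _ _ _ _ P1 P2 (EFin \o u))//.
exact/measurable_EFinP.
Qed.

Lemma int1_fst u : int1 P1 u -> int1 prodP (u \o fst).
Proof.
move=> iu; have mu := int1_measurable iu.
have mf : measurable_fun setT (u \o fst : T1 * T2 -> R).
  exact: measurableT_comp.
apply/integrableP; split; first exact/measurable_EFinP.
have := @prodP_tonelli (fun z => `|u z.1|) _ _ => /= ->//.
  under eq_integral => a _.
    rewrite integral_cst_prob; over.
  by case/integrableP : iu.
exact: measurableT_comp.
Qed.

Lemma int1_snd u : int1 P2 u -> int1 prodP (u \o snd).
Proof.
move=> iu; have mu := int1_measurable iu.
have mf : measurable_fun setT (u \o snd : T1 * T2 -> R).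
  exact: measurableT_comp.
apply/integrableP; split; first exact/measurable_EFinP.
have := @prodP_tonelli (fun z => `|u z.2|) _ _ => /= ->//.
  by rewrite integral_cst_prob; case/integrableP : iu.
exact: measurableT_comp.
Qed.

Lemma prodP_fubini (u : T1 * T2 -> R) : int1 prodP u ->
  (forall a, int1 P2 (fun b => u (a, b))) ->
  int1 P1 (fun a => Ex P2 (fun b => u (a, b))) /\
  Ex prodP u = Ex P1 (fun a => Ex P2 (fun b => u (a, b))).
Proof.
move=> iu ia.
have E1 : (fun a => (Ex P2 (fun b => u (a, b)))%:E) =
  fubini_F P2 (EFin \o u).
  by apply/funext => a; rewrite EFin_Ex.
have i1 : int1 P1 (fun a => Ex P2 (fun b => u (a, b))).
  rewrite /int1 (_ : _ \o _ = fubini_F P2 (EFin \o u)).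
    exact: integrable_fubini_F.
  exact: E1.
split => //.
rewrite /Ex [in LHS]/Rintegral [in RHS]/Rintegral; congr fine.
rewrite /prodP /prodm -integral12_prod_meas1//.
by under [RHS]eq_integral => a _ do rewrite -/(Ex P2 _) EFin_Ex//.
Qed.

Lemma measurable_sec (u : T1 * T2 -> R) a : measurable_fun setT u ->
  measurable_fun setT (fun b => u (a, b)).
Proof. by move=> mu; apply: measurableT_comp mu _; exact: measurable_pair1. Qed.

Lemma prodP_fubini_bounded (u : T1 * T2 -> R) M : measurable_fun setT u ->
  (forall z, `|u z| <= M) ->
  Ex prodP u = Ex P1 (fun a => Ex P2 (fun b => u (a, b))).
Proof.
move=> mu uM; apply: (prodP_fubini _ _).2; first exact: (int1_bounded _ mu uM).
by move=> a; apply: (@int1_bounded _ _ _ _ _ M) => //; exact: measurable_sec.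
Qed.

End Product.

(** * Laplace transform, characteristic function and variance of normal laws *)

Lemma measurable_expRM (R : realType) (c : R) :
  measurable_fun setT (fun x => expR (c * x)).
Proof.
apply: measurableT_comp; first exact: measurable_expR.
by apply: (@measurable_funM _ _ _ _ (cst c) id).
Qed.

Section NormalLaw.
Context {R : realType}.
Notation mu := (@lebesgue_measure R).
Variables (m s : R).
Hypothesis s0 : s != 0.
Notation N := (normal_prob m s : probability _ R).

(** The density and the Radon-Nikodym derivative of the normal law have the same integral over every
    measurable set, hence agree almost everywhere; the change of variables known for the latter then
    applies to the former. *)
Lemma ge0_integral_normal (f : R -> \bar R) : (forall x, 0 <= f x)%E ->
  measurable_fun setT f ->
  (\int[N]_x f x = \int[mu]_x (f x * (normal_pdf m s x)%:E))%E.
Proof.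
move=> f0 mf.
have dom := normal_prob_dominates m s.
rewrite -(Radon_Nikodym_SigmaFinite.change_of_variables dom f0 measurableT mf).
apply: ae_eq_integral => //.
- apply: emeasurable_funM => //; apply: (measurable_int mu).
  exact: Radon_Nikodym_SigmaFinite.f_integrable.
- apply: emeasurable_funM => //; apply/measurable_EFinP.
  exact: measurable_normal_pdf.
- apply: ae_eqe_mul2l; apply: integral_ae_eq => //.
  + exact: Radon_Nikodym_SigmaFinite.f_integrable.
  + by apply/measurable_EFinP; exact: measurable_normal_pdf.
  + by move=> E _ mE; rewrite -Radon_Nikodym_SigmaFinite.f_integral.
Qed.

Lemma normal_pdf_shift c x :
  expR (c * x) * normal_pdf m s x =
  expR (m * c + c ^+ 2 * s ^+ 2 / 2) * normal_pdf (m + c * s ^+ 2) s x.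
Proof.
rewrite !normal_pdfE // /normal_fun mulrCA [RHS]mulrCA -!expRD; congr (_ * expR _).
by field; rewrite s0.
Qed.

Lemma normal_mgf c : (\int[N]_x (expR (c * x))%:E =
  (expR (m * c + c ^+ 2 * s ^+ 2 / 2))%:E)%E.
Proof.
rewrite ge0_integral_normal//; last first.
  by apply/measurable_EFinP; exact: measurable_expRM.
under eq_integral => x _ do rewrite -EFinM normal_pdf_shift EFinM.
rewrite ge0_integralZl//=.
- by rewrite integral_normal_pdf mule1.
- by apply/measurable_EFinP; exact: measurable_normal_pdf.
- by move=> x _; rewrite lee_fin normal_pdf_ge0.
Qed.

Lemma int1_normal_expR c : int1 N (fun x => expR (c * x)).
Proof.
apply: int1_ge0_fin; last by rewrite normal_mgf.
- exact: measurable_expRM.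
- by move=> x; exact: expR_ge0.
Qed.

Lemma int1_normal_id : int1 N id.
Proof.
apply: (@int1_le _ _ _ N id (fun x => expR (1 * x) + expR (- 1 * x))).
- exact: measurable_id.
- move=> x; rewrite mul1r mulN1r; have := expR_ge1Dx x; have := expR_ge1Dx (- x).
  have := expR_ge0 x; have := expR_ge0 (- x).
  by move=> a b c d; rewrite ler_norml; apply/andP; split; lra.
- by apply: int1D; exact: int1_normal_expR.
Qed.

Lemma normal_integrable u : int1 N u ->
  mu.-integrable setT (fun x => (u x * normal_pdf m s x)%:E).
Proof.
move=> iu; have mu_ := int1_measurable iu.
apply/integrableP; split.
  by apply/measurable_EFinP; apply: measurable_funM => //; exact: measurable_normal_pdf.
case/integrableP: iu => _; rewrite ge0_integral_normal//; last first.
  by apply: measurableT_comp => //; exact/measurable_EFinP.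
congr (_ < _)%E; apply: eq_integral => x _ /=.
by rewrite -EFinM normrM [`|normal_pdf _ _ _|]ger0_norm// normal_pdf_ge0.
Qed.

Lemma Ex_normal u : int1 N u ->
  Ex N u = \int[mu]_x (u x * normal_pdf m s x).
Proof.
move=> iu; have mu_ := int1_measurable iu.
have p0 x := normal_pdf_ge0 m s x.
rewrite /Ex /Rintegral; congr fine.
rewrite integralE [RHS]integralE; congr (_ - _)%E.
- rewrite ge0_integral_normal//; last first.
    by apply: measurable_funepos; exact/measurable_EFinP.
  apply: eq_integral => x _; rewrite !funeposE /= -!EFin_max -EFinM.
  by rewrite maxr_pMl ?mul0r.
- rewrite ge0_integral_normal//; last first.
    by apply: measurable_funeneg; exact/measurable_EFinP.
  apply: eq_integral => x _; rewrite !funenegE /= -!EFin_max -EFinM.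
  by rewrite maxr_pMl ?mul0r ?mulNr.
Qed.

End NormalLaw.

Section WholeLine.
Context {R : realType}.
Notation mu := (@lebesgue_measure R).

Lemma Rintegral_itvNnn_cvg (h : R -> R) : mu.-integrable setT (EFin \o h) ->
  \int[mu]_(x in `[- n.+1%:R, n.+1%:R]) h x @[n --> \oo] --> \int[mu]_x h x.
Proof.
move=> ih; have mh : measurable_fun setT h.
  by apply/measurable_EFinP; exact: measurable_int ih.
pose f_ (n : nat) : R -> \bar R := (EFin \o h) \_ `[- n.+1%:R, n.+1%:R].
have := @dominated_convergence _ _ R mu setT measurableT f_ (EFin \o h)
  (fun x => `|h x|%:E).
case.
- move=> n; apply: (measurable_restrict _ _ _).1 => //.
  rewrite setTI; apply: measurable_funTS; exact/measurable_EFinP.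
- exact/measurable_EFinP.
- apply: aeW => x _; apply: cvg_near_cst; near=> n.
  rewrite /f_ patchE mem_set//= in_itv/= -ler_norml.
  near: n; exists (Num.truncn `|x|) => // n /= xn.
  apply: ltW; apply: lt_le_trans (truncnS_gt `|x|) _.
  by rewrite ler_nat ltnS.
- exact: integrable_norm ih.
- apply: aeW => x n _; rewrite /f_ patchE; case: ifP => //= _.
  by rewrite lee_fin normr0 normr_ge0.
move=> _ _ i3; rewrite /Rintegral.
rewrite (_ : (fun n : nat => _) = fine \o (fun n => \int[mu]_x f_ n x)%E).
  apply: fine_cvg; rewrite fineK//; exact: integrable_fin_num.
by apply/funext => n /=; rewrite integral_mkcond.
Unshelve. all: by end_near. Qed.

(** The fundamental theorem of calculus on growing segments leaves two boundary terms that vanish in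
    the limit. This serves as integration by parts against the normal density. *)
Lemma Rintegral_derivative0 (g G : R -> R) :
  mu.-integrable setT (EFin \o g) -> continuous g ->
  (forall x : R, is_derive x (1 : R) G (g x)) ->
  G n.+1%:R @[n --> \oo] --> (0 : R) -> G (- n.+1%:R) @[n --> \oo] --> (0 : R) ->
  \int[mu]_x g x = 0.
Proof.
move=> ig cg dG G1 G2.
have H := Rintegral_itvNnn_cvg ig.
have E n : \int[mu]_(x in `[- n.+1%:R, n.+1%:R]) g x = G n.+1%:R - G (- n.+1%:R).
  have cG : continuous G.
    move=> x; apply/differentiable_continuous/derivable1_diffP.
    exact: ex_derive.
  rewrite /Rintegral (@continuous_FTC2 _ g G)//=.
  - by rewrite gtrN.
  - exact: continuous_subspaceT.
  - split.
    + by move=> x _; exact: ex_derive.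
    + exact/cvg_at_right_filter/cG.
    + exact/cvg_at_left_filter/cG.
  - by move=> x _; rewrite derive1E; exact: derive_val.
apply: cvg_unique H _ => //.
rewrite (_ : (fun n : nat => _) = fun n => G n.+1%:R - G (- n.+1%:R)).
  2: by apply/funext => n; exact: E.
have := cvgB G1 G2; rewrite subr0; exact.
Qed.

End WholeLine.

Section NormalCF.
Context {R : realType}.
Notation mu := (@lebesgue_measure R).
Variable s : R.
Hypothesis s0 : s != 0.
Notation N := (normal_prob 0 s : probability _ R).
Notation p := (normal_pdf 0 s).

Lemma is_derive_normal_pdf0 (x : R) :
  is_derive x (1 : R) p (- (x / s ^+ 2) * p x).
Proof.
have D1 : is_derive x (1 : R) (fun y : R => - (y - 0) ^+ 2 / (s ^+ 2 *+ 2))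
    (- (x / s ^+ 2)).
  apply: is_derive_eq.
  rewrite /GRing.scale/=. by field.
have D2 := @is_derive1_comp _ expR _ x _ _ (is_derive_expR _) D1.
rewrite normal_pdfE//.
have := is_deriveM (is_derive_cst (normal_peak s) x (1:R)) D2.
move=> D3; apply: (is_derive_eq D3); rewrite /normal_fun /GRing.scale/=; ring.
Qed.

(** The bound [expR u >= u] at [u = x ^+ 2 / (2 * s ^+ 2)] makes the density decay like
    [1 / x ^+ 2], which a multiple of the harmonic sequence dominates. The boolean [a] selects one
    of the two ends of the line. *)
Lemma normal_pdf0_cvg0 (g : R -> R) (a : bool) : (forall x, `|g x| <= 1) ->
  g ((-1) ^+ a * n.+1%:R) * p ((-1) ^+ a * n.+1%:R) @[n --> \oo] --> (0 : R).
Proof.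
move=> g1.
pose C := normal_peak s * (s ^+ 2 *+ 2).
have C0 : 0 <= C by rewrite mulr_ge0 ?normal_peak_ge0// mulrn_wge0// sqr_ge0.
apply/norm_cvg0P.
apply: (@squeeze_cvgr _ _ _ _ (cst 0) (fun n => C * harmonic n)).
- apply: nearW => n; rewrite normr_ge0/= normrM.
  apply: (@le_trans _ _ (p ((-1) ^+ a * n.+1%:R))).
    rewrite [`|p _|]ger0_norm ?normal_pdf_ge0// ler_piMl// normal_pdf_ge0//.
  rewrite normal_pdfE// /C -mulrA ler_wpM2l ?normal_peak_ge0//.
  rewrite /normal_fun subr0 exprMn sqrr_sign mul1r mulNr expRN.
  rewrite -[leRHS]invrK lef_pV2 ?posrE ?expR_gt0//; last first.
    by rewrite invr_gt0 mulr_gt0 // ?pmulrn_lgt0// ?exprn_even_gt0// invr_gt0.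
  apply: (le_trans _ (expR_ge1Dx _)).
  rewrite invfM invrK mulrC.
  rewrite -[leLHS]add0r lerD// ler_wpM2r// ?invr_ge0 ?mulrn_wge0// ?sqr_ge0//.
  by rewrite expr2 ler_peMl // ler1n.
- exact: cvg_cst.
- rewrite -(mulr0 C); apply: cvgM; [exact: cvg_cst|exact: cvg_harmonic].
Qed.

Lemma continuous_trig (f : R -> R) (th t : R) : continuous f ->
  continuous (fun x : R => f (th + t * x)).
Proof.
move=> cf x; apply: continuous_comp; last exact: cf.
by apply: cvgD; [exact: cvg_cst|apply: cvgM; [exact: cvg_cst|exact: cvg_id]].
Qed.

Lemma measurable_trig (f : R -> R) (th t : R) : continuous f ->
  measurable_fun setT (fun x : R => f (th + t * x)).
Proof. by move=> cf; apply: continuous_measurable_fun; exact: continuous_trig. Qed.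

Lemma normr_cos_le1 (x : R) : `|cos x| <= 1.
Proof. by rewrite ler_norml cos_geN1 cos_le1. Qed.

Lemma normr_sin_le1 (x : R) : `|sin x| <= 1.
Proof. by rewrite ler_norml sin_geN1 sin_le1. Qed.

Lemma is_derive_trig_sin (th t x : R) :
  is_derive x (1 : R) (fun x : R => sin (th + t * x)) (t * cos (th + t * x)).
Proof.
apply: is_derive_eq; rewrite /GRing.scale/=; ring.
Qed.

(** Stein's operator [s ^+ 2 * g' - x * g] at [g x = sin (th + t * x)]. Multiplied by the density it
    is the derivative of [s ^+ 2 * g * p], so its expectation is 0. *)
Let stein th t x := s ^+ 2 * t * cos (th + t * x) - x * sin (th + t * x).

Lemma int1_stein th t : int1 N (stein th t).
Proof.
apply: int1B.
  apply: (@int1Z _ _ _ N); apply: (@int1_bounded _ _ _ N _ 1).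
    by apply: measurable_trig; exact: continuous_cos.
  by move=> x; exact: normr_cos_le1.
apply: (@int1_le _ _ _ N _ (fun x : R => `|x|)).
- apply: measurable_funM; first exact: measurable_id.
  by apply: measurable_trig; exact: continuous_sin.
- by move=> x; rewrite normrM ler_piMr// normr_sin_le1.
- apply: int1_norm; exact: int1_normal_id.
Qed.

Lemma Ex_stein th t : Ex N (stein th t) = 0.
Proof.
have iu := int1_stein th t.
rewrite Ex_normal//.
apply: (@Rintegral_derivative0 _ _ (fun x => s ^+ 2 * (sin (th + t * x) * p x))).
- exact: normal_integrable.
- move=> x; apply: cvgM; last exact: continuous_normal_pdf.
  apply: cvgB; apply: cvgM.
  + exact: cvg_cst.
  + exact: (continuous_trig (@continuous_cos _)).
  + exact: cvg_id.
  + exact: (continuous_trig (@continuous_sin _)).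
- move=> x; have D := is_deriveM (is_derive_trig_sin th t x) (is_derive_normal_pdf0 x).
  have D2 := is_deriveZ (s ^+ 2) D.
  apply: (is_derive_eq D2); rewrite /GRing.scale/= /stein.
  by field.
- rewrite -[X in _ --> X](mulr0 (s ^+ 2)); apply: cvgM; first exact: cvg_cst.
  have := @normal_pdf0_cvg0 (fun x => sin (th + t * x)) false (fun x => normr_sin_le1 _).
  by under eq_fun do rewrite expr0 mul1r.
- rewrite -[X in _ --> X](mulr0 (s ^+ 2)); apply: cvgM; first exact: cvg_cst.
  have := @normal_pdf0_cvg0 (fun x => sin (th + t * x)) true (fun x => normr_sin_le1 _).
  by under eq_fun do rewrite expr1 mulN1r.
Qed.

Lemma int1_cos th t : int1 N (fun x : R => cos (th + t * x)).
Proof.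
apply: (@int1_bounded _ _ _ N _ 1).
  by apply: measurable_trig; exact: continuous_cos.
by move=> x; exact: normr_cos_le1.
Qed.

(** The derivative in [t] of [expR (s ^+ 2 / 2 * t ^+ 2)] times the left-hand side is a multiple of
    the expectation of [stein], hence 0, and at [t = 0] the value is [cos th]. The phase [th] lets
    one real formula carry both the real and the imaginary part of the characteristic function. *)
Lemma normal_cf th t :
  Ex N (fun x : R => cos (th + t * x)) = cos th * expR (- (t ^+ 2 * s ^+ 2 / 2)).
Proof.
pose f (t x : R) := expR (s ^+ 2 / 2 * t ^+ 2) * cos (th + t * x).
have Df (t0 x : R) : is_derive t0 (1 : R) (f ^~ x)
    (expR (s ^+ 2 / 2 * t0 ^+ 2) * stein th t0 x).
  have D1 : is_derive t0 (1 : R) (fun t : R => s ^+ 2 / 2 * t ^+ 2) (s ^+ 2 * t0).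
    apply: is_derive_eq; rewrite /GRing.scale/=; by field.
  have D2 := @is_derive1_comp _ expR _ t0 _ _ (is_derive_expR _) D1.
  have D3 : is_derive t0 (1 : R) (fun t : R => cos (th + t * x)) (- (x * sin (th + t0 * x))).
    apply: is_derive_eq; rewrite /GRing.scale/=; ring.
  apply: (is_derive_eq (is_deriveM D2 D3)).
  rewrite /GRing.scale/= /stein; ring.
have intf t0 : int1 N (f t0) by apply: int1Z; exact: int1_cos.
pose F t := Ex N (f t).
have dF (a : R) : is_derive a (1 : R) F 0.
  (* Domination for differentiating under the integral: on []a - 1, a + 1[] the parameter is at most
     [|a| + 1] in absolute value, so the derivative is bounded by a function affine in [|y|]. *)
  pose C := expR (s ^+ 2 / 2 * (`|a| + 1) ^+ 2).
  have C0 : 0 <= C by exact: expR_ge0.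
  pose G (y : R) := C * (s ^+ 2 * (`|a| + 1) + `|y|).
  have G0 y : 0 <= G y.
    by rewrite mulr_ge0// addr_ge0// mulr_ge0// ?sqr_ge0// addr_ge0.
  have iG : int1 N G.
    apply: int1Z; apply: int1D; first exact: int1_cst.
    apply: int1_norm; exact: int1_normal_id.
  have Ia : `]a - 1, a + 1[%classic a by rewrite /= in_itv/=; apply/andP; split; lra.
  have df1 x y : `]a - 1, a + 1[%classic x -> [set: R] y -> derivable (f ^~ y) x 1.
    by move=> _ _; exact: ex_derive.
  have G_ub x y : `]a - 1, a + 1[%classic x -> [set: R] y ->
      `|partial1of2 f x y| <= G y.
    rewrite /= in_itv/= => /andP[x1 x2] _; rewrite partial1of2E.
    have -> := @derive_val _ _ _ _ _ _ _ (Df x y).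
    have xa : `|x| <= `|a| + 1.
      have := ler_norm a; have := ler_norm (- a); rewrite normrN => h1 h2.
      by rewrite ler_norml; apply/andP; split; lra.
    rewrite normrM ler_pM//.
      rewrite ger0_norm ?expR_ge0// ler_expR ler_wpM2l// ?divr_ge0 ?sqr_ge0//.
      by rewrite -(real_normK (num_real x)) lerXn2r ?nnegrE ?addr_ge0.
    apply: (le_trans (ler_normB _ _)); apply: lerD.
      rewrite normrM [`|_ * x|]normrM (ger0_norm (sqr_ge0 _)) -mulrA ler_wpM2l ?sqr_ge0//.
      by rewrite (le_trans _ xa)// ler_piMr// normr_cos_le1.
    by rewrite normrM ler_piMr// normr_sin_le1.
  have D := @derivable_under_integral _ _ _ N f setT measurableT a (a-1) (a+1)
    Ia (fun x _ => intf x) df1 G G0 iG G_ub.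
  have E := @differentiation_under_integral _ _ _ N f setT measurableT a (a-1) (a+1)
    Ia (fun x _ => intf x) df1 G G0 iG G_ub.
  apply: DeriveDef; first exact: D.
  rewrite -derive1E E.
  transitivity (Ex N (fun y => expR (s ^+ 2 / 2 * a ^+ 2) * stein th a y)).
    apply: eq_Rintegral => y _; rewrite partial1of2E.
    by have -> := @derive_val _ _ _ _ _ _ _ (Df a y).
  by rewrite ExZ ?Ex_stein ?mulr0//; exact: int1_stein.
have : F t = F 0 by exact: is_derive_0_is_cst.
rewrite /F /f ExZ ?int1_cos// ExZ ?int1_cos// expr0n/= mulr0 expR0 mul1r.
under [X in _ = Ex _ X -> _]eq_fun do rewrite mul0r addr0.
rewrite Ex_cst => <-; rewrite mulrAC -expRD.
by rewrite (_ : _ + _ = 0) ?expR0 ?mul1r//; lra.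
Qed.

End NormalCF.

Section TrigonometricBounds.
Context {R : realType}.

Lemma sin_div_cvg (x : R) : n.+1%:R * sin (x / n.+1%:R) @[n --> \oo] --> x.
Proof.
have D : is_derive (0 : R) (1 : R) (fun t : R => sin (x * t)) x.
  apply: is_derive_eq; rewrite /GRing.scale/= ?mulr0 ?cos0; ring.
pose f := fun t : R => sin (x * t).
have H : h^-1 *: ((f \o shift (0 : R)) (h *: (1 : R)) - f 0) @[h --> 0^'] --> x.
  have E := @derive_val _ _ _ _ _ _ _ D.
  by have := @ex_derive _ _ _ _ _ _ _ D; rewrite /derivable -[X in _ -> _ --> X]E.
have cv0 : (n.+1%:R : R)^-1 @[n --> \oo] --> (0 : R) by exact: cvg_harmonic.
move/cvgr_dnbhsP : H => /(_ (fun n => n.+1%:R^-1)) H.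
have := H (conj (fun n => _) cv0).
have nz (n : nat) : (n.+1%:R : R)^-1 != 0 by rewrite invr_eq0.
move=> /(_ nz); apply: cvg_trans; apply: near_eq_cvg; apply: nearW => n /=; rewrite /f.
by rewrite invrK mulr0 sin0 subr0 addr0 /GRing.scale/= mulr1.
Qed.

Lemma normr_sin_le_id (y : R) : `|sin y| <= `|y|.
Proof.
wlog y0 : y / 0 < y => [H|].
  have [y0|y0|<-] := ltrgtP 0 y; first exact: H.
    by rewrite -normrN -sinN -[leRHS]normrN H// oppr_gt0.
  by rewrite sin0 normr0.
have [c _] := @MVT R sin cos 0 y y0 (fun x _ => is_derive_sin x)
  (continuous_subspaceT (@continuous_sin R)).
by rewrite sin0 !subr0 => ->; rewrite normrM ler_piMl// normr_cos_le1.
Qed.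

Lemma sqr_le_expR (x : R) : x ^+ 2 <= 2 * (expR (1 * x) + expR (-1 * x)).
Proof.
have H (y : R) : 0 <= y -> y ^+ 2 <= 2 * expR y.
  move=> y0; have := expR_ge1Dxn 1 y0; rewrite (_ : 2`!%:R = 2 :> R)// => h; lra.
rewrite mul1r mulN1r.
have [x0|x0] := leP 0 x.
  have := H _ x0; have := expR_ge0 (- x); lra.
have := H (- x); rewrite sqrrN => /(_ _); have := expR_ge0 x; lra.
Qed.

End TrigonometricBounds.

Section NormalSq.
Context {R : realType}.
Variable s : R.
Hypothesis s0 : s != 0.
Notation N := (normal_prob 0 s : probability _ R).

(** The functions [x * (n+1) * sin (x / (n+1))] converge to [x ^+ 2] and are dominated by it. Their
    expectations are known from [Ex_stein] and [normal_cf] at [t = 1 / (n+1)], and tend to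
    [s ^+ 2]. *)
Lemma normal_sqr : int1 N (fun x : R => x ^+ 2) /\ Ex N (fun x : R => x ^+ 2) = s ^+ 2.
Proof.
have ig : int1 N (fun x : R => x ^+ 2).
  apply: (@int1_le _ _ _ N _ (fun x : R => 2 * (expR (1 * x) + expR (-1 * x)))).
  - by apply: measurable_funX; exact: measurable_id.
  - by move=> x; rewrite ger0_norm ?sqr_ge0// sqr_le_expR.
  - apply: int1Z; apply: int1D; exact: int1_normal_expR.
split => //.
pose f_ (n : nat) (x : R) := n.+1%:R * (x * sin (0 + n.+1%:R^-1 * x)).
have mf n : measurable_fun setT (f_ n).
  apply: measurable_funM => //; apply: measurable_funM; first exact: measurable_id.
  by apply: measurable_trig; exact: continuous_sin.
have [] := @Ex_cvg _ _ _ N f_ (fun x => x ^+ 2) (fun x => x ^+ 2) mf _ ig.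
- move=> x; rewrite /f_ expr2.
  under eq_fun do rewrite add0r mulrCA [_^-1 * x]mulrC.
  by apply: cvgM; [exact: cvg_cst|exact: sin_div_cvg].
- move=> n x; rewrite /f_ add0r !normrM.
  rewrite (le_trans (ler_wpM2l _ (ler_wpM2l _ (normr_sin_le_id _))))// normrM.
  rewrite [`|n.+1%:R|]ger0_norm// [`|_^-1|]ger0_norm ?invr_ge0//.
  have -> : n.+1%:R * (`|x| * (n.+1%:R^-1 * `|x|)) = `|x| ^+ 2 :> R.
    have : (n.+1%:R : R) != 0 by rewrite pnatr_eq0.
    by set c := n.+1%:R => c0; field.
  by rewrite real_normK// num_real.
move=> _ H.
have E n : Ex N (f_ n) = s ^+ 2 * expR (- ((n.+1%:R^-1) ^+ 2 * s ^+ 2 / 2)).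
  have St := Ex_stein s0 0 n.+1%:R^-1.
  rewrite ExB in St; last 2 first.
  - by apply: int1Z; exact: int1_cos.
  - apply: (@int1_le _ _ _ N _ (fun x : R => `|x|)).
    + apply: measurable_funM; first exact: measurable_id.
      by apply: measurable_trig; exact: continuous_sin.
    + by move=> x; rewrite normrM ler_piMr// normr_sin_le1.
    + apply: int1_norm; exact: int1_normal_id.
  rewrite ExZ in St; last exact: int1_cos.
  rewrite normal_cf // cos0 mul1r in St.
  rewrite /f_ ExZ; last first.
    apply: (@int1_le _ _ _ N _ (fun x : R => `|x|)).
    + apply: measurable_funM; first exact: measurable_id.
      by apply: measurable_trig; exact: continuous_sin.
    + by move=> x; rewrite normrM ler_piMr// normr_sin_le1.
    + apply: int1_norm; exact: int1_normal_id.
  move/eqP: St; rewrite subr_eq0 => /eqP <-.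
  by rewrite mulrA [_ * (s ^+ 2 * _)]mulrCA mulfV// mulr1.
have K : s ^+ 2 * expR (- ((n.+1%:R^-1) ^+ 2 * s ^+ 2 / 2)) @[n --> \oo] --> s ^+ 2.
  have K1 : (n.+1%:R^-1) ^+ 2 * s ^+ 2 / 2 @[n --> \oo] --> (0 : R).
    have K3 : harmonic n * harmonic n * (s ^+ 2 / 2) @[n --> \oo] -->
        (0 * 0 * (s ^+ 2 / 2) : R).
      by apply: cvgM; [apply: cvgM; exact: cvg_harmonic|exact: cvg_cst].
    rewrite !mul0r in K3; apply: cvg_trans K3; apply: near_eq_cvg.
    by apply: nearW => n /=; rewrite -[in RHS]mulrA [in RHS]expr2.
  have K2 : - ((n.+1%:R^-1) ^+ 2 * s ^+ 2 / 2) @[n --> \oo] --> (0 : R).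
    by rewrite -oppr0; apply: cvgN.
  have K3 := continuous_cvg _ (@continuous_expR R 0) K2.
  have : s ^+ 2 * expR (- ((n.+1%:R^-1) ^+ 2 * s ^+ 2 / 2)) @[n --> \oo] -->
      s ^+ 2 * expR 0 by apply: cvgM; [exact: cvg_cst|exact: K3].
  by rewrite expR0 mulr1.
apply: cvg_unique H _ => //.
by apply: cvg_trans K; apply: near_eq_cvg; apply: nearW => n; rewrite -E.
Qed.

End NormalSq.

(** * Centered Gaussian variables, possibly degenerate *)

Section GaussianRV.
Context {disp : measure_display} {T : measurableType disp} {R : realType}.
Variable P : probability T R.

Section Law.
Variables (X : T -> R) (Q : probability (measurableTypeR R) R).
Hypothesis mX : measurable_fun setT X.
Hypothesis lawX : forall A : set R, measurable A -> P (X @^-1` A) = Q A.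

Lemma ge0_integral_law (f : R -> \bar R) : (forall x, 0 <= f x)%E ->
  measurable_fun setT f -> (\int[P]_w f (X w) = \int[Q]_x f x)%E.
Proof.
move=> f0 mf.
rewrite -(@ge0_integral_pushforward _ _ T (measurableTypeR R) R X mX P setT f measurableT mf) => [|y _]; last exact: f0.
apply: eq_measure_integral => A mA _; exact: lawX.
Qed.

Lemma int1_law (f : R -> R) : int1 Q f -> int1 P (f \o X).
Proof.
move=> iu; have mf := int1_measurable iu; apply/integrableP; split.
  by apply/measurable_EFinP; exact: measurableT_comp.
have := @ge0_integral_law (fun x => `|f x|%:E) _ _ => /= ->//.
- by case/integrableP: iu.
- by apply/measurable_EFinP; exact: measurableT_comp.
Qed.

Lemma Ex_law (f : R -> R) : measurable_fun setT f -> Ex P (f \o X) = Ex Q f.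
Proof.
move=> mf; rewrite /Ex /Rintegral; congr fine.
rewrite integralE [RHS]integralE; congr (_ - _)%E.
- rewrite -(@ge0_integral_law ((EFin \o f)^\+)%E)//.
    by apply: eq_integral => x _; rewrite !funeposE.
  by apply: measurable_funepos; exact/measurable_EFinP.
- rewrite -(@ge0_integral_law ((EFin \o f)^\-)%E)//.
    by apply: eq_integral => x _; rewrite !funenegE.
  by apply: measurable_funeneg; exact/measurable_EFinP.
Qed.

End Law.

(** Written in terms of the variance [v], the formulas are the same for normal and Dirac laws, so
    that no later argument has to distinguish the two. *)
Lemma gaussian_rvP (X : T -> R) : measurable_fun setT X -> gaussian_rv P X ->
  Ex P X = 0 -> exists v : R, [/\ 0 <= v,
    forall c, (\int[P]_w (expR (c * X w))%:E = (expR (c ^+ 2 * v / 2))%:E)%E,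
    forall th t, Ex P (fun w => cos (th + t * X w)) = cos th * expR (- (t ^+ 2 * v / 2)),
    int1 P (fun w => X w ^+ 2) & Ex P (fun w => X w ^+ 2) = v].
Proof.
move=> mX [[m [s [s0 law]]]|[m law]] EX0.
- have s0' : s != 0 by rewrite gt_eqF.
  pose Q : probability (measurableTypeR R) R := normal_prob m s.
  have lawQ : forall A : set R, measurable A -> P (X @^-1` A) = Q A by exact: law.
  (* Integrating [1 + c * x <= expR (c * x)] under a law of mean 0 gives
     [0 <= m * c + c ^+ 2 * s ^+ 2 / 2] for every [c]. At the minimiser [c = - m / s ^+ 2] the
     right-hand side is [- m ^+ 2 / (2 * s ^+ 2)]. *)
  have m0 : m = 0.
    have EQ : Ex Q id = 0 by rewrite -EX0 -(Ex_law mX lawQ) //; exact: measurable_id.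
    have H (c : R) : 1 <= expR (m * c + c ^+ 2 * s ^+ 2 / 2).
      rewrite -lee_fin -(normal_mgf m s0') -EFin_Ex; last exact: int1_normal_expR.
      rewrite lee_fin.
      have -> : 1 = Ex Q (fun x => 1 + c * x).
        rewrite ExD ?Ex_cst ?ExZ ?[Ex _ _]EQ ?mulr0 ?addr0//.
        - exact: int1_normal_id.
        - exact: int1_cst.
        - by apply: int1Z; exact: int1_normal_id.
      apply: le_Ex.
      - apply: int1D; first exact: int1_cst.
        by apply: int1Z; exact: int1_normal_id.
      - exact: int1_normal_expR.
      - by move=> x; exact: expR_ge1Dx.
    have := H (- m / s ^+ 2); rewrite -[leLHS]expR0 ler_expR.
    have s20 : 0 < s ^+ 2 by rewrite exprn_gt0.
    have -> : m * (- m / s ^+ 2) + (- m / s ^+ 2) ^+ 2 * s ^+ 2 / 2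
       = - (m ^+ 2 / (s ^+ 2 * 2)) by field.
    rewrite oppr_ge0 pmulr_lle0 ?invr_gt0 ?mulr_gt0//.
    by rewrite real_exprn_even_le0 ?num_real//= => /eqP.
  subst m; exists (s ^+ 2); split.
  - exact: sqr_ge0.
  - move=> c; have := @ge0_integral_law X Q mX lawQ (fun x => (expR (c * x))%:E).
    move=> ->; first by rewrite normal_mgf// mul0r add0r.
    + by move=> x; rewrite lee_fin expR_ge0.
    + by apply/measurable_EFinP; exact: measurable_expRM.
  - move=> th t; rewrite -(normal_cf s0').
    apply: (Ex_law mX lawQ (f := fun x => cos (th + t * x))).
    by apply: measurable_trig; exact: continuous_cos.
  - by apply: (int1_law mX lawQ (f := fun x => x ^+ 2)); exact: (normal_sqr s0').1.
  - rewrite -(normal_sqr s0').2; apply: (Ex_law mX lawQ (f := fun x => x ^+ 2)).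
    by apply: measurable_funX; exact: measurable_id.
- pose Q : probability (measurableTypeR R) R := @dirac _ (measurableTypeR R) m R.
  have lawQ : forall A : set R, measurable A -> P (X @^-1` A) = Q A by exact: law.
  have EQ (f : R -> R) : measurable_fun setT f -> Ex P (f \o X) = f m.
    move=> mf; rewrite (Ex_law mX lawQ mf) /Ex /Rintegral integral_dirac//.
    - by rewrite diracT mul1e.
    - exact/measurable_EFinP.
  have m0 : m = 0.
    by rewrite -EX0; apply/esym; apply: (EQ id); exact: measurable_id.
  subst m; exists 0; split => //.
  - move=> c; have := @ge0_integral_law X Q mX lawQ (fun x => (expR (c * x))%:E).
    move=> ->.
    + rewrite integral_dirac//; first by rewrite diracT mul1e !mulr0 mul0r.
      by apply/measurable_EFinP; exact: measurable_expRM.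
    + by move=> x; rewrite lee_fin expR_ge0.
    + by apply/measurable_EFinP; exact: measurable_expRM.
  - move=> th t; rewrite (EQ (fun x => cos (th + t * x))).
      by rewrite !mulr0 addr0 mul0r oppr0 expR0 mulr1.
    by apply: measurable_trig; exact: continuous_cos.
  - apply: (int1_law mX lawQ (f := fun x => x ^+ 2)).
    apply: int1_ge0_fin; last first.
    + rewrite integral_dirac//.
        by rewrite diracT mul1e.
      by apply/measurable_EFinP; apply: measurable_funX; exact: measurable_id.
    + by move=> x; exact: sqr_ge0.
    + by apply: measurable_funX; exact: measurable_id.
  - rewrite (EQ (fun x => x ^+ 2)) ?expr0n//.
Qed.

End GaussianRV.

(** * Bernstein polynomials *)

Section Bernstein.
Context {R : realType}.

(* [bern m g y] is the expectation of [g S] for [S] binomial of parameters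
   [m] and [y], that is, the Bernstein polynomial of [g]. *)
Fixpoint bern (m : nat) (g : nat -> R) (y : R) : R :=
  if m is m'.+1 then y * bern m' (g \o succn) y + (1 - y) * bern m' g y
  else g 0%N.

Lemma bern_le m (g h : nat -> R) y : 0 <= y <= 1 ->
  (forall k, g k <= h k) -> bern m g y <= bern m h y.
Proof.
move=> /andP[y0 y1]; elim: m g h => [|m IH] g h gh //=.
by apply: lerD; apply: ler_wpM2l; rewrite ?subr_ge0//; apply: IH => k; exact: gh.
Qed.

Lemma bern_lin m (g h : nat -> R) (a c y : R) :
  bern m (fun k => a * g k + c * h k) y = a * bern m g y + c * bern m h y.
Proof.
elim: m g h => [|m IH] g h //=.
rewrite (_ : _ \o succn = fun k => a * (g \o succn) k + c * (h \o succn) k)//.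
rewrite !IH; ring.
Qed.

Lemma bern_cst m (a y : R) : bern m (fun=> a) y = a.
Proof.
elim: m => [|m IH] //=; rewrite (_ : _ \o succn = fun=> a)// IH; ring.
Qed.

(** At [a = 0] this is the binomial variance. The shift [a] is there for the induction: one trial
    changes it to [a + (1 - y)] or to [a - y]. *)
Lemma bern_sqr m (y a : R) :
  bern m (fun k => (k%:R + a - m%:R * y) ^+ 2) y = m%:R * (y * (1 - y)) + a ^+ 2.
Proof.
elim: m a => [|m IH] a /=; first by ring.
rewrite (_ : _ \o succn = fun k => (k%:R + (a + (1 - y)) - m%:R * y) ^+ 2); last first.
  by apply/funext => k /=; rewrite -!natr1; congr (_ ^+ 2); ring.
rewrite (_ : (fun k => (k%:R + a - m.+1%:R * y) ^+ 2) = fun k => (k%:R + (a - y) - m%:R * y) ^+ 2); last first.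
  by apply/funext => k /=; rewrite -!natr1; congr (_ ^+ 2); ring.
rewrite !IH -natr1; ring.
Qed.

(** The value [v] stands for the function at the point [L * (2 * y - 1)] of [[- L, L]]. With
    [r = m + 1] and [r ^+ 2] trials, the bound [2 * t / r ^+ 2 <= 1 / r + t ^+ 2 / r ^+ 3] reduces
    the mean deviation to the variance, and [1 + y * (1 - y) <= 2]. *)
Lemma bern_dist (m : nat) (y v : R) (g : nat -> R) (Q L : R) :
  0 <= y <= 1 -> 0 <= Q -> 0 <= L ->
  (forall k, `|v - g k| <= Q * `|L * (2 * y - 1) - L * (2 * (k%:R / (m.+1 ^ 2)%:R) - 1)|) ->
  `|v - bern (m.+1 ^ 2) g y| <= 2 * Q * L / m.+1%:R.
Proof.
move=> y01 Q0 L0 vg.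
pose M := (m.+1 ^ 2)%N; pose r : R := m.+1%:R.
have r0 : 0 < r by rewrite ltr0n.
have MrE : M%:R = r ^+ 2 :> R by rewrite /M natrX.
pose D k := Q * L * (r^-1 + r^-1 ^+ 3 * (k%:R + 0 - M%:R * y) ^+ 2).
have vgD k : `|v - g k| <= D k.
  apply: le_trans (vg k) _; rewrite /D -mulrA ler_wpM2l// -mulrBr normrM ger0_norm// ler_wpM2l//.
  rewrite -/M MrE addr0.
  have -> : 2 * y - 1 - (2 * (k%:R / r ^+ 2) - 1) = - (2 * (k%:R - r ^+ 2 * y) / r ^+ 2).
    by field; rewrite gt_eqF.
  rewrite normrN !normrM (ger0_norm (_ : 0 <= 2))// [`|_^-1|]ger0_norm ?invr_ge0 ?sqr_ge0//.
  set z := k%:R - r ^+ 2 * y.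
  rewrite -(real_normK (num_real z)); set t := `|z|.
  have -> : r^-1 + r^-1 ^+ 3 * t ^+ 2 = 2 * t / r ^+ 2 + r^-1 * (1 - t / r) ^+ 2.
    by field; rewrite gt_eqF.
  by rewrite lerDl mulr_ge0 ?sqr_ge0 ?invr_ge0 ?(ltW r0).
have bD : bern M D y <= 2 * Q * L / r.
  rewrite (_ : D = fun k => (Q * L * r^-1) * (fun=> 1) k +
     (Q * L * r^-1 ^+ 3) * (fun k => (k%:R + 0 - M%:R * y) ^+ 2) k); last first.
    by apply/funext => k; rewrite /D; ring.
  rewrite bern_lin bern_cst bern_sqr MrE.
  have y14 : y * (1 - y) <= 1 by case/andP: y01 => *; nra.
  have -> : Q * L / r * 1 + Q * L * r^-1 ^+ 3 * (r ^+ 2 * (y * (1 - y)) + 0 ^+ 2) =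
    Q * L / r * (1 + y * (1 - y)) by field; rewrite gt_eqF.
  have -> : 2 * Q * L / r = Q * L / r * 2 by ring.
  rewrite ler_wpM2l ?divr_ge0 ?mulr_ge0// ?(ltW r0)//; lra.
apply: le_trans bD; rewrite ler_norml; apply/andP; split.
- rewrite lerNl opprB -[X in _ - X](bern_cst M v y).
  rewrite (_ : _ - _ = 1 * bern M g y + (-1) * bern M (fun=> v) y); last by ring.
  rewrite -bern_lin; apply: bern_le => // k.
  have := vgD k; rewrite ler_norml => /andP[]; lra.
- rewrite -[X in X - _](bern_cst M v y).
  rewrite (_ : _ - _ = 1 * bern M (fun=> v) y + (-1) * bern M g y); last by ring.
  rewrite -bern_lin; apply: bern_le => // k.
  have := vgD k; rewrite ler_norml => /andP[]; lra.
Qed.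

End Bernstein.

(** * Laws determined by characteristic functions *)

Section CramerWold.
Context {R : realType} {I : finType}.
Context {d1 d2 : measure_display} {T1 : measurableType d1}
  {T2 : measurableType d2}.
Variables (P1 : probability T1 R) (P2 : probability T2 R).
Variables (X1 : I -> T1 -> R) (X2 : I -> T2 -> R).
Hypothesis mX1 : forall i, measurable_fun setT (X1 i).
Hypothesis mX2 : forall i, measurable_fun setT (X2 i).
Implicit Types (u v F : (I -> R) -> R) (c x y : I -> R).

(** The class of test functions with equal expectations under both laws. It contains the functions
    [tcos], is stable under linear combinations and suitable uniform limits, and is enlarged until
    it contains the bounded Lipschitz functions of [uu]. *)
Let eqE u := [/\ int1 P1 (fun w => u (X1 ^~ w)), int1 P2 (fun w => u (X2 ^~ w)) &
  Ex P1 (fun w => u (X1 ^~ w)) = Ex P2 (fun w => u (X2 ^~ w))].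

Let tcos (th : R) c x := cos (th + \sum_i c i * x i).

Hypothesis eq_cf : forall th c, 
  Ex P1 (fun w => tcos th c (X1 ^~ w)) = Ex P2 (fun w => tcos th c (X2 ^~ w)).

Let eqED u v : eqE u -> eqE v -> eqE (fun x => u x + v x).
Proof.
move=> [i1 i2 E] [j1 j2 E']; split; [exact: int1D|exact: int1D|].
by rewrite (ExD i1 j1) (ExD i2 j2) E E'.
Qed.

Let eqEZ a u : eqE u -> eqE (fun x => a * u x).
Proof.
move=> [i1 i2 E]; split; [exact: int1Z|exact: int1Z|].
by rewrite (ExZ _ i1) (ExZ _ i2) E.
Qed.

Let eq_eqE u v : u =1 v -> eqE u -> eqE v.
Proof. by move=> /funext ->. Qed.

Let eqE_tcos th c : eqE (tcos th c).
Proof.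
split; last exact: eq_cf.
- apply: (@int1_bounded _ _ _ _ _ 1); last by move=> w; exact: normr_cos_le1.
  apply: measurableT_comp; first by apply: continuous_measurable_fun; exact: continuous_cos.
  apply: measurable_funD => //; apply: measurable_sum => i.
  exact: measurable_funM.
- apply: (@int1_bounded _ _ _ _ _ 1); last by move=> w; exact: normr_cos_le1.
  apply: measurableT_comp; first by apply: continuous_measurable_fun; exact: continuous_cos.
  apply: measurable_funD => //; apply: measurable_sum => i.
  exact: measurable_funM.
Qed.

Variable L : R.
Hypothesis L0 : 0 < L.

(** A variable in [[0, 1]], fit for Bernstein polynomials, with [uu x i = L * (2 * yy i x - 1)]; for
    large [L] the map [uu] is close to the identity. *)
Let yy (i : I) x : R := (1 + sin (x i / L)) / 2.
Let uu x : I -> R := fun i => L * sin (x i / L).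
Let upd x (i : I) (a : R) : I -> R := fun j => if j == i then a else x j.

(** The product formula for sine and cosine: multiplying [tcos th c] by [sin (x i / L)] gives a
    combination of two functions [tcos], with [c i] moved by [1 / L] either way and the phase by a
    quarter turn. *)
Let eqE_yy g i : (forall th c, eqE (fun x => g x * tcos th c x)) ->
  forall th c, eqE (fun x => yy i x * g x * tcos th c x).
Proof.
move=> H th c.
pose cp j := c j + (j == i)%:R / L.
pose cm j := c j - (j == i)%:R / L.
have E (e : R) x : \sum_j (c j + e * ((j == i)%:R / L)) * x j =
    \sum_j c j * x j + e * (x i / L).
  under eq_bigr do rewrite mulrDl.
  rewrite big_split/=; congr (_ + _).
  rewrite (bigD1 i)//= eqxx big1 ?addr0; first by rewrite -mulrA mul1r [L^-1 * _]mulrC.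
  by move=> j /negbTE ->; rewrite mul0r mulr0 mul0r.
have := eqED (eqEZ (1/2) (H th c)) (eqED (eqEZ (1/4) (H (th - pi / 2) cp))
  (eqEZ (1/4) (H (th + pi / 2) cm))).
apply: eq_eqE => x; rewrite /tcos /yy.
have -> : \sum_j cp j * x j = \sum_j c j * x j + x i / L.
  by rewrite -[X in _ + X]mul1r -E; apply: eq_bigr => j _; rewrite /cp mul1r.
have -> : \sum_j cm j * x j = \sum_j c j * x j - x i / L.
  by rewrite -[X in _ - X]mul1r -mulNr -E; apply: eq_bigr => j _; rewrite /cm mulN1r.
set b := \sum_j _; set a := x i / L.
have -> : th - pi / 2 + (b + a) = (th + b) + a - pi / 2 by ring.
have -> : th + pi / 2 + (b - a) = (th + b) - a + pi / 2 by ring.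
rewrite cosBpihalf cosDpihalf sinB sinD; by field.
Qed.

Let eqE_bern m i (g : nat -> (I -> R) -> R) :
  (forall k th c, eqE (fun x => g k x * tcos th c x)) ->
  forall th c, eqE (fun x => bern m (g ^~ x) (yy i x) * tcos th c x).
Proof.
elim: m g => [|m IH] g H th c /=; first exact: H.
have H1 := eqE_yy i (IH (fun k => g k.+1) (fun k => H k.+1)) th c.
have H2 := IH g H th c; have H3 := eqEZ (-1) (eqE_yy i (IH g H) th c).
have := eqED H1 (eqED H2 H3); apply: eq_eqE => x.
rewrite (_ : _ \o succn = fun k => g k.+1 x)//; ring.
Qed.

Let eqE_lim (v : (I -> R) -> R) (v_ : nat -> (I -> R) -> R) C M :
  measurable_fun setT (fun w => v (X1 ^~ w)) ->
  measurable_fun setT (fun w => v (X2 ^~ w)) ->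
  (forall x, `|v x| <= M) ->
  (forall n x, `|v x - v_ n x| <= C / n.+1%:R) ->
  (forall n, eqE (v_ n)) -> eqE v.
Proof.
move=> m1 m2 vM vv ev.
have i1 : int1 P1 (fun w => v (X1 ^~ w)) by exact: (int1_bounded _ m1).
have i2 : int1 P2 (fun w => v (X2 ^~ w)) by exact: (int1_bounded _ m2).
split => //.
have key d (T : measurableType d) (P : probability T R) (X : I -> T -> R) n :
  int1 P (fun w => v (X ^~ w)) -> int1 P (fun w => v_ n (X ^~ w)) ->
  `|Ex P (fun w => v (X ^~ w)) - Ex P (fun w => v_ n (X ^~ w))| <= C / n.+1%:R.
  move=> iv ivn; rewrite -ExB// (le_trans (Ex_norm (int1B iv ivn)))//.
  rewrite -[leRHS](Ex_cst P); apply: le_Ex; [|exact: int1_cst|].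
  - exact/int1_norm/int1B.
  - by move=> w; exact: vv.
apply/eqP; rewrite -subr_eq0 -normr_le0; apply/ler_addgt0Pr => e e0.
rewrite add0r.
have [n Hn] : exists n : nat, 2 * C / n.+1%:R <= e.
  exists (Num.truncn (`|2 * C| / e)).
  rewrite ler_pdivrMr// [e * _]mulrC -ler_pdivrMr//.
  apply: (@le_trans _ _ (`|2 * C| / e)); last by apply: ltW; exact: truncnS_gt.
  by rewrite ler_pM2r ?invr_gt0// ler_norm.
apply: le_trans Hn.
have [j1 j2 Ev] := ev n.
have := key _ _ P1 X1 n i1 j1; have := key _ _ P2 X2 n i2 j2; rewrite Ev.
set a := Ex P1 _; set b := Ex P2 _; set e2 := Ex P2 _ => h1 h2.
have -> : a - b = (a - e2) - (b - e2) by ring.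
apply: (le_trans (ler_normB _ _)); rewrite -mulrA mulr_natl mulr2n; exact: lerD.
Qed.

Let dep (s : seq I) F := forall x y, (forall i, i \in s -> x i = y i) -> F x = F y.

Let measurable_uu d (T : measurableType d) (X : I -> T -> R) Q F :
  (forall i, measurable_fun setT (X i)) -> lip1 Q F ->
  measurable_fun setT (fun w => F (uu (X ^~ w))).
Proof.
move=> mX LF; apply: (lip1_measurable (X := fun i w => L * sin (X i w / L)) LF).
move=> i; apply: measurable_funM => //; apply: measurableT_comp.
  by apply: continuous_measurable_fun; exact: continuous_sin.
exact: measurable_funM.
Qed.

(** Coordinates are removed one at a time. Bernstein interpolation in coordinate [i], at nodes
    spread over [[- L, L]], approximates [F] uniformly by combinations of functions in which that
    coordinate is frozen at a node, and these depend only on the remaining ones. *)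
Let eqE_dep (s : seq I) Q F M : lip1 Q F -> (forall x, `|F x| <= M) -> dep s F ->
  forall th c, eqE (fun x => F (uu x) * tcos th c x).
Proof.
elim: s F => [|i s IH] F LF FM dF th c.
  have := eqEZ (F (fun=> 0)) (eqE_tcos th c); apply: eq_eqE => x.
  by rewrite (dF (uu x) (fun=> 0)).
pose node (n k : nat) := L * (2 * (k%:R / (n.+1 ^ 2)%:R) - 1).
pose G n k x := F (upd x i (node n k)).
have LG n k : lip1 Q (G n k).
  case: LF => Q0 LF; split => // x y; apply: le_trans (LF _ _) _.
  rewrite ler_wpM2l//; apply: ler_sum => j _; rewrite /upd; case: eqP => // _.
  by rewrite subrr normr0.
have dG n k : dep s (G n k).
  move=> x y xy; apply: dF => j; rewrite inE /upd.
  by case: eqP => //= _ /xy.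
have HG n k th' c' : eqE (fun x => G n k (uu x) * tcos th' c' x).
  by apply: IH => // x; exact: FM.
have mF d (T : measurableType d) (X : I -> T -> R) :
    (forall i, measurable_fun setT (X i)) ->
    measurable_fun setT (fun w => F (uu (X ^~ w)) * tcos th c (X ^~ w)).
  move=> mX; apply: measurable_funM; first exact: (measurable_uu mX LF).
  apply: measurableT_comp; first by apply: continuous_measurable_fun; exact: continuous_cos.
  apply: measurable_funD => //; apply: measurable_sum => j.
  exact: measurable_funM.
apply: (@eqE_lim _ (fun n x => bern (n.+1 ^ 2) (fun k => G n k (uu x)) (yy i x) *
   tcos th c x) (2 * Q * L) M).
- exact: mF.
- exact: mF.
- move=> x; rewrite normrM -[leRHS]mulr1; apply: ler_pM => //.
  exact: normr_cos_le1.
- move=> n x; rewrite -mulrBl normrM -[leRHS]mulr1; apply: ler_pM => //; last first.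
    exact: normr_cos_le1.
  apply: bern_dist; rewrite ?(ltW L0)// ?LF.1//.
    rewrite /yy; have := sin_geN1 (x i / L); have := sin_le1 (x i / L).
    by move=> h1 h2; apply/andP; split; lra.
  move=> k; apply: le_trans (LF.2 _ _) _; rewrite ler_wpM2l ?LF.1//.
  rewrite /l1 (bigD1 i)//= big1 ?addr0.
    rewrite /upd eqxx /uu /yy /node le_eqVlt; apply/orP; left; apply/eqP.
    by congr (`|_ - _|); field.
  by move=> j /negbTE ji; rewrite /upd ji subrr normr0.
- move=> n; apply: (@eqE_bern (n.+1 ^ 2) i (fun k x => G n k (uu x))) => k; exact: HG.
Qed.

Lemma eq_Ex_sin Q F M : lip1 Q F -> (forall x, `|F x| <= M) ->
  Ex P1 (fun w => F (fun i => L * sin (X1 i w / L))) =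
  Ex P2 (fun w => F (fun i => L * sin (X2 i w / L))).
Proof.
move=> LF FM; have dF : dep (index_enum I) F.
  by move=> x y xy; congr F; apply/funext => i; rewrite xy// mem_index_enum.
have [_ _] := eqE_dep LF FM dF 0 (fun=> 0).
have E x : tcos 0 (fun=> 0) x = 1.
  by rewrite /tcos big1 ?addr0 ?cos0// => i _; rewrite mul0r.
by under eq_Ex do rewrite E mulr1; under [in RHS]eq_Ex do rewrite E mulr1.
Qed.

End CramerWold.

(** [eq_Ex_sin] compares the laws of [L * sin (X i / L)]. Letting [L] grow recovers [X] itself by
    dominated convergence, [F] being bounded and Lipschitz. *)
Lemma cramer_wold (R : realType) (I : finType) d1 d2 (T1 : measurableType d1)
  (T2 : measurableType d2) (P1 : probability T1 R) (P2 : probability T2 R)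
  (X1 : I -> T1 -> R) (X2 : I -> T2 -> R) (Q M : R) (F : (I -> R) -> R) :
  (forall i, measurable_fun setT (X1 i)) ->
  (forall i, measurable_fun setT (X2 i)) ->
  (forall th c, Ex P1 (fun w => cos (th + \sum_i c i * X1 i w)) =
                Ex P2 (fun w => cos (th + \sum_i c i * X2 i w))) ->
  lip1 Q F -> (forall x, `|F x| <= M) ->
  Ex P1 (fun w => F (X1 ^~ w)) = Ex P2 (fun w => F (X2 ^~ w)).
Proof.
move=> mX1 mX2 cf LF FM.
have key d (T : measurableType d) (P : probability T R) (X : I -> T -> R) :
    (forall i, measurable_fun setT (X i)) ->
    Ex P (fun w => F (fun i => n.+1%:R * sin (X i w / n.+1%:R))) @[n --> \oo] -->
    Ex P (fun w => F (X ^~ w)).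
  move=> mX.
  have [] := @Ex_cvg _ _ _ P (fun n w => F (fun i => n.+1%:R * sin (X i w / n.+1%:R)))
    (fun w => F (X ^~ w)) (fun=> M) => //.
  - move=> n; apply: (lip1_measurable (X := fun i w => n.+1%:R * sin (X i w / n.+1%:R)) LF).
    move=> i; apply: measurable_funM => //; apply: measurableT_comp.
      by apply: continuous_measurable_fun; exact: continuous_sin.
    exact: measurable_funM.
  - move=> w; apply/cvgrPdist_le => e e0.
    have K : \sum_i `|X i w - n.+1%:R * sin (X i w / n.+1%:R)| @[n --> \oo] --> (0 : R).
      have Z : \sum_(i : I) `|X i w - X i w| = 0.
        by rewrite big1// => i _; rewrite subrr normr0.
      rewrite -[X in _ --> X]Z.
      apply: cvg_big => [|i _]; first exact: add_continuous.
      by apply: cvg_norm; apply: cvgB; [exact: cvg_cst|exact: sin_div_cvg].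
    have QK : Q * \sum_i `|X i w - n.+1%:R * sin (X i w / n.+1%:R)| @[n --> \oo] --> Q * (0 : R).
      by apply: cvgM; [exact: cvg_cst|exact: K].
    rewrite mulr0 in QK.
    move/cvgrPdist_le : QK => /(_ e e0); apply: filterS => n.
    rewrite sub0r normrN ger0_norm; last by rewrite mulr_ge0 ?LF.1// sumr_ge0.
    exact: le_trans (LF.2 _ _).
  - exact: int1_cst.
have K1 := key _ _ P1 X1 mX1; have K2 := key _ _ P2 X2 mX2.
apply: cvg_unique K1 _ => //; apply: cvg_trans K2; apply: near_eq_cvg.
by apply: nearW => n; apply/esym; apply: eq_Ex_sin LF FM.
Qed.

(** * Gaussian concentration *)

Section BilinearForm.
Context {R : realType} {I : finType}.
Implicit Types (S : I -> I -> R) (a c g h : I -> R).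

(** For a covariance [S], the vectors [app S g] form the Cameron-Martin space, and [bil S g g] is
    the squared norm of [app S g] in it. *)
Definition bil S a c : R := \sum_i \sum_j a i * S i j * c j.
Definition app S g : I -> R := fun i => \sum_j S i j * g j.

Lemma bil_app S a g : bil S a g = \sum_i a i * app S g i.
Proof.
apply: eq_bigr => i _; rewrite /app mulr_sumr; apply: eq_bigr => j _.
by rewrite mulrA.
Qed.

Lemma bilDl S a a' c (k k' : R) :
  bil S (fun i => k * a i + k' * a' i) c = k * bil S a c + k' * bil S a' c.
Proof.
rewrite /bil !mulr_sumr -big_split/=; apply: eq_bigr => i _.
rewrite !mulr_sumr -big_split/=; apply: eq_bigr => j _; ring.
Qed.

Lemma bilDr S a c c' (k k' : R) :
  bil S a (fun i => k * c i + k' * c' i) = k * bil S a c + k' * bil S a c'.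
Proof.
rewrite /bil !mulr_sumr -big_split/=; apply: eq_bigr => i _.
rewrite !mulr_sumr -big_split/=; apply: eq_bigr => j _; ring.
Qed.

End BilinearForm.

Section InfConvolution.
Context {R : realType} {I : finType}.
Variables (S : I -> I -> R) (F : (I -> R) -> R) (M Q K a : R).
Hypothesis S_ge0 : forall c, 0 <= bil S c c.
Hypothesis F_le : forall x, `|F x| <= M.
Hypothesis F_lip : lip1 Q F.
Hypothesis F_CM : forall x g,
  F (fun i => x i + app S g i) - F x <= K * Num.sqrt (bil S g g).
Hypothesis a_gt0 : 0 < a.
Implicit Types x y g h : I -> R.

Definition sq x : R := \sum_i x i ^+ 2.

Lemma sq_ge0 x : 0 <= sq x.
Proof. by apply: sumr_ge0 => i _; exact: sqr_ge0. Qed.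

Let cost x y : R := F y + a * sq (fun i => x i - y i).
(** The Moreau envelope of [F]. An infimum of quadratics with the same leading part [a * sq x] stays
    below a parabola of that curvature at each point, up to the accuracy with which the infimum is
    attained. *)
Definition infconv x : R := inf (range (cost x)).

Let cost_ge x y : - M <= cost x y.
Proof.
have := F_le y; rewrite ler_norml => /andP[h _].
by rewrite /cost (le_trans h)// lerDl mulr_ge0 ?sq_ge0// ltW.
Qed.

Let has_inf_cost x : has_inf (range (cost x)).
Proof.
split; first by exists (cost x x), x.
by exists (- M) => _ [y _ <-].
Qed.

Let infconv_le x y : infconv x <= cost x y.
Proof. by apply: ge_inf; [exact: (has_inf_cost x).2|exists y]. Qed.

Lemma infconv_le_id x : infconv x <= F x.
Proof.
apply: le_trans (infconv_le x x) _; rewrite /cost /sq big1 ?mulr0 ?addr0//.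
by move=> i _; rewrite subrr expr0n.
Qed.

Lemma infconv_norm x : `|infconv x| <= M.
Proof.
rewrite ler_norml; apply/andP; split.
  by apply: lb_le_inf; [exact: (has_inf_cost x).1|move=> _ [y _ <-]].
apply: le_trans (infconv_le_id x) _.
by have := F_le x; rewrite ler_norml => /andP[].
Qed.

(** In each coordinate [Q * t - a * t ^+ 2 <= Q ^+ 2 / (4 * a)], so the error of the regularisation
    vanishes as [a] grows. *)
Lemma le_infconv x : F x <= infconv x + #|I|%:R * (Q ^+ 2 / (4 * a)).
Proof.
rewrite -lerBlDr; apply: lb_le_inf; first exact: (has_inf_cost x).1.
move=> _ [y _ <-]; rewrite lerBlDr /cost.
apply: le_trans (lip1_ub x y F_lip) _; rewrite -addrA lerD2l.
rewrite /l1 /sq !mulr_sumr mulr_natl -[X in _ + X]sumr_const -big_split/=.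
apply: ler_sum => i _; set z := x i - y i.
rewrite -(real_normK (num_real z)); set t := `|z|.
have -> : a * t ^+ 2 + Q ^+ 2 / (4 * a) = Q * t + a * (t - Q / (2 * a)) ^+ 2.
  by field; rewrite gt_eqF.
by rewrite lerDl mulr_ge0 ?sqr_ge0 ?(ltW a_gt0).
Qed.

Lemma infconv_lip : lip1 Q infconv.
Proof.
split; first exact: F_lip.1.
have key x x' : infconv x - infconv x' <= Q * l1 x x'.
  rewrite lerBlDr addrC -lerBlDr; apply: lb_le_inf; first exact: (has_inf_cost x').1.
  move=> _ [y _ <-]; rewrite lerBlDr.
  (* The competitor [y] for [x'] is translated by [x - x'], which leaves the quadratic part
     unchanged. *)
  apply: le_trans (infconv_le x (fun i => y i + (x i - x' i))) _.
  rewrite /cost (_ : (fun i => x i - _) = fun i => x' i - y i); last first.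
    by apply/funext => i; ring.
  rewrite addrAC lerD2r.
  rewrite (_ : l1 x x' = l1 (fun i => y i + (x i - x' i)) y); last first.
    by apply: eq_bigr => i _; rewrite addrAC subrr add0r.
  exact: lip1_ub.
move=> x x'; rewrite ler_norml key andbT lerNl opprB.
rewrite (_ : l1 x x' = l1 x' x) ?key//.
by apply: eq_bigr => i _; rewrite distrC.
Qed.

Let near_min x e : 0 < e -> exists y, cost x y < infconv x + e.
Proof.
move=> e0; have [_ [y _ <-] h] := inf_adherent e0 (has_inf_cost x).
by exists y.
Qed.

(* An almost minimiser [y] of the cost at [x] provides the almost supergradient
   [2 a (x - y)]; comparing [y] with [y + t S g] bounds its [S]-norm by that of
   the Lipschitz constant [K]. *)
Lemma infconv_supergradient : exists G0 C0 : R, [/\ 0 <= G0, 0 <= C0 &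
  forall x t, 0 < t -> t <= 1 -> exists g, [/\ forall i, `|g i| <= G0,
    bil S g g <= K ^+ 2 + C0 * t &
    forall h, infconv (fun i => x i + h i) <=
      infconv x + \sum_i g i * h i + a * sq h + t ^+ 2]].
Proof.
have M0 : 0 <= M by apply: le_trans (F_le (fun=> 0)).
(* Since [F] and its envelope are bounded by [M], an almost minimiser satisfies
   [a * sq (x - y) <= 2 * M + 1]; hence [r] bounds the coordinates of [x - y]. *)
pose r := Num.sqrt ((2 * M + 1) / a).
pose G0 := 2 * a * r.
have G00 : 0 <= G0 by rewrite !mulr_ge0// ?sqrtr_ge0// ltW.
pose B i := \sum_j `|S i j| * G0.
pose H0 := \sum_i B i ^+ 2.
have H00 : 0 <= H0 by apply: sumr_ge0 => i _; exact: sqr_ge0.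
(* Below, [s ^+ 2 <= K * s + t * (a * H0 + 1)] where [s] is the [S]-norm of [g]. Absorbing
   [K * s <= (K ^+ 2 + s ^+ 2) / 2] doubles the error term. *)
exists G0, (2 * (a * H0 + 1)); split => //.
  by rewrite mulr_ge0// addr_ge0// mulr_ge0// ltW.
move=> x t t0 t1.
have [y yx] := near_min x (exprn_gt0 2 t0).
pose g i := 2 * a * (x i - y i).
have gG0 i : `|g i| <= G0.
  rewrite /g /G0 normrM ger0_norm ?mulr_ge0 ?(ltW a_gt0)// ler_wpM2l ?mulr_ge0 ?(ltW a_gt0)//.
  rewrite -sqrtr_sqr ler_wsqrtr// ler_pdivlMr// mulrC.
  apply: (@le_trans _ _ (a * sq (fun i => x i - y i))).
    rewrite ler_wpM2l ?(ltW a_gt0)// /sq (bigD1 i)//= lerDl.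
    by apply: sumr_ge0 => j _; exact: sqr_ge0.
  have := infconv_norm x; have := F_le y; rewrite !ler_norml => /andP[h1 _] /andP[_ h2].
  have : t ^+ 2 <= 1 by rewrite expr_le1// ltW.
  move: yx; rewrite /cost; lra.
have expand h k : sq (fun i => x i + k * h i - y i) =
    sq (fun i => x i - y i) + 2 * k * (\sum_i (x i - y i) * h i) + k ^+ 2 * sq h.
  rewrite /sq !mulr_sumr -!big_split/=; apply: eq_bigr => i _; ring.
have gh h : \sum_i g i * h i = 2 * a * \sum_i (x i - y i) * h i.
  by rewrite mulr_sumr; apply: eq_bigr => i _; rewrite /g mulrA.
exists g; split => //.
- pose h := app S g.
  have hH0 : sq h <= H0.
    apply: ler_sum => i _; rewrite -(real_normK (num_real (h i))).
    rewrite lerXn2r ?nnegrE//; first by apply: sumr_ge0 => j _; exact: mulr_ge0.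
    apply: le_trans (ler_norm_sum _ _ _) _; apply: ler_sum => j _.
    by rewrite normrM ler_wpM2l.
  have h1 := infconv_le x (fun i => y i + t * h i).
  rewrite /cost (_ : (fun i => x i - (y i + t * h i)) = fun i => x i + (- t) * h i - y i) in h1; last first.
    by apply/funext => i; ring.
  rewrite expand in h1.
  have h2 : F (fun i => y i + t * h i) - F y <= K * (t * Num.sqrt (bil S g g)).
    have := F_CM y (fun i => t * g i + 0 * g i).
    rewrite bilDl bilDr.
    rewrite (_ : _ + _ * _ = t ^+ 2 * bil S g g); last by ring.
    rewrite sqrtrM ?sqr_ge0// sqrtr_sqr (gtr0_norm t0).
    rewrite (_ : (fun i => y i + _) = fun i => y i + t * h i)//.
    apply/funext => i; rewrite /h /app mulr_sumr; congr (_ + _).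
    by apply: eq_bigr => j _; ring.
  have sgh : bil S g g = 2 * a * \sum_i (x i - y i) * h i by rewrite -gh bil_app.
  move: h1 h2 sgh yx; rewrite /cost.
  have := sqr_sqrtr (S_ge0 g); set s := Num.sqrt _ => sE.
  set c := \sum_i (x i - y i) * h i; set z := sq (fun i => x i - y i).
  set Fh := F _ => h1 h2 sgh yx.
  have h3 : t * s ^+ 2 <= t * (K * s + t * (a * H0 + 1)).
    have : a * (t ^+ 2 * sq h) <= a * (t ^+ 2 * H0).
      by rewrite ler_wpM2l ?(ltW a_gt0)// ler_wpM2l// sqr_ge0.
    rewrite sE sgh; rewrite sqrrN in h1; nra.
  rewrite ler_pM2l// in h3.
  have h4 : 0 <= (K - s) ^+ 2 by exact: sqr_ge0.
  rewrite -sE; nra.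
- move=> h; have := infconv_le (fun i => x i + h i) y; rewrite /cost.
  rewrite (_ : (fun i => x i + h i - y i) = fun i => x i + 1 * h i - y i); last first.
    by apply/funext => i; rewrite mul1r.
  rewrite expand gh; move: yx; rewrite /cost expr1n !mul1r => yx h1.
  nra.
Qed.

End InfConvolution.

Lemma expR_lip (R : realType) (B u v : R) : `|u| <= B -> `|v| <= B ->
  `|expR u - expR v| <= expR B * `|u - v|.
Proof.
wlog uv : u v / v <= u => [H uB vB|].
  have [vu|/ltW uv] := leP v u; first exact: H.
  by rewrite distrC [`|u - v|]distrC; exact: H.
move=> uB vB; rewrite !ger0_norm ?subr_ge0 ?ler_expR//.
have h := expR_ge1Dx (v - u).
apply: (@le_trans _ _ (expR u * (u - v))).
  have -> : expR v = expR u * expR (v - u) by rewrite -expRD; congr expR; ring.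
  rewrite -[X in X - _]mulr1 -mulrBr ler_wpM2l ?expR_ge0//; lra.
by rewrite ler_wpM2r ?subr_ge0// ler_expR (le_trans _ uB)// ler_norm.
Qed.

Section GaussianFamily.
Context {R : realType} {I : finType} {disp : measure_display}
  {T : measurableType disp}.
Variables (P : probability T R) (X : I -> T -> R) (S : I -> I -> R).
Implicit Types (a b c : I -> R).

(** The facts on a centered Gaussian vector of covariance [S] on which concentration rests. The
    Laplace transform is only bounded from above, which is what truncation and Fatou's lemma yield
    when independent components are combined. *)
Record gaussian_family := {
  gf_measurable : forall i, measurable_fun setT (X i);
  gf_cf : forall th c, Ex P (fun w => cos (th + \sum_i c i * X i w)) =
    cos th * expR (- (bil S c c / 2));
  gf_mgf : forall c, (\int[P]_w (expR (\sum_i c i * X i w))%:E <=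
    (expR (bil S c c / 2))%:E)%E }.

Hypothesis GX : gaussian_family.
Let mX := gf_measurable GX.

Lemma measurable_lincomb c : measurable_fun setT (fun w => \sum_i c i * X i w).
Proof. by apply: measurable_sum => i; exact: measurable_funM. Qed.

(** Positivity is read off the characteristic function: the expectation of a cosine is at most 1. *)
Lemma gf_ge0 c : 0 <= bil S c c.
Proof.
have : Ex P (fun w => cos (0 + \sum_i c i * X i w)) <= Ex P (fun=> 1).
  apply: le_Ex; [|exact: int1_cst|by move=> w; exact: cos_le1].
  apply: (@int1_bounded _ _ _ _ _ 1); last by move=> w; exact: normr_cos_le1.
  apply: measurableT_comp; first by apply: continuous_measurable_fun; exact: continuous_cos.
  by apply: measurable_funD => //; exact: measurable_lincomb.
rewrite Ex_cst gf_cf// cos0 mul1r expR_le1; lra.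
Qed.

Lemma int1_gf_mgf c : int1 P (fun w => expR (\sum_i c i * X i w)).
Proof.
apply: int1_ge0_fin; last exact: (gf_mgf GX c).
- by apply: measurableT_comp => //; exact: measurable_lincomb.
- by move=> w; exact: expR_ge0.
Qed.

Lemma Ex_gf_mgf_le c :
  Ex P (fun w => expR (\sum_i c i * X i w)) <= expR (bil S c c / 2).
Proof. by rewrite -lee_fin EFin_Ex; [exact: (gf_mgf GX)|exact: int1_gf_mgf]. Qed.

(** For each outcome the sum of absolute values is a signed sum for some choice of signs, so the
    exponential is dominated by the finite sum, over all sign patterns, of exponentials of linear
    forms. *)
Lemma int1_gf_expR_norm (k : R) : 0 <= k ->
  int1 P (fun w => expR (k * \sum_i `|X i w|)).
Proof.
move=> k0.
pose sg (e : {ffun I -> bool}) i : R := k * (-1) ^+ e i.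
apply: (@int1_le _ _ _ _ _ (fun w => \sum_(e <- enum {ffun I -> bool})
  expR (\sum_i sg e i * X i w))).
- apply: measurableT_comp => //; apply: measurable_funM => //.
  by apply: measurable_sum => i; exact: measurableT_comp.
- move=> w; rewrite ger0_norm ?expR_ge0//.
  pose e : {ffun I -> bool} := [ffun i => X i w < 0].
  rewrite (bigD1_seq e) ?mem_enum ?enum_uniq//=.
  rewrite mulr_sumr (_ : \sum_i k * _ = \sum_i sg e i * X i w).
    by rewrite lerDl; apply: sumr_ge0 => e' _; exact: expR_ge0.
  apply: eq_bigr => i _; rewrite /sg ffunE -mulrA; congr (_ * _).
  case: ltP => h /=.
    by rewrite expr1 mulN1r ltr0_norm.
  by rewrite expr0 mul1r ger0_norm.
- by apply: int1_sum => e _; exact: int1_gf_mgf.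
Qed.

Notation PP := (prodP P P).

Lemma prod_cf th a b :
  Ex PP (fun w => cos (th + (\sum_i a i * X i w.1 + \sum_i b i * X i w.2))) =
  cos th * expR (- ((bil S a a + bil S b b) / 2)).
Proof.
rewrite (@prodP_fubini_bounded _ _ _ _ _ _ _ _ 1); last 2 first.
- apply: measurableT_comp; first by apply: continuous_measurable_fun; exact: continuous_cos.
  apply: measurable_funD => //; apply: measurable_funD.
  + by apply: (measurableT_comp (measurable_lincomb a)); exact: measurable_fst.
  + by apply: (measurableT_comp (measurable_lincomb b)); exact: measurable_snd.
- by move=> z; exact: normr_cos_le1.
transitivity (Ex P (fun w => expR (- (bil S b b / 2)) * cos (th + \sum_i a i * X i w))).
  apply: eq_Ex => w /=; rewrite mulrC -(gf_cf GX).
  by apply: eq_Ex => w'; rewrite addrA.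
rewrite ExZ.
  by rewrite gf_cf// mulrCA -expRD; congr (_ * expR _); lra.
apply: (@int1_bounded _ _ _ _ _ 1); last by move=> z; exact: normr_cos_le1.
apply: measurableT_comp; first by apply: continuous_measurable_fun; exact: continuous_cos.
by apply: measurable_funD => //; exact: measurable_lincomb.
Qed.

(** The orthogonal change of variables preserves [bil S a a + bil S b b], because the cross terms
    cancel; both pairs thus have the same characteristic function and [cramer_wold] applies. *)
Lemma rotation_invariance (k s : R) (Q M : R) (G : (I + I -> R) -> R) :
  k ^+ 2 + s ^+ 2 = 1 -> lip1 Q G -> (forall z, `|G z| <= M) ->
  Ex PP (fun w => G (fun i => match i with
     | inl i => s * X i w.1 + k * X i w.2
     | inr i => k * X i w.1 - s * X i w.2 end)) =
  Ex PP (fun w => G (fun i => match i with inl i => X i w.1 | inr i => X i w.2 end)).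
Proof.
move=> ks LG GM.
pose X1 (i : I + I) (w : T * T) := match i with
     | inl i => s * X i w.1 + k * X i w.2
     | inr i => k * X i w.1 - s * X i w.2 end.
pose X2 (i : I + I) (w : T * T) := match i with
     | inl i => X i w.1 | inr i => X i w.2 end.
have m1 i : measurable_fun setT (fun w : T * T => X i w.1).
  by apply: (measurableT_comp (mX i)); exact: measurable_fst.
have m2 i : measurable_fun setT (fun w : T * T => X i w.2).
  by apply: (measurableT_comp (mX i)); exact: measurable_snd.
apply: (@cramer_wold R _ _ _ _ _ PP PP X1 X2 Q M G) => //.
- move=> [i|i]; rewrite /X1.
  + by apply: measurable_funD; exact: measurable_funM.
  + by apply: measurable_funB; exact: measurable_funM.
- by move=> [i|i]; rewrite /X2.
move=> th c; pose a i := c (inl i); pose b i := c (inr i).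
transitivity (cos th * expR (- ((bil S a a + bil S b b) / 2))).
- transitivity (Ex PP (fun w => cos (th +
    (\sum_i (s * a i + k * b i) * X i w.1 + \sum_i (k * a i + (- s) * b i) * X i w.2)))).
    apply: eq_Ex => w; congr (cos (_ + _)).
    rewrite big_sumType/= -!big_split/=; apply: eq_bigr => i _; rewrite /X1 /a /b; ring.
  rewrite prod_cf; congr (_ * expR (- (_ / 2))).
  rewrite !bilDl !bilDr.
  rewrite -[RHS]mul1r -ks; ring.
- rewrite -prod_cf; apply: eq_Ex => w; congr (cos (_ + _)).
  by rewrite big_sumType.
Qed.

End GaussianFamily.

Lemma onem_cos_le (R : realType) (e : R) : 0 <= e -> 1 - cos e <= e ^+ 2.
Proof.
move=> e0; have -> : cos e = 1 - (sin (e / 2)) ^+ 2 *+ 2.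
  have E : e = e / 2 + e / 2 by field.
  rewrite [in LHS]E cosD -!expr2 mulr2n; have := cos2Dsin2 (e / 2); lra.
have : (sin (e / 2)) ^+ 2 <= (e / 2) ^+ 2.
  rewrite -(real_normK (num_real (sin _))) lerXn2r ?nnegrE ?divr_ge0//.
  by apply: (le_trans (normr_sin_le_id _)); rewrite ger0_norm// divr_ge0.
have := sqr_ge0 (sin (e / 2)); nra.
Qed.

(** * The Maurey-Pisier rotation argument *)

Section MaureyPisier.
Context {R : realType} {I : finType} {disp : measure_display}
  {T : measurableType disp}.
Variables (P : probability T R) (X : I -> T -> R) (S : I -> I -> R).
Hypothesis GX : gaussian_family P X S.
Let mX := gf_measurable GX.
Notation PP := (prodP P P).

Section Semiconcave.
Variables (G : (I -> R) -> R) (M Q K a G0 C0 l : R).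
Hypothesis G_le : forall x, `|G x| <= M.
Hypothesis G_lip : lip1 Q G.
Hypothesis a_ge0 : 0 <= a.
Hypothesis l_ge0 : 0 <= l.
Hypothesis G0_ge0 : 0 <= G0.
Hypothesis C0_ge0 : 0 <= C0.
Hypothesis G_grad : forall (x : I -> R) (t : R), 0 < t -> t <= 1 -> exists g, [/\ forall i, `|g i| <= G0,
    bil S g g <= K ^+ 2 + C0 * t &
    forall h : I -> R, G (fun i => x i + h i) <=
      G x + \sum_i g i * h i + a * sq h + t ^+ 2].

Section Step.
Implicit Types x g : I -> R.
Variable n : nat.
Let N : R := n.+1%:R.
Let ep : R := (pi / 2) / N.

Let N0 : 0 < N. Proof. by rewrite ltr0n. Qed.
Let N1 : 1 <= N. Proof. by rewrite ler1n. Qed.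
Let ep0 : 0 <= ep. Proof. by rewrite divr_ge0 ?divr_ge0 ?pi_ge0// ltW. Qed.
Let Nep : N * ep <= 2.
Proof. by rewrite mulrC divfK ?gt_eqF// ltW// pihalf_lt2. Qed.
Let epN : ep <= 2 / N.
Proof. by rewrite ler_pdivlMr// mulrC. Qed.
Let Nep2 : N * ep ^+ 2 <= 4 / N.
Proof.
have -> : N * ep ^+ 2 = (N * ep) * ep by ring.
have -> : 4 / N = 2 * (2 / N) by field; rewrite gt_eqF.
by apply: ler_pM => //; rewrite mulr_ge0// ltW.
Qed.

Definition rot (x x' : I -> R) : I -> R := fun i => x i * cos ep + x' i * sin ep.
(* [n.+1] rotations by [ep] carry [x] to [x'], so that the increment of [l G]
   along the whole path is the mean of the [stepW] along it (rotation_chain).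
   Semiconcavity bounds [stepW] by its linear part, which is Gaussian given
   [x], up to an error [stepR] of order [1 / N]; [stepD] bounds it
   everywhere, and [stepZ] is the resulting error on exponentials. *)
Definition stepW x x' : R := l * (N * (G (rot x x') - G x)).

Let nrm (x : I -> R) : R := \sum_i `|x i|.
Let nrm_ge0 x : 0 <= nrm x. Proof. by apply: sumr_ge0. Qed.

Definition step_lip : R := l * (4 * Q + 2 * G0).
Definition stepD x x' : R := step_lip * nrm x + step_lip * nrm x'.
Definition step_quad x x' : R := 4 * G0 * nrm x + 32 * a * (sq x + sq x') + 1.
Definition stepR x x' : R := l * step_quad x x' / N.
Definition stepZ x x' : R := expR (stepD x x') * Num.min 1 (expR (stepR x x') - 1).

Let h x x' : I -> R := fun i => x i * (cos ep - 1) + x' i * sin ep.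

Let sin_ep : `|sin ep| <= ep.
Proof. by apply: le_trans (normr_sin_le_id _) _; rewrite ger0_norm. Qed.

Let cos_ep : `|cos ep - 1| <= ep ^+ 2.
Proof. by rewrite distrC ger0_norm ?subr_ge0 ?cos_le1// onem_cos_le. Qed.

Let W_le_D x x' : stepW x x' <= stepD x x'.
Proof.
have Q0 := G_lip.1.
have h1 : G (rot x x') - G x <= Q * (\sum_i (`|x i| * ep ^+ 2 + `|x' i| * ep)).
  rewrite lerBlDl; apply: le_trans (lip1_ub _ x G_lip) _; rewrite lerD2l ler_wpM2l//.
  apply: ler_sum => i _; rewrite /rot.
  have -> : x i * cos ep + x' i * sin ep - x i = x i * (cos ep - 1) + x' i * sin ep by ring.
  apply: le_trans (ler_normD _ _) _; rewrite !normrM.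
  by apply: lerD; apply: ler_wpM2l.
rewrite big_split/= -!mulr_suml -/(nrm x) -/(nrm x') in h1.
rewrite /stepW /stepD /step_lip -!mulrA -mulrDr ler_wpM2l//.
apply: (@le_trans _ _ (N * (Q * (nrm x * ep ^+ 2 + nrm x' * ep)))).
  by rewrite ler_wpM2l// ltW.
have -> : N * (Q * (nrm x * ep ^+ 2 + nrm x' * ep)) =
  Q * nrm x * (N * ep ^+ 2) + Q * nrm x' * (N * ep) by ring.
have N4 : N * ep ^+ 2 <= 4.
  by apply: le_trans Nep2 _; rewrite ler_pdivrMr// ler_peMr.
have := mulr_ge0 Q0 (nrm_ge0 x); have := mulr_ge0 Q0 (nrm_ge0 x').
have := mulr_ge0 G0_ge0 (nrm_ge0 x); have := mulr_ge0 G0_ge0 (nrm_ge0 x').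
have := nrm_ge0 x; have := nrm_ge0 x'; move: Nep; nra.
Qed.

Let step_quad_ge0 x x' : 0 <= step_quad x x'.
Proof. by rewrite /step_quad !addr_ge0// !mulr_ge0// ?addr_ge0// sq_ge0. Qed.

Let stepR_ge0 x x' : 0 <= stepR x x'.
Proof. by rewrite /stepR divr_ge0 ?mulr_ge0// ltW. Qed.

Lemma stepZ_ge0 x x' : 0 <= stepZ x x'.
Proof.
rewrite /stepZ mulr_ge0 ?expR_ge0// le_min ler01/= subr_ge0.
by rewrite -[leLHS]expR0 ler_expR.
Qed.

Lemma stepZ_le x x' : stepZ x x' <= expR (stepD x x').
Proof. by rewrite /stepZ ler_piMr ?expR_ge0// ge_min lexx. Qed.

Let A (g x' : I -> R) : R := \sum_i (l * (N * sin ep) * g i) * x' i.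

Let step_bound x : exists g, bil S g g <= K ^+ 2 + C0 / N /\
  forall x', expR (stepW x x') <= expR (A g x') + stepZ x x'.
Proof.
(* With accuracy [t = 1 / N] the error [t ^+ 2], multiplied by the factor [N] of [stepW], is still
   of order [1 / N]. *)
have [|//|g [gG0 gS gG]] := G_grad x (t := N^-1); first by rewrite invr_gt0.
  by rewrite invf_le1.
exists g; split => // x'.
have AD : A g x' <= stepD x x'.
  apply: (@le_trans _ _ (step_lip * nrm x')); last first.
    by rewrite /stepD lerDr mulr_ge0// /step_lip mulr_ge0// addr_ge0// mulr_ge0// G_lip.1.
  rewrite /A /nrm mulr_sumr; apply: ler_sum => i _.
  apply: le_trans (ler_norm _) _; rewrite !normrM ler_wpM2r//.
  rewrite ger0_norm// (gtr0_norm N0) /step_lip -!mulrA ler_wpM2l//.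
  have h1 : N * `|sin ep| <= 2 by apply: le_trans Nep; rewrite ler_wpM2l// ltW.
  rewrite mulrA; apply: (@le_trans _ _ (2 * G0)).
    by apply: ler_pM => //; rewrite mulr_ge0// ltW.
  by rewrite lerDr mulr_ge0// G_lip.1.
have WAR : stepW x x' <= A g x' + stepR x x'.
  have := gG (h x x').
  rewrite (_ : (fun i => x i + h x x' i) = rot x x'); last first.
    by apply/funext => i; rewrite /h /rot; ring.
  rewrite -lerBlDl => g1.
  have g2 : N * \sum_i g i * h x x' i <= N * sin ep * (\sum_i g i * x' i) + 4 * G0 * nrm x / N.
    rewrite -[X in _ + X]mulrA (mulrC (nrm x)) mulrA /nrm !mulr_sumr -big_split/=.
    apply: ler_sum => i _; rewrite /h.
    have -> : N * (g i * (x i * (cos ep - 1) + x' i * sin ep)) =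
      N * sin ep * (g i * x' i) + N * (cos ep - 1) * (g i * x i) by ring.
    rewrite lerD2l; apply: le_trans (ler_norm _) _; rewrite !normrM mulrA ler_wpM2r//.
    rewrite (gtr0_norm N0).
    apply: (@le_trans _ _ (N * ep ^+ 2 * G0)).
      by apply: ler_pM => //; rewrite ?mulr_ge0// ?(ltW N0)// ler_wpM2l// ltW.
    have -> : 4 * G0 / N = 4 / N * G0 by ring.
    by rewrite ler_wpM2r.
  have g3 : N * (a * sq (h x x')) <= 32 * a * (sq x + sq x') / N.
    have -> : 32 * a * (sq x + sq x') / N = a * (32 / N * (sq x + sq x')) by ring.
    rewrite mulrCA ler_wpM2l// /sq -big_split/= !mulr_sumr; apply: ler_sum => i _.
    rewrite /h.
    have h1 : (x i * (cos ep - 1) + x' i * sin ep) ^+ 2 <=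
        2 * (x i ^+ 2 * (cos ep - 1) ^+ 2 + x' i ^+ 2 * sin ep ^+ 2).
      have : 0 <= (x i * (cos ep - 1) - x' i * sin ep) ^+ 2 by exact: sqr_ge0.
      nra.
    have h2 : (cos ep - 1) ^+ 2 <= ep ^+ 2 * 4.
      rewrite -(real_normK (num_real (cos ep - 1))).
      apply: (@le_trans _ _ ((ep ^+ 2) ^+ 2)).
        by rewrite lerXn2r ?nnegrE ?sqr_ge0.
      rewrite [leLHS]expr2 ler_wpM2l ?sqr_ge0//.
      have ep2 : ep <= 2 by apply: le_trans epN _; rewrite ler_pdivrMr// ler_peMr.
      by rewrite (_ : 4 = 2 ^+ 2) ?lerXn2r ?nnegrE//; ring.
    have h3 : sin ep ^+ 2 <= ep ^+ 2.
      by rewrite -(real_normK (num_real (sin ep))) lerXn2r ?nnegrE.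
    apply: (@le_trans _ _ (N * (2 * (x i ^+ 2 * (ep ^+ 2 * 4) + x' i ^+ 2 * ep ^+ 2)))).
      rewrite ler_wpM2l ?(ltW N0)//; apply: le_trans h1 _; rewrite ler_wpM2l//.
      by apply: lerD; apply: ler_wpM2l => //; exact: sqr_ge0.
    have -> : N * (2 * (x i ^+ 2 * (ep ^+ 2 * 4) + x' i ^+ 2 * ep ^+ 2)) =
      N * ep ^+ 2 * (8 * x i ^+ 2 + 2 * x' i ^+ 2) by ring.
    apply: (@le_trans _ _ (4 / N * (8 * x i ^+ 2 + 2 * x' i ^+ 2))).
      by rewrite ler_wpM2r// addr_ge0// mulr_ge0// sqr_ge0.
    have -> : 32 / N = 4 / N * 8 by ring.
    rewrite -[leRHS]mulrA ler_wpM2l ?divr_ge0 ?(ltW N0)//.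
    have := sqr_ge0 (x i); have := sqr_ge0 (x' i); lra.
  have g4 : N * N^-1 ^+ 2 = N^-1 by field; rewrite gt_eqF.
  rewrite /stepW /stepR /step_quad.
  have -> : A g x' = l * (N * sin ep * \sum_i g i * x' i).
    rewrite /A [RHS]mulrA mulr_sumr; apply: eq_bigr => i _; ring.
  rewrite -[X in _ <= _ + X]mulrA -mulrDr ler_wpM2l//.
  rewrite lerBlDl in g1.
  move: g1 g2 g3 g4; set u := \sum_i g i * h x x' i; set v := a * sq (h x x').
  set p := 4 * G0 * nrm x; set q := 32 * a * (sq x + sq x').
  set z := G (rot x x'); set z' := G x; set y := \sum_i _ => g1 g2 g3 g4.
  have : N * (z - z') <= N * (u + v + N^-1 ^+ 2).
    rewrite ler_wpM2l ?(ltW N0)// lerBlDl !addrA; exact: g1.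
  rewrite [N * (u + _ + _)]mulrDr [N * (u + v)]mulrDr g4 => /le_trans; apply.
  have -> : (p + q + 1) / N = p / N + q / N + N^-1 by ring.
  rewrite !addrA lerD2r; exact: lerD.
(* If the correction exceeds 1, the crude bound by [stepD] suffices; otherwise [expR (A + stepR)] is
   expanded and [A] bounded by [stepD]. Since [stepR] is quadratic, its exponential may fail to be
   integrable, while the minimum keeps the error below [expR stepD] for all [N]. *)
rewrite /stepZ; set m := Num.min _ _.
have [h1|h1] := leP 1 (expR (stepR x x') - 1).
  rewrite /m min_l// mulr1; apply: (@le_trans _ _ (expR (stepD x x'))).
    by rewrite ler_expR.
  by rewrite lerDr expR_ge0.
rewrite /m min_r ?(ltW h1)//.
apply: (@le_trans _ _ (expR (A g x') * expR (stepR x x'))).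
  by rewrite -expRD ler_expR.
have -> : expR (A g x') * expR (stepR x x') =
  expR (A g x') + expR (A g x') * (expR (stepR x x') - 1) by ring.
rewrite lerD2l ler_wpM2r ?ler_expR// subr_ge0.
by rewrite -[leLHS]expR0 ler_expR.
Qed.

Let m1 i : measurable_fun setT (fun w : T * T => X i w.1).
Proof. by apply: (measurableT_comp (mX i)); exact: measurable_fst. Qed.
Let m2 i : measurable_fun setT (fun w : T * T => X i w.2).
Proof. by apply: (measurableT_comp (mX i)); exact: measurable_snd. Qed.

Let mnrm d (U : measurableType d) (Z : I -> U -> R) :
  (forall i, measurable_fun setT (Z i)) -> measurable_fun setT (fun w => nrm (Z ^~ w)).
Proof. by move=> mZ; apply: measurable_sum => i; exact: measurableT_comp. Qed.

Let msq d (U : measurableType d) (Z : I -> U -> R) :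
  (forall i, measurable_fun setT (Z i)) -> measurable_fun setT (fun w => sq (Z ^~ w)).
Proof. by move=> mZ; apply: measurable_sum => i; exact: measurable_funX. Qed.

Let step_lip_ge0 : 0 <= step_lip.
Proof. by rewrite /step_lip mulr_ge0// addr_ge0// mulr_ge0// G_lip.1. Qed.

Lemma measurable_stepD :
  measurable_fun setT (fun w : T * T => expR (stepD (X ^~ w.1) (X ^~ w.2))).
Proof.
apply: measurableT_comp => //; apply: measurable_funD; apply: measurable_funM => //.
- exact: (mnrm (Z := fun i w => X i w.1)).
- exact: (mnrm (Z := fun i w => X i w.2)).
Qed.

Lemma measurable_stepZ :
  measurable_fun setT (fun w : T * T => stepZ (X ^~ w.1) (X ^~ w.2)).
Proof.
apply: measurable_funM; first exact: measurable_stepD.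
apply: measurable_minr => //; apply: measurable_funB => //.
apply: measurableT_comp => //; apply: measurable_funM => //.
apply: measurable_funM => //; apply: measurable_funD => //.
apply: measurable_funD; apply: measurable_funM => //.
- exact: (mnrm (Z := fun i w => X i w.1)).
- apply: measurable_funD.
  + exact: (msq (Z := fun i w => X i w.1)).
  + exact: (msq (Z := fun i w => X i w.2)).
Qed.

Lemma int1_stepD : int1 PP (fun w => expR (stepD (X ^~ w.1) (X ^~ w.2))).
Proof.
pose u w := expR (2 * step_lip * \sum_i `|X i w|).
have iu : int1 P u by apply: (int1_gf_expR_norm GX); rewrite mulr_ge0.
apply: (@int1_le _ _ _ PP _ (fun w => u w.1 + u w.2)).
- exact: measurable_stepD.
- move=> w; rewrite ger0_norm ?expR_ge0// /stepD expRD /u.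
  rewrite -!mulrA -/(nrm (X ^~ w.1)) -/(nrm (X ^~ w.2)).
  rewrite !expRM_natl; set p := expR _; set q := expR (step_lip * nrm (X ^~ w.2)).
  have : 0 <= p by exact: expR_ge0.
  have : 0 <= q by exact: expR_ge0.
  have := sqr_ge0 (p - q); nra.
- by apply: int1D; [exact: (int1_fst P iu)|exact: (int1_snd P iu)].
Qed.

Lemma int1_stepZ : int1 PP (fun w => stepZ (X ^~ w.1) (X ^~ w.2)).
Proof.
apply: (int1_le _ _ int1_stepD); first exact: measurable_stepZ.
by move=> w; rewrite ger0_norm ?stepZ_ge0// stepZ_le.
Qed.

(** Fubini with the first copy fixed. The supergradient is chosen separately for each outcome and
    only the resulting numerical bound is integrated, so no measurable selection is made. As
    [N * sin ep] is at most 2 in absolute value, the variance of the linear part is at most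
    [4 * l ^+ 2 * (K ^+ 2 + C0 / N)]. *)
Lemma stepW_Ex : Ex PP (fun w => expR (stepW (X ^~ w.1) (X ^~ w.2))) <=
  expR (2 * l ^+ 2 * (K ^+ 2 + C0 / N)) +
  Ex PP (fun w => stepZ (X ^~ w.1) (X ^~ w.2)).
Proof.
have Wle x x' : `|stepW x x'| <= l * (N * (M + M)).
  rewrite /stepW normrM ger0_norm// ler_wpM2l// normrM (gtr0_norm N0) ler_wpM2l ?(ltW N0)//.
  by apply: le_trans (ler_normB _ _) _; exact: lerD.
have lip_rot : measurable_fun setT (fun w : T * T => G (rot (X ^~ w.1) (X ^~ w.2))).
  apply: (lip1_measurable (X := fun i w => X i w.1 * cos ep + X i w.2 * sin ep) G_lip).
  by move=> i; apply: measurable_funD; exact: measurable_funM.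
have mW : measurable_fun setT (fun w : T * T => expR (stepW (X ^~ w.1) (X ^~ w.2))).
  apply: measurableT_comp => //; apply: measurable_funM => //.
  apply: measurable_funM => //; apply: measurable_funB => //.
  exact: (lip1_measurable (X := fun i w => X i w.1) G_lip).
have eW x x' : `|expR (stepW x x')| <= expR (l * (N * (M + M))).
  rewrite ger0_norm ?expR_ge0// ler_expR.
  by have := Wle x x'; rewrite ler_norml => /andP[].
rewrite (@prodP_fubini_bounded _ _ _ _ _ _ _ _ (expR (l * (N * (M + M)))))//.
have iD w : int1 P (fun w' => expR (stepD (X ^~ w) (X ^~ w'))).
  rewrite (_ : (fun w' => _) = fun w' => expR (step_lip * nrm (X ^~ w)) * expR (step_lip * \sum_i `|X i w'|)).
    by apply: int1Z; exact: (int1_gf_expR_norm GX).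
  by apply/funext => w'; rewrite -expRD.
have iZ w : int1 P (fun w' => stepZ (X ^~ w) (X ^~ w')).
  apply: (int1_le _ _ (iD w)); first by have := measurable_sec w measurable_stepZ.
  by move=> w'; rewrite ger0_norm ?stepZ_ge0// stepZ_le.
have [iZ1 ->] := prodP_fubini int1_stepZ iZ.
rewrite -[X in X + _](Ex_cst P) -ExD//; last exact: int1_cst.
have iW : int1 PP (fun w => expR (stepW (X ^~ w.1) (X ^~ w.2))).
  by apply: (int1_bounded _ mW) => w; exact: eW.
have iW' w : int1 P (fun w' => expR (stepW (X ^~ w) (X ^~ w'))).
  by apply: (int1_bounded _ (measurable_sec w mW)) => w'; exact: eW.
apply: le_Ex.
- exact: (prodP_fubini iW iW').1.
- by apply: int1D => //; exact: int1_cst.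
move=> w; have [g [gS gW]] := step_bound (X ^~ w).
have iA : int1 P (fun w' => expR (A g (X ^~ w'))) by exact: (int1_gf_mgf GX).
apply: (@le_trans _ _ (Ex P (fun w' => expR (A g (X ^~ w')) + stepZ (X ^~ w) (X ^~ w')))).
  apply: le_Ex => //.
  - exact: iW'.
  - exact: int1D.
rewrite ExD// lerD2r; apply: le_trans (Ex_gf_mgf_le GX _) _; rewrite ler_expR.
have -> : bil S (fun i => l * (N * sin ep) * g i) (fun i => l * (N * sin ep) * g i) =
   (l * (N * sin ep)) ^+ 2 * bil S g g.
  rewrite /bil mulr_sumr; apply: eq_bigr => i _; rewrite mulr_sumr.
  by apply: eq_bigr => j _; ring.
have s2 : (N * sin ep) ^+ 2 <= 4.
  rewrite -(real_normK (num_real (_ * _))) (_ : 4 = 2 ^+ 2); last by ring.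
  rewrite lerXn2r ?nnegrE// normrM (gtr0_norm N0); apply: le_trans Nep.
  by rewrite ler_wpM2l// ltW.
have KC : 0 <= K ^+ 2 + C0 / N by rewrite addr_ge0 ?sqr_ge0// divr_ge0// ltW.
rewrite exprMn ler_pdivrMr//.
apply: (@le_trans _ _ (l ^+ 2 * 4 * (K ^+ 2 + C0 / N))).
  apply: ler_pM => //; first by rewrite mulr_ge0// sqr_ge0.
  - exact: (gf_ge0 GX).
  - by rewrite ler_wpM2l// sqr_ge0.
by rewrite le_eqVlt; apply/orP; left; apply/eqP; ring.
Qed.

End Step.

Lemma stepZ_cvg :
  Ex PP (fun w => stepZ n (X ^~ w.1) (X ^~ w.2)) @[n --> \oo] --> (0 : R).
Proof.
have [] := @Ex_cvg _ _ _ PP (fun n w => stepZ n (X ^~ w.1) (X ^~ w.2)) (fun=> 0)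
  (fun w => expR (stepD (X ^~ w.1) (X ^~ w.2))).
- by move=> n; exact: measurable_stepZ.
- move=> w.
  set D := expR (stepD (X ^~ w.1) (X ^~ w.2)); set r := l * step_quad (X ^~ w.1) (X ^~ w.2).
  have H : D * (expR (r * n.+1%:R^-1) - 1) @[n --> \oo] --> D * (expR (r * 0) - 1).
    apply: cvgM; first exact: cvg_cst.
    apply: cvgB; last exact: cvg_cst.
    apply: continuous_cvg; first exact: continuous_expR.
    by apply: cvgM; [exact: cvg_cst|exact: cvg_harmonic].
  rewrite mulr0 expR0 subrr mulr0 in H.
  apply: (squeeze_cvgr _ (@cvg_cst _ (0 : R) _ \oo _) H).
  apply: nearW => n; rewrite /= stepZ_ge0/= /stepZ ler_wpM2l ?expR_ge0//.
  by rewrite ge_min lexx orbT.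
- exact: int1_stepD.
- by move=> n w; rewrite ger0_norm ?stepZ_ge0// stepZ_le.
by move=> _; rewrite Ex_cst.
Qed.

End Semiconcave.
End MaureyPisier.

(** Jensen's inequality, from the tangent of the exponential at the mean. *)
Lemma expR_mean_le (R : realType) (n : nat) (u : nat -> R) :
  expR ((\sum_(0 <= j < n.+1) u j) / n.+1%:R) <=
  (\sum_(0 <= j < n.+1) expR (u j)) / n.+1%:R.
Proof.
set m := (\sum_(0 <= j < n.+1) u j) / n.+1%:R.
have N0 : 0 < n.+1%:R :> R by rewrite ltr0n.
rewrite ler_pdivlMr//.
have -> : expR m * n.+1%:R = \sum_(0 <= j < n.+1) (expR m * (1 + u j - m)).
  rewrite -mulr_sumr; congr (_ * _).
  under eq_bigr do rewrite -addrA.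
  rewrite big_split/= big_split/= sumrN !sumr_const_nat subn0.
  by rewrite /m -[X in _ - X]mulr_natr divfK ?gt_eqF// subrr addr0.
apply: ler_sum => j _.
have -> : expR (u j) = expR m * expR (u j - m) by rewrite -expRD; congr expR; ring.
rewrite ler_wpM2l ?expR_ge0// -addrA; exact: expR_ge1Dx.
Qed.

Section GaussianConcentration.
Context {R : realType} {I : finType} {disp : measure_display}
  {T : measurableType disp}.
Variables (P : probability T R) (X : I -> T -> R) (S : I -> I -> R).
Hypothesis GX : gaussian_family P X S.
Let mX := gf_measurable GX.
Notation PP := (prodP P P).

(** The pair [(Y j, Y' j)] is the image of the two copies under an orthogonal map, so all [n + 1]
    steps have the same law; Jensen's inequality for their mean then bounds the whole path by a
    single step. *)
Lemma rotation_chain (G : (I -> R) -> R) (M Q l : R) (n : nat) :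
  (forall x, `|G x| <= M) -> lip1 Q G -> 0 <= l ->
  Ex PP (fun w => expR (l * (G (X ^~ w.1) - G (X ^~ w.2)))) <=
  Ex PP (fun w => expR (stepW G l n (X ^~ w.1) (X ^~ w.2))).
Proof.
move=> GM LG l0; have Q0 := LG.1.
pose N : R := n.+1%:R; pose ep : R := pi / 2 / N.
have N0 : 0 < N by rewrite ltr0n.
pose Y j (w : T * T) i := sin (j%:R * ep) * X i w.1 + cos (j%:R * ep) * X i w.2.
pose Y' j (w : T * T) i := cos (j%:R * ep) * X i w.1 - sin (j%:R * ep) * X i w.2.
have m1 i : measurable_fun setT (fun w : T * T => X i w.1).
  by apply: (measurableT_comp (mX i)); exact: measurable_fst.
have m2 i : measurable_fun setT (fun w : T * T => X i w.2).
  by apply: (measurableT_comp (mX i)); exact: measurable_snd.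
pose Gf (z : I + I -> R) := expR (stepW G l n (z \o inl) (z \o inr)).
pose B := l * (N * (M + M)).
have Wle x x' : `|stepW G l n x x'| <= B.
  rewrite /stepW normrM ger0_norm// ler_wpM2l// normrM (gtr0_norm N0) ler_wpM2l ?(ltW N0)//.
  by apply: le_trans (ler_normB _ _) _; exact: lerD.
have GfB z : `|Gf z| <= expR B.
  by rewrite ger0_norm ?expR_ge0// ler_expR; apply: le_trans (ler_norm _) _.
have LGf : lip1 (expR B * (l * (N * (2 * Q)))) Gf.
  split; first by rewrite !mulr_ge0 ?expR_ge0// ltW.
  move=> z z'; apply: le_trans (expR_lip (Wle _ _) (Wle _ _)) _.
  rewrite -!mulrA ler_wpM2l ?expR_ge0// /stepW -mulrBr normrM (ger0_norm l0) ler_wpM2l//.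
  rewrite -mulrBr normrM (gtr0_norm N0) ler_wpM2l ?(ltW N0)//.
  have -> : forall a b c d : R, a - b - (c - d) = (a - c) - (b - d) by move=> *; ring.
  apply: le_trans (ler_normB _ _) _.
  have -> : 2 * (Q * l1 z z') = Q * l1 z z' + Q * l1 z z' by ring.
  have lE : l1 z z' = l1 (z \o inl) (z' \o inl) + l1 (z \o inr) (z' \o inr).
    by rewrite /l1 big_sumType.
  apply: lerD; apply: le_trans (LG.2 _ _) _; rewrite ler_wpM2l// lE.
    rewrite /l1 -big_split/=; apply: ler_sum => i _; rewrite /rot.
    have -> : forall a b c d e f : R, a * e + b * f - (c * e + d * f) =
      (a - c) * e + (b - d) * f by move=> *; ring.
    apply: le_trans (ler_normD _ _) _; rewrite !normrM.
    by apply: lerD; rewrite ler_piMr// ?normr_cos_le1 ?normr_sin_le1.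
  by rewrite lerDl sumr_ge0.
have mGf d (U : measurableType d) (Z Z' : I -> U -> R) :
    (forall i, measurable_fun setT (Z i)) -> (forall i, measurable_fun setT (Z' i)) ->
    measurable_fun setT (fun w => expR (stepW G l n (Z ^~ w) (Z' ^~ w))).
  move=> mZ mZ'.
  apply: (lip1_measurable (X := fun i => match i with inl i => Z i | inr i => Z' i end) LGf).
  by case.
have iW j : int1 PP (fun w => expR (stepW G l n (Y j w) (Y' j w))).
  apply: (@int1_bounded _ _ _ _ _ (expR B)).
    apply: (mGf _ _ (fun i w => Y j w i) (fun i w => Y' j w i)) => i.
    - by apply: measurable_funD; exact: measurable_funM.
    - by apply: measurable_funB; exact: measurable_funM.
  by move=> w; rewrite ger0_norm ?expR_ge0// ler_expR; apply: le_trans (ler_norm _) _.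
have rotE j : Ex PP (fun w => expR (stepW G l n (Y j w) (Y' j w))) =
    Ex PP (fun w => expR (stepW G l n (X ^~ w.1) (X ^~ w.2))).
  have := rotation_invariance GX (cos2Dsin2 (j%:R * ep)) LGf GfB.
  exact.
have YS j w : rot n (Y j w) (Y' j w) = Y j.+1 w.
  apply/funext => i; rewrite /rot /Y /Y' -[pi / 2 / _]/ep.
  have -> : j.+1%:R * ep = j%:R * ep + ep by rewrite -natr1; ring.
  rewrite sinD cosD; ring.
have Y0 w : Y 0%N w = X ^~ w.2.
  by apply/funext => i; rewrite /Y mul0r sin0 cos0 mul0r mul1r add0r.
have YN w : Y n.+1 w = X ^~ w.1.
  apply/funext => i; rewrite /Y (_ : n.+1%:R * ep = pi / 2).
    by rewrite sin_pihalf cos_pihalf mul0r mul1r addr0.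
  by rewrite /ep mulrC divfK// gt_eqF.
have telE w : l * (G (X ^~ w.1) - G (X ^~ w.2)) =
    (\sum_(0 <= j < n.+1) stepW G l n (Y j w) (Y' j w)) / N.
  rewrite /stepW; under eq_bigr do rewrite YS.
  rewrite -mulr_sumr -mulr_sumr telescope_sumr// YN Y0 -/N.
  by field; rewrite gt_eqF.
apply: (@le_trans _ _ (Ex PP (fun w =>
   N^-1 * \sum_(j <- index_iota 0 n.+1) expR (stepW G l n (Y j w) (Y' j w))))).
  apply: le_Ex.
  - apply: (@int1_bounded _ _ _ _ _ (expR (l * (M + M)))).
      apply: measurableT_comp => //; apply: measurable_funM => //.
      by apply: measurable_funB; [apply: (lip1_measurable (X := fun i w => X i w.1) LG)|
        apply: (lip1_measurable (X := fun i w => X i w.2) LG)].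
    move=> w; rewrite ger0_norm ?expR_ge0// ler_expR ler_wpM2l//.
    by apply: le_trans (ler_norm _) _; apply: le_trans (ler_normB _ _) _; exact: lerD.
  - by apply: int1Z; apply: int1_sum => j _; exact: iW.
  - by move=> w; rewrite telE [leRHS]mulrC; exact: expR_mean_le.
rewrite ExZ; last by apply: int1_sum => j _; exact: iW.
rewrite Ex_sum; last by move=> j _; exact: iW.
under eq_bigr do rewrite rotE.
rewrite sumr_const_nat subn0 -mulr_natl mulrA mulVf ?mul1r//.
by rewrite pnatr_eq0.
Qed.

(** Refining the rotation bounds the Laplace transform of the difference of two independent copies.
    By Jensen's inequality in the second copy, centring at the mean can only make it smaller. *)
Lemma infconv_concentration (F : (I -> R) -> R) (M Q K l a : R) :
  (forall x, `|F x| <= M) -> lip1 Q F -> 0 <= K ->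
  (forall x g, F (fun i => x i + app S g i) - F x <= K * Num.sqrt (bil S g g)) ->
  0 <= l -> 0 < a ->
  Ex P (fun w => expR (l * (infconv F a (X ^~ w) - Ex P (fun w => infconv F a (X ^~ w)))))
  <= expR (2 * l ^+ 2 * K ^+ 2).
Proof.
move=> FM LF K0 FCM l0 a0.
pose G := infconv F a.
have GM x : `|G x| <= M := infconv_norm FM a0 x.
have LG : lip1 Q G := infconv_lip FM LF a0.
have [G0 [C0 [G00 C00 Ggrad]]] := infconv_supergradient (gf_ge0 GX) FM FCM a0.
have a0' := ltW a0.
have mG : measurable_fun setT (fun w => G (X ^~ w)) := lip1_measurable LG mX.
have bd : Ex PP (fun w => expR (l * (G (X ^~ w.1) - G (X ^~ w.2)))) <= expR (2 * l ^+ 2 * K ^+ 2).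
  pose u (n : nat) := expR (2 * l ^+ 2 * (K ^+ 2 + C0 * harmonic n)) +
    Ex PP (fun w => stepZ Q a G0 l n (X ^~ w.1) (X ^~ w.2)).
  have ucv : u n @[n --> \oo] --> expR (2 * l ^+ 2 * (K ^+ 2 + C0 * 0)) + 0.
    apply: cvgD; last exact: (stepZ_cvg GX LG a0' l0 G00).
    apply: continuous_cvg; first exact: continuous_expR.
    apply: cvgM; first exact: cvg_cst.
    apply: cvgD; first exact: cvg_cst.
    by apply: cvgM; [exact: cvg_cst|exact: cvg_harmonic].
  rewrite mulr0 !addr0 in ucv.
  rewrite -(cvg_lim _ ucv)//; apply: limr_ge; first by apply/cvg_ex; eexists; exact: ucv.
  apply: nearW => n; apply: le_trans (rotation_chain n GM LG l0) _.
  exact: (stepW_Ex GX GM LG a0' l0 G00 C00 Ggrad).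
set m := Ex P (fun w => infconv F a (X ^~ w)).
have iG : int1 P (fun w => G (X ^~ w)) by apply: (int1_bounded _ mG) => w.
have iE (k : R) : int1 P (fun w => expR (k * G (X ^~ w))).
  apply: (@int1_bounded _ _ _ _ _ (expR (`|k| * M))).
    by apply: measurableT_comp => //; apply: measurable_funM.
  move=> w; rewrite ger0_norm ?expR_ge0// ler_expR; apply: le_trans (ler_norm _) _.
  by rewrite normrM ler_wpM2l.
have E2 : Ex PP (fun w => expR (l * (G (X ^~ w.1) - G (X ^~ w.2)))) =
    Ex P (fun w => expR (l * G (X ^~ w))) * Ex P (fun w => expR (- l * G (X ^~ w))).
  rewrite (@prodP_fubini_bounded _ _ _ _ _ _ _ _ (expR (l * (M + M)))).
  - rewrite mulrC -ExZ//; apply: eq_Ex => w /=; rewrite mulrC -ExZ//.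
    by apply: eq_Ex => w'; rewrite -expRD; congr expR; ring.
  - apply: measurableT_comp => //; apply: measurable_funM => //.
    apply: measurable_funB.
    + by apply: (measurableT_comp mG); exact: measurable_fst.
    + by apply: (measurableT_comp mG); exact: measurable_snd.
  - move=> w; rewrite ger0_norm ?expR_ge0// ler_expR ler_wpM2l//.
    by apply: le_trans (ler_norm _) _; apply: le_trans (ler_normB _ _) _; exact: lerD.
have E3 : expR (- l * m) <= Ex P (fun w => expR (- l * G (X ^~ w))).
  have -> : expR (- l * m) = Ex P (fun w => expR (- l * m) * (1 + (- l) * (G (X ^~ w) - m))).
    rewrite ExZ; last first.
      by apply: int1D; [exact: int1_cst|apply: int1Z; apply: int1B => //; exact: int1_cst].
    rewrite ExD; [|exact: int1_cst|apply: int1Z; apply: int1B => //; exact: int1_cst].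
    rewrite ExZ; last by apply: int1B => //; exact: int1_cst.
    rewrite ExB//; last exact: int1_cst.
    by rewrite -/m !Ex_cst subrr mulr0 addr0 mulr1.
  apply: le_Ex => //.
  - apply: int1Z; apply: int1D; first exact: int1_cst.
    by apply: int1Z; apply: int1B => //; exact: int1_cst.
  - move=> w; have -> : - l * G (X ^~ w) = - l * m + (- l) * (G (X ^~ w) - m) by ring.
    by rewrite expRD ler_wpM2l ?expR_ge0//; exact: expR_ge1Dx.
apply: le_trans bd; rewrite E2.
have -> : Ex P (fun w => expR (l * (infconv F a (X ^~ w) - m))) =
    Ex P (fun w => expR (l * G (X ^~ w))) * expR (- l * m).
  rewrite mulrC -ExZ//; apply: eq_Ex => w; rewrite -expRD; congr expR.
  by rewrite -/G; ring.
by rewrite ler_wpM2l// Ex_ge0// => w; exact: expR_ge0.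
Qed.

(** The envelope costs [#|I| * Q ^+ 2 / (4 * a)], which vanishes as [a] grows. The dimension, [M]
    and [Q] thus disappear and the bound depends on the Cameron-Martin constant [K] alone. *)
Theorem gaussian_concentration (F : (I -> R) -> R) (M Q K l : R) :
  (forall x, `|F x| <= M) -> lip1 Q F -> 0 <= K ->
  (forall x g, F (fun i => x i + app S g i) - F x <= K * Num.sqrt (bil S g g)) ->
  0 <= l ->
  Ex P (fun w => expR (l * (F (X ^~ w) - Ex P (fun w => F (X ^~ w)))))
  <= expR (2 * l ^+ 2 * K ^+ 2).
Proof.
move=> FM LF K0 FCM l0.
have mF : measurable_fun setT (fun w => F (X ^~ w)) := lip1_measurable LF mX.
have iF : int1 P (fun w => F (X ^~ w)) by apply: (int1_bounded _ mF) => w.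
pose c := l * (#|I|%:R * (Q ^+ 2 / 4)).
have key (n : nat) : Ex P (fun w => expR (l * (F (X ^~ w) - Ex P (fun w => F (X ^~ w)))))
    <= expR (c * harmonic n) * expR (2 * l ^+ 2 * K ^+ 2).
  pose a : R := n.+1%:R; have a0 : 0 < a by rewrite ltr0n.
  have mG : measurable_fun setT (fun w => infconv F a (X ^~ w)) :=
    lip1_measurable (infconv_lip FM LF a0) mX.
  have iG : int1 P (fun w => infconv F a (X ^~ w)).
    by apply: (int1_bounded _ mG) => w; exact: infconv_norm.
  apply: le_trans (ler_wpM2l (expR_ge0 _) (infconv_concentration FM LF K0 FCM l0 a0)).
  have bnd (u : T -> R) (k : R) : measurable_fun setT u -> (forall w, `|u w| <= M) ->
      int1 P (fun w => expR (l * (u w - k))).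
    move=> mu uM; apply: (@int1_bounded _ _ _ _ _ (expR (l * (M + `|k|)))).
      by apply: measurableT_comp => //; apply: measurable_funM => //; exact: measurable_funB.
    move=> w; rewrite ger0_norm ?expR_ge0// ler_expR ler_wpM2l//.
    apply: le_trans (ler_norm _) _; apply: le_trans (ler_normB _ _) _.
    by apply: lerD.
  have bG : forall w, `|infconv F a (X ^~ w)| <= M by move=> w; exact: infconv_norm.
  rewrite -ExZ; last exact: bnd.
  apply: le_Ex.
  - exact: bnd.
  - by apply: int1Z; exact: bnd.
  move=> w; rewrite -expRD ler_expR.
  have h1 := le_infconv FM LF a0 (X ^~ w).
  have h2 : Ex P (fun w => infconv F a (X ^~ w)) <= Ex P (fun w => F (X ^~ w)).
    by apply: le_Ex => // w'; exact: infconv_le_id.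
  have -> : c * harmonic n = l * (#|I|%:R * (Q ^+ 2 / (4 * a))).
    by rewrite /c /= -/a; field; rewrite gt_eqF.
  rewrite -mulrDr ler_wpM2l// [leRHS]addrCA addrA; apply: lerB h2.
  by rewrite addrC in h1 *; exact: h1.
have cv : expR (c * harmonic n) * expR (2 * l ^+ 2 * K ^+ 2) @[n --> \oo] -->
    expR (c * 0) * expR (2 * l ^+ 2 * K ^+ 2).
  apply: cvgM; last exact: cvg_cst.
  apply: continuous_cvg; first exact: continuous_expR.
  by apply: cvgM; [exact: cvg_cst|exact: cvg_harmonic].
rewrite mulr0 expR0 mul1r in cv.
rewrite -(cvg_lim _ cv)//; apply: limr_ge; first by apply/cvg_ex; eexists; exact: cv.
exact: nearW.
Qed.

End GaussianConcentration.

(** * Independence and the fractional Brownian family *)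

Section IndicatorToFunction.
Context {disp : measure_display} {T : measurableType disp} {R : realType}.
Variable P : probability T R.

Lemma measurable_indic_comp (U : T -> R) (A : set R) : measurable_fun setT U ->
  measurable A -> measurable_fun setT (fun w => \1_A (U w) : R).
Proof. by move=> mU mA; apply: measurableT_comp mU; exact: measurable_indic. Qed.

Lemma Ex_indic_comp (U : T -> R) (A : set R) : measurable_fun setT U ->
  measurable A -> (Ex P (fun w => \1_A (U w)))%:E = P (U @^-1` A).
Proof.
move=> mU mA; rewrite EFin_Ex.
  rewrite (_ : (fun w => _) = fun w => (\1_(U @^-1` A) w)%:E); last first.
    by apply/funext => w; rewrite !indicE; congr (_%:R%:E); apply/idP/idP; rewrite !inE.
  rewrite integral_indic ?setIT//.
  by have := mU measurableT A mA; rewrite setTI.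
apply: (@int1_bounded _ _ _ _ _ 1); first exact: measurable_indic_comp.
by move=> w; rewrite indicE; case: (_ \in _); rewrite ?normr1 ?normr0.
Qed.

(* Approximates [phi], rescaled to [[0, 1]], by the averages of the indicators
   of its superlevel sets at the heights [(j + 1) / n]. *)
Lemma Ex_product_indic (U psi : T -> R) (c M B : R) (phi : R -> R) :
  measurable_fun setT U -> measurable_fun setT psi -> (forall w, `|psi w| <= B) ->
  (forall A, measurable A -> Ex P (fun w => \1_A (U w) * psi w) =
     Ex P (fun w => \1_A (U w)) * c) ->
  measurable_fun setT phi -> (forall x, `|phi x| <= M) ->
  Ex P (fun w => phi (U w) * psi w) = Ex P (fun w => phi (U w)) * c.
Proof.
move=> mU mpsi psiB H mphi phiM.
have B0 (w : T) : 0 <= B by apply: le_trans (psiB w).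
pose M1 := M + 1.
have M10 : 0 < M1 by rewrite /M1 ltr_wpDl// (le_trans _ (phiM 0)).
pose g x := (phi x + M1) / (2 * M1).
have g01 x : 0 <= g x <= 1.
  have := phiM x; rewrite ler_norml => /andP[h1 h2].
  rewrite /g; apply/andP; split.
    by rewrite divr_ge0 ?mulr_ge0 ?(ltW M10)//; move: h1 h2; rewrite /M1; clear; lra.
  by rewrite ler_pdivrMr ?mulr_gt0//; move: h1 h2; rewrite /M1; clear; lra.
have mg : measurable_fun setT g.
  by apply: measurable_funM => //; exact: measurable_funD.
pose A n j := [set x | j.+1%:R <= n.+1%:R * g x].
have mA n j : measurable (A n j).
  have mf : measurable_fun setT (fun x => n.+1%:R * g x) by exact: measurable_funM.
  have := mf measurableT `[j.+1%:R, +oo[%classic (measurable_itv _).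
  by rewrite setTI; congr measurable; apply/seteqP; split => x /=; rewrite in_itv/= andbT.
pose gn n x : R := n.+1%:R^-1 * \sum_(j <- index_iota 0 n.+1) \1_(A n j) x.
(* The indicators count the heights not above [g x], so [gn n] is [g] rounded down to a multiple of
   [1 / (n+1)]. *)
have gnE n x : gn n x = n.+1%:R^-1 * (Num.truncn (n.+1%:R * g x))%:R.
  rewrite /gn; congr (_ * _); have /andP[g0 g1] := g01 x.
  set k := Num.truncn _.
  have kn : (k <= n.+1)%N.
    rewrite -(ler_nat R); apply: (@le_trans _ _ (n.+1%:R * g x)).
      by rewrite truncn_le// mulr_ge0.
    by rewrite ler_piMr.
  have E j : \1_(A n j) x = (if (j < k)%N then 1 else 0) :> R.
    rewrite indicE truncn_gt_nat; case: ifPn => h.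
      by rewrite mem_set.
    by rewrite memNset//; exact/negP.
  under eq_bigr do rewrite E.
  rewrite -big_mkcond/= -(big_nat_widen 0 k n.+1 xpredT) //.
  by rewrite sumr_const_nat subn0.
have gngB n x : `|g x - gn n x| <= n.+1%:R^-1.
  have N0 : 0 < n.+1%:R :> R by rewrite ltr0n.
  rewrite gnE; have /andP[g0 g1] := g01 x.
  have h0 : 0 <= n.+1%:R * g x by rewrite mulr_ge0.
  have /andP[h1 h2] := truncn_itv h0; set k := Num.truncn _ in h1 h2 *.
  have -> : g x - n.+1%:R^-1 * k%:R = n.+1%:R^-1 * (n.+1%:R * g x - k%:R).
    by rewrite mulrBr mulrA mulVf ?mul1r// gt_eqF.
  rewrite normrM gtr0_norm ?invr_gt0// ler_piMr ?invr_ge0 ?(ltW N0)//.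
  rewrite ger0_norm ?subr_ge0// lerBlDl natr1; exact: ltW.
have mgn n : measurable_fun setT (fun w => gn n (U w)).
  apply: measurable_funM => //; apply: measurable_sum => j.
  exact: measurable_indic_comp.
have gn1 n x : `|gn n x| <= 2.
  have /andP[g0 g1] := g01 x.
  have h : n.+1%:R^-1 <= 1 :> R by rewrite invf_le1 ?ler1n// ltr0n.
  have := le_trans (gngB n x) h; rewrite !ler_norml => /andP[].
  by move: g0 g1; clear => *; apply/andP; split; lra.
have i1 n j : int1 P (fun w => \1_(A n j) (U w) : R).
  apply: (@int1_bounded _ _ _ _ _ 1); first exact: measurable_indic_comp.
  by move=> w; rewrite indicE; case: (_ \in _); rewrite ?normr1 ?normr0.
have i2 n j : int1 P (fun w => \1_(A n j) (U w) * psi w).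
  apply: (@int1_bounded _ _ _ _ _ B).
    by apply: measurable_funM => //; exact: measurable_indic_comp.
  move=> w; rewrite normrM -[leRHS]mul1r; apply: ler_pM => //.
  by rewrite indicE; case: (_ \in _); rewrite ?normr1 ?normr0.
have Hn n : Ex P (fun w => gn n (U w) * psi w) = Ex P (fun w => gn n (U w)) * c.
  rewrite /gn [in RHS]ExZ; last by apply: int1_sum => j _.
  rewrite Ex_sum; last by move=> j _.
  transitivity (Ex P (fun w => n.+1%:R^-1 * \sum_(j <- index_iota 0 n.+1) \1_(A n j) (U w) * psi w)).
    by apply: eq_Ex => w; rewrite -mulrA mulr_suml.
  rewrite ExZ; last by apply: int1_sum => j _.
  rewrite Ex_sum; last by move=> j _.
  rewrite -mulrA mulr_suml; congr (_ * _); apply: eq_bigr => j _.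
  exact: H.
have mgU : measurable_fun setT (fun w => g (U w)) by exact: measurableT_comp.
have gcv x : gn n x @[n --> \oo] --> g x.
  apply/cvgrPdist_le => e e0; have := @cvg_harmonic R.
  move=> /cvgrPdist_le/(_ e e0); apply: filterS => n; rewrite sub0r normrN /= => h.
  by apply: le_trans (gngB n x) _; apply: le_trans (ler_norm _) h.
have [ig C1] := @Ex_cvg _ _ _ P (fun n w => gn n (U w)) (fun w => g (U w)) (fun=> 2)
   mgn (fun w => gcv (U w)) (int1_cst _ _) (fun n w => gn1 n (U w)).
have [igp C2] : int1 P (fun w => g (U w) * psi w) /\
   (Ex P (fun w => gn n (U w) * psi w) @[n --> \oo] --> Ex P (fun w => g (U w) * psi w)).
  apply: (@Ex_cvg _ _ _ P _ _ (fun=> 2 * B)).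
  - by move=> n; exact: measurable_funM.
  - by move=> w; apply: cvgM; [exact: gcv|exact: cvg_cst].
  - exact: int1_cst.
  - by move=> n w; rewrite normrM; apply: ler_pM.
have Hg : Ex P (fun w => g (U w) * psi w) = Ex P (fun w => g (U w)) * c.
  apply: cvg_unique C2 _ => //.
  rewrite (_ : (fun n => _) = fun n => Ex P (fun w => gn n (U w)) * c); last exact/funext.
  by apply: cvgM; [exact: C1|exact: cvg_cst].
have H1 : Ex P psi = c.
  have := H setT measurableT.
  have E (w : T) : \1_(setT : set R) (U w) = 1 :> R by rewrite indicE in_setT.
  under eq_Ex do rewrite E mul1r.
  under [X in _ = X * _ -> _]eq_Ex do rewrite E.
  by rewrite Ex_cst mul1r.
have ipsi : int1 P psi by exact: (int1_bounded _ mpsi psiB).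
have phiE x : phi x = 2 * M1 * g x - M1 by rewrite /g; field; rewrite gt_eqF.
transitivity (Ex P (fun w => 2 * M1 * (g (U w) * psi w) - M1 * psi w)).
  by apply: eq_Ex => w; rewrite phiE; ring.
rewrite ExB; [|exact: int1Z|exact: int1Z].
rewrite !ExZ// Hg H1.
transitivity ((2 * M1 * Ex P (fun w => g (U w)) - M1) * c); first by ring.
congr (_ * _); rewrite -[X in _ - X](Ex_cst P) -ExZ// -ExB; [|exact: int1Z|exact: int1_cst].
by apply: eq_Ex => w; rewrite phiE.
Qed.

End IndicatorToFunction.

Lemma fatou_le d (T : measurableType d) (R : realType)
  (mu : {measure set T -> \bar R}) (f_ : nat -> T -> R) (f : T -> R) (c : \bar R) :
  (forall n, measurable_fun setT (f_ n)) -> (forall n w, 0 <= f_ n w) ->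
  (forall w, f_ n w @[n --> \oo] --> f w) ->
  (forall n, (\int[mu]_w (f_ n w)%:E <= c)%E) -> (\int[mu]_w (f w)%:E <= c)%E.
Proof.
move=> mf f0 ff fc.
have mf' n : measurable_fun setT (EFin \o f_ n) by exact/measurable_EFinP.
have f0' n w : setT w -> (0 <= (EFin \o f_ n) w)%E by move=> _; rewrite lee_fin.
have := fatou mu measurableT mf' f0'; rewrite limn_einf_lim => H.
apply: (le_trans _ (le_trans H _)).
- rewrite le_eqVlt; apply/orP; left; apply/eqP; apply: eq_integral => w _.
  have cw : (f_ n w)%:E @[n --> \oo] --> (f w)%:E by apply: cvg_EFin; [exact: nearW|exact: ff].
  rewrite is_cvg_limn_einfE; first by apply/esym; exact: (cvg_lim _ cw).
  by apply/cvg_ex; eexists; exact: cw.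
- apply: lime_le; first exact: is_cvg_einfs.
  apply: nearW => n; apply: le_trans (fc n).
  by apply: ereal_inf_lbound; exists n => /=.
Qed.

Section IndependentProduct.
Context {disp : measure_display} {T : measurableType disp} {R : realType}.
Variables (P : probability T R) (d : nat) (U : 'I_d -> T -> R).
Hypothesis mU : forall i, measurable_fun setT (U i).
Hypothesis indepU : forall A : 'I_d -> set R, (forall i, measurable (A i)) ->
  P (\bigcap_i (U i @^-1` A i)) = (\prod_(i < d) P (U i @^-1` A i))%E.
Implicit Types phi : 'I_d -> R -> R.

Let bounded_mfun (f : R -> R) :=
  measurable_fun setT f /\ exists M, forall x, `|f x| <= M.

Let measurable_prodU (p : pred 'I_d) phi : (forall i, bounded_mfun (phi i)) ->
  measurable_fun setT (fun w => \prod_(i | p i) phi i (U i w)).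
Proof.
move=> Hphi.
have H (s : seq 'I_d) : measurable_fun setT (fun w => \prod_(i <- s | p i) phi i (U i w)).
  elim: s => [|i s IH].
    rewrite (_ : (fun w => _) = fun=> 1)//; by apply/funext => w; rewrite big_nil.
  case pi: (p i).
    rewrite (_ : (fun w => _) = fun w => phi i (U i w) * \prod_(i <- s | p i) phi i (U i w)).
      apply: measurable_funM => //; apply: measurableT_comp => //; exact: (Hphi i).1.
    by apply/funext => w; rewrite big_cons pi.
  by rewrite (_ : (fun w => _) = fun w => \prod_(i <- s | p i) phi i (U i w))//; apply/funext => w; rewrite big_cons pi.
exact: H.
Qed.

Let bounded_prodU (p : pred 'I_d) phi : (forall i, bounded_mfun (phi i)) ->
  exists B, forall w, `|\prod_(i | p i) phi i (U i w)| <= B.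
Proof.
move=> Hphi; exists (\prod_(i | p i) sval (cid (Hphi i).2)) => w.
rewrite normr_prod; apply: ler_prod => i _; rewrite normr_ge0/=.
by case: cid => M /= ->.
Qed.

(** Induction on the list [s] of coordinates that carry arbitrary bounded functions, the others
    carrying indicators. With indicators only, this is independence of events; [Ex_product_indic]
    then upgrades one coordinate at a time. *)
Lemma Ex_prod_indep phi : (forall i, bounded_mfun (phi i)) ->
  Ex P (fun w => \prod_i phi i (U i w)) = \prod_i Ex P (fun w => phi i (U i w)).
Proof.
have key (s : seq 'I_d) phi' : uniq s -> (forall i, bounded_mfun (phi' i)) ->
    (forall i, i \notin s -> exists A : set R, measurable A /\ phi' i = \1_A) ->
    Ex P (fun w => \prod_i phi' i (U i w)) = \prod_i Ex P (fun w => phi' i (U i w)).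
  elim: s phi' => [|i s IH] phi' us Hphi Hs.
    have {}Hs i := cid (Hs i isT).
    pose A i := sval (Hs i).
    have mA i : measurable (A i) by rewrite /A; case: (Hs i) => B [].
    have E i : phi' i = \1_(A i) by rewrite /A; case: (Hs i) => B [].
    apply: EFin_inj.
    transitivity (P (\bigcap_i (U i @^-1` A i))).
      rewrite EFin_Ex; last first.
        by have [B HB] := bounded_prodU xpredT Hphi; exact: (int1_bounded _ (measurable_prodU xpredT Hphi) HB).
      rewrite -[X in P X]setIT -integral_indic//; last first.
        apply: fin_bigcap_measurable => [|j _]; first exact: finite_finset.
        by have := mU j measurableT (mA j); rewrite setTI.
      apply: eq_integral => w _; congr EFin.
      have [h|h] := pselect ((\bigcap_i (U i @^-1` A i)) w).
        rewrite indicE mem_set//= big1// => j _; rewrite E indicE mem_set//.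
        exact: h.
      rewrite indicE memNset//=.
      have [j nj] : exists j, ~ A j (U j w).
        by apply/existsNP => hh; apply: h => j _; exact: hh.
      by rewrite (bigD1 j)//= E indicE memNset// mul0r.
    rewrite indepU// -prodEFin; apply: eq_bigr => i _.
    by rewrite E Ex_indic_comp.
  pose psi w := \prod_(j | j != i) phi' j (U j w).
  have [mphi [M HM]] := Hphi i.
  have [B HB] := bounded_prodU (fun j => j != i) Hphi.
  have := @Ex_product_indic _ _ _ P (U i) psi (\prod_(j | j != i) Ex P (fun w => phi' j (U j w)))
     M B (phi' i) (mU i) (measurable_prodU (fun j => j != i) Hphi) HB _ mphi HM.
  have -> : Ex P (fun w => \prod_j phi' j (U j w)) = Ex P (fun w => phi' i (U i w) * psi w).
    by apply: eq_Ex => w; rewrite (bigD1 i).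
  move=> HH; rewrite HH; first by rewrite [in RHS](bigD1 i).
  move=> A mA.
  pose phi2 j := if j == i then \1_A else phi' j.
  have := IH phi2; rewrite (bigD1 i)//=.
  have -> : Ex P (fun w => \prod_j phi2 j (U j w)) = Ex P (fun w => \1_A (U i w) * psi w).
    apply: eq_Ex => w; rewrite (bigD1 i)//= /phi2 eqxx; congr (_ * _).
    by apply: eq_bigr => j /negbTE ->.
  have -> : Ex P (fun w => phi2 i (U i w)) = Ex P (fun w => \1_A (U i w)).
    by rewrite /phi2 eqxx.
  move=> ->.
  - by congr (_ * _); apply: eq_bigr => j /negbTE; rewrite /phi2 => ->.
  - by case/andP : us.
  - move=> j; rewrite /phi2; case: eqP => // _; split; first exact: measurable_indic.
    by exists 1 => x; rewrite indicE; case: (_ \in _); rewrite ?normr1 ?normr0.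
  - move=> j js; rewrite /phi2; case: eqP => [_|/eqP ji]; first by exists A.
    by apply: Hs; rewrite inE negb_or ji.
move=> Hphi; apply: (key (enum 'I_d)) => //; first exact: enum_uniq.
by move=> i; rewrite mem_enum.
Qed.

Variable v : 'I_d -> R.
Hypothesis cfU : forall i th t,
  Ex P (fun w => cos (th + t * U i w)) = cos th * expR (- (t ^+ 2 * v i / 2)).

(** The addition formula splits off one [U i] at a time. The product of the [phi i] collects the
    sines and cosines already split off, so independence is used only once the sum is exhausted.
    Branches containing a sine vanish, as its expectation is 0. *)
Lemma Ex_cos_sum_indep th :
  Ex P (fun w => cos (th + \sum_i U i w)) = cos th * expR (- ((\sum_i v i) / 2)).
Proof.
have bc : bounded_mfun cos.
  split; first by apply: continuous_measurable_fun; exact: continuous_cos.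
  by exists 1; exact: normr_cos_le1.
have bs : bounded_mfun sin.
  split; first by apply: continuous_measurable_fun; exact: continuous_sin.
  by exists 1; exact: normr_sin_le1.
have b1 : bounded_mfun (fun=> 1) by split => //; exists 1 => x; rewrite normr1.
have Ec i : Ex P (fun w => cos (U i w)) = expR (- (v i / 2)).
  have := cfU i 0 1; rewrite cos0 expr1n !mul1r => <-.
  by apply: eq_Ex => w; rewrite add0r mul1r.
have Es i : Ex P (fun w => sin (U i w)) = 0.
  have := cfU i (- (pi / 2)) 1; rewrite cosN cos_pihalf mul0r => <-.
  by apply: eq_Ex => w; rewrite mul1r addrC cosBpihalf.
have key (s : seq 'I_d) th' phi : uniq s -> (forall i, bounded_mfun (phi i)) ->
    (forall i, i \in s -> phi i = fun=> 1) ->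
    Ex P (fun w => cos (th' + \sum_(i <- s) U i w) * \prod_i phi i (U i w)) =
    cos th' * expR (- ((\sum_(i <- s) v i) / 2)) * \prod_i Ex P (fun w => phi i (U i w)).
  elim: s th' phi => [|i s IH] th' phi us Hphi Hs.
    rewrite big_nil mul0r oppr0 expR0 mulr1 -Ex_prod_indep// -ExZ.
      by apply: eq_Ex => w; rewrite big_nil addr0.
    by have [B HB] := bounded_prodU xpredT Hphi; exact: (int1_bounded _ (measurable_prodU xpredT Hphi) HB).
  case/andP : us => nis us.
  pose phi2 f j := if j == i then f else phi j.
  have Hphi2 f : bounded_mfun f -> forall j, bounded_mfun (phi2 f j).
    by move=> bf j; rewrite /phi2; case: eqP.
  have Hs2 f j : j \in s -> phi2 f j = fun=> 1.
    move=> js; rewrite /phi2; case: eqP => [ji|_]; first by rewrite -ji js in nis.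
    by apply: Hs; rewrite inE js orbT.
  have p2 f w : \prod_j phi2 f j (U j w) = f (U i w) * \prod_j phi j (U j w).
    rewrite (bigD1 i)//= [in RHS](bigD1 i)//= (Hs i) ?inE ?eqxx// mul1r {1}/phi2 eqxx.
    by congr (_ * _); apply: eq_bigr => j /negbTE; rewrite /phi2 => ->.
  have Ep2 f : \prod_j Ex P (fun w => phi2 f j (U j w)) =
      Ex P (fun w => f (U i w)) * \prod_j Ex P (fun w => phi j (U j w)).
    rewrite (bigD1 i)//= [in RHS](bigD1 i)//= (Hs i) ?inE ?eqxx// Ex_cst mul1r {1}/phi2 eqxx.
    by congr (_ * _); apply: eq_bigr => j /negbTE; rewrite /phi2 => ->.
  have H1 := IH th' (phi2 cos) us (Hphi2 _ bc) (Hs2 cos).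
  have H2 := IH (th' + pi / 2) (phi2 sin) us (Hphi2 _ bs) (Hs2 sin).
  rewrite Ep2 Ec in H1; rewrite Ep2 Es mul0r mulr0 in H2.
  have int f th2 : bounded_mfun f ->
      int1 P (fun w => cos (th2 + \sum_(i <- s) U i w) * \prod_j phi2 f j (U j w)).
    move=> bf; have [B HB] := bounded_prodU xpredT (Hphi2 f bf).
    apply: (@int1_bounded _ _ _ _ _ (1 * B)).
      apply: measurable_funM; last exact: (measurable_prodU xpredT (Hphi2 f bf)).
      apply: measurableT_comp; first by apply: continuous_measurable_fun; exact: continuous_cos.
      by apply: measurable_funD => //; apply: measurable_sum.
    by move=> w; rewrite normrM; apply: ler_pM => //; exact: normr_cos_le1.
  transitivity (Ex P (fun w => cos (th' + \sum_(i <- s) U i w) * \prod_j phi2 cos j (U j w) +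
     cos (th' + pi / 2 + \sum_(i <- s) U i w) * \prod_j phi2 sin j (U j w))).
    apply: eq_Ex => w; rewrite !p2 big_cons.
    have -> : th' + (U i w + \sum_(i <- s) U i w) = (th' + \sum_(i <- s) U i w) + U i w by ring.
    rewrite cosD.
    have -> : th' + pi / 2 + \sum_(i <- s) U i w = (th' + \sum_(i <- s) U i w) + pi / 2 by ring.
    rewrite cosDpihalf; ring.
  rewrite ExD; [|exact: int|exact: int].
  rewrite H1 H2 addr0 big_cons.
  have -> : - ((v i + \sum_(i <- s) v i) / 2) = - ((\sum_(i <- s) v i) / 2) + - (v i / 2).
    by lra.
  by rewrite expRD; ring.
have := key (index_enum 'I_d) th (fun=> fun=> 1) (index_enum_uniq _) (fun=> b1) (fun _ _ => erefl).
rewrite [X in _ = _ * X]big1 ?mulr1; last by move=> i _; exact: Ex_cst.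
move=> <-; apply: eq_Ex => w; rewrite [X in _ * X]big1 ?mulr1//.
Qed.

Hypothesis mgfU : forall i,
  (\int[P]_w (expR (U i w))%:E <= (expR (v i / 2))%:E)%E.

(** Independence is available for bounded functions only, so the exponentials are capped at [n];
    Fatou's lemma removes the cap and leaves an inequality. *)
Lemma le_integral_expR_sum_indep :
  (\int[P]_w (expR (\sum_i U i w))%:E <= (expR ((\sum_i v i) / 2))%:E)%E.
Proof.
pose phi (n : nat) (x : R) := Num.min (expR x) n%:R.
have phi0 n x : 0 <= phi n x by rewrite le_min expR_ge0 ler0n.
have mphi n : measurable_fun setT (phi n).
  by apply: measurable_minr => //; exact: measurable_expR.
have bphi n : bounded_mfun (phi n).
  split; first exact: mphi.
  by exists n%:R => x; rewrite ger0_norm// ge_min lexx orbT.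
have ie i : int1 P (fun w => expR (U i w)).
  apply: int1_ge0_fin (mgfU i); last by move=> w; exact: expR_ge0.
  exact: measurableT_comp.
apply: (@fatou_le _ _ _ P (fun n w => \prod_i phi n (U i w))).
- by move=> n; exact: (measurable_prodU xpredT (fun=> bphi n)).
- by move=> n w; apply: prodr_ge0.
- move=> w; rewrite expR_sum; apply: cvg_near_cst.
  near=> n; apply: eq_bigr => i _; rewrite /phi min_l//.
  apply: (@le_trans _ _ (\sum_i expR (U i w))).
    by rewrite (bigD1 i)//= lerDl sumr_ge0// => j _; exact: expR_ge0.
  by near: n; exact: nbhs_infty_ger.
- move=> n; rewrite -EFin_Ex; last first.
    by have [B HB] := bounded_prodU xpredT (fun=> bphi n); exact: (int1_bounded _ (measurable_prodU xpredT (fun=> bphi n)) HB).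
  rewrite (Ex_prod_indep (phi := fun=> phi n))// lee_fin mulr_suml expR_sum.
  apply: ler_prod => i _; rewrite Ex_ge0//=.
  apply: (@le_trans _ _ (Ex P (fun w => expR (U i w)))).
    apply: le_Ex => //.
    + apply: (@int1_bounded _ _ _ _ _ n%:R); first exact: measurableT_comp.
      by move=> w; rewrite ger0_norm// ge_min lexx orbT.
    + by move=> w; rewrite ge_min lexx.
  by rewrite -lee_fin EFin_Ex.
Unshelve. all: by end_near. Qed.

End IndependentProduct.

Section FbmComponent.
Context {disp : measure_display} {T : measurableType disp} {R : realType}.
Variables (P : probability T R) (H : R) (X : R -> {RV P >-> R}).
Hypothesis fX : is_fbm1 H X.

Lemma fbm1_Ex (t : R) : 0 <= t -> Ex P (X t) = 0.
Proof. by move=> t0; have := fbm1_centered fX t0; rewrite unlock /Ex /Rintegral => ->. Qed.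

Let gaussX : gaussian_process X. Proof. exact: fbm1_gaussian fX. Qed.

Let gauss1 (t : R) : 0 <= t -> gaussian_rv P (X t).
Proof.
move=> t0; have := @gaussX 1%N (fun=> t) (fun=> 1) (fun=> t0).
by congr gaussian_rv; apply/funext => w; rewrite big_ord1 mul1r.
Qed.

Let mXt t : measurable_fun setT (X t). Proof. exact: measurable_funPT. Qed.

Lemma fbm1_sqr (t : R) : 0 <= t -> int1 P (fun w => X t w ^+ 2).
Proof.
by move=> t0; have [v []] := gaussian_rvP (mXt t) (gauss1 t0) (fbm1_Ex t0).
Qed.

Lemma fbm1_int (t : R) : 0 <= t -> int1 P (X t).
Proof.
move=> t0; apply: (@int1_le _ _ _ _ _ (fun w => 1 + X t w ^+ 2)) => //.
  move=> w; rewrite -[X in 1 + X](real_normK (num_real _)).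
  have := sqr_ge0 (`|X t w| - 1); have := normr_ge0 (X t w); nra.
by apply: int1D; [exact: int1_cst|exact: fbm1_sqr].
Qed.

Lemma fbm1_int_mul (s t : R) : 0 <= s -> 0 <= t -> int1 P (fun w => X s w * X t w).
Proof.
move=> s0 t0; apply: (@int1_le _ _ _ _ _ (fun w => X s w ^+ 2 + X t w ^+ 2)).
- exact: measurable_funM.
- move=> w; rewrite normrM -[X in X + _](real_normK (num_real _)) -[X in _ + X](real_normK (num_real _)).
  have := sqr_ge0 (`|X s w| - `|X t w|); have := normr_ge0 (X s w).
  have := normr_ge0 (X t w); nra.
- by apply: int1D; exact: fbm1_sqr.
Qed.

Lemma fbm1_Ex_mul (s t : R) : 0 <= s -> 0 <= t ->
  Ex P (fun w => X s w * X t w) = fbm_cov H s t.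
Proof.
move=> s0 t0; apply: EFin_inj; rewrite EFin_Ex; last exact: fbm1_int_mul.
rewrite -(fbm1_covariance fX s0 t0) unlock !(fbm1_centered fX)// unlock/=.
by apply: eq_integral => w _; congr EFin; rewrite -[in LHS](subr0 (X s w)) -[in LHS](subr0 (X t w)).
Qed.

(** Gaussianity provides some variance; expanding the square of the linear combination identifies it
    with the quadratic form of the covariance. *)
Lemma fbm1_lincomb (n : nat) (t c : 'I_n -> R) : (forall k, 0 <= t k) ->
  let U w := \sum_k c k * X (t k) w in
  let v := \sum_i \sum_j c i * fbm_cov H (t i) (t j) * c j in
  (forall th r, Ex P (fun w => cos (th + r * U w)) = cos th * expR (- (r ^+ 2 * v / 2))) /\
  (\int[P]_w (expR (U w))%:E <= (expR (v / 2))%:E)%E.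
Proof.
move=> t0 U v.
have mU : measurable_fun setT U.
  by apply: measurable_sum => k; exact: measurable_funM.
have EU : Ex P U = 0.
  rewrite /U Ex_sum => [|k _]; last by apply: int1Z; exact: fbm1_int.
  by rewrite big1// => k _; rewrite ExZ ?fbm1_Ex ?mulr0//; exact: fbm1_int.
have [v' [v'0 mgf cf iU2 EU2]] := gaussian_rvP mU (@gaussX n t c t0) EU.
have vE : v' = v.
  rewrite -EU2.
  transitivity (Ex P (fun w => \sum_i \sum_j c i * c j * (X (t i) w * X (t j) w))).
    apply: eq_Ex => w; rewrite /U expr2 mulr_suml; apply: eq_bigr => i _.
    rewrite mulr_sumr; apply: eq_bigr => j _; ring.
  have im i j : int1 P (fun w => c i * c j * (X (t i) w * X (t j) w)).
    by apply: int1Z; exact: fbm1_int_mul.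
  rewrite Ex_sum => [|i _]; last by apply: int1_sum => j _; exact: im.
  apply: eq_bigr => i _; rewrite Ex_sum => [|j _]; last exact: im.
  apply: eq_bigr => j _; rewrite ExZ; last exact: fbm1_int_mul.
  by rewrite fbm1_Ex_mul//; ring.
rewrite -vE; split; first exact: cf.
have := mgf 1; under eq_integral do rewrite mul1r.
by move=> ->; rewrite expr1n mul1r.
Qed.

(** Brings events on linear combinations within reach of [independent_processes], which speaks of
    generated sigma-algebras. *)
Lemma sigma_process_lincomb (n : nat) (t c : 'I_n -> R) (A : set R) :
  (forall k, 0 <= t k) -> measurable A ->
  sigma_process X ((fun w => \sum_k c k * X (t k) w) @^-1` A).
Proof.
move=> t0 mA.
pose G := [set E | exists (t : R) (A : set R), [/\ 0 <= t, measurable A & E = X t @^-1` A]].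
have mG k : measurable_fun setT (X (t k) : g_sigma_algebraType G -> R).
  move=> _ B mB; rewrite setTI; apply: sub_sigma_algebra.
  by exists (t k), B; split.
have mU : measurable_fun setT (fun w : g_sigma_algebraType G => \sum_k c k * X (t k) w).
  by apply: measurable_sum => k; exact: measurable_funM.
by have := mU measurableT A mA; rewrite setTI.
Qed.

End FbmComponent.

Lemma sum_pairE (V : nmodType) (I J : finType) (F : I * J -> V) :
  \sum_p F p = \sum_i \sum_j F (i, j).
Proof. by rewrite pair_bigA; apply: eq_bigr => -[]. Qed.

Section FbmFamily.
Context {disp : measure_display} {T : measurableType disp} {R : realType}.
Variables (P : probability T R) (d m : nat) (H : R).
Variables (B : 'I_d -> R -> {RV P >-> R}) (t : 'I_m -> R).

Definition fbmX (p : 'I_d * 'I_m) (w : T) : R := B p.1 (t p.2) w.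
Definition fbmS (p q : 'I_d * 'I_m) : R :=
  if p.1 == q.1 then fbm_cov H (t p.2) (t q.2) else 0.

Lemma fbmS_bil (a c : 'I_d * 'I_m -> R) : bil fbmS a c =
  \sum_i \sum_j \sum_k a (i, j) * fbm_cov H (t j) (t k) * c (i, k).
Proof.
rewrite /bil sum_pairE.
apply: eq_bigr => i _; apply: eq_bigr => j _.
rewrite sum_pairE.
rewrite (bigD1 i)//= [X in _ + X]big1 ?addr0.
  by apply: eq_bigr => k _; rewrite /fbmS/= eqxx.
move=> i' /negbTE ii'; rewrite big1// => k _.
by rewrite /fbmS/= eq_sym ii' mulr0 mul0r.
Qed.

Lemma fbm_gaussian_family : is_fbm H B -> (forall j, 0 <= t j) ->
  gaussian_family P fbmX fbmS.
Proof.
move=> [fB indB] t0.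
pose U (c : 'I_d * 'I_m -> R) i w := \sum_j c (i, j) * B i (t j) w.
have mU c i : measurable_fun setT (U c i).
  by apply: measurable_sum => k; exact: measurable_funM.
pose v (c : 'I_d * 'I_m -> R) i := \sum_j \sum_k c (i, j) * fbm_cov H (t j) (t k) * c (i, k).
have UE c w : \sum_p c p * fbmX p w = \sum_i U c i w.
  by rewrite sum_pairE.
have vE c : bil fbmS c c = \sum_i v c i by rewrite fbmS_bil.
have ind c (A : 'I_d -> set R) : (forall i, measurable (A i)) ->
    P (\bigcap_i (U c i @^-1` A i)) = (\prod_(i < d) P (U c i @^-1` A i))%E.
  by move=> mA; apply: indB => i; apply: sigma_process_lincomb.
have L c i := fbm1_lincomb (fB i) (fun j => c (i, j)) t0.
split.
- by move=> p; exact: measurable_funPT.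
- move=> th c; under eq_Ex do rewrite UE.
  by rewrite vE (Ex_cos_sum_indep (mU c) (ind c) (v := v c))// => i th' r; exact: (L c i).1.
- move=> c; under eq_integral do rewrite UE.
  rewrite vE; apply: (le_integral_expR_sum_indep (mU c) (ind c)) => i.
  exact: (L c i).2.
Qed.

End FbmFamily.

(** * Covariance of fractional increments *)

Section PowerIncrements.
Context {R : realType}.
Implicit Types (x y t q h : R).

Lemma powR_convex q t x y : 1 <= q -> 0 <= t <= 1 -> 0 <= x -> 0 <= y ->
  (t * x + (1 - t) * y) `^ q <= t * x `^ q + (1 - t) * y `^ q.
Proof.
move=> q1 /andP[t0 t1] x0 y0.
have := @convex_powR R q q1 (Itv01 t0 t1) x y; rewrite !inE/= !in_itv/= !andbT.
by move=> /(_ x0 y0); rewrite !convRE.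
Qed.

(** Convexity of the power [q^-1], applied to the [q]-th powers of [x] and [y]; the increasing power
    [q] is then taken on both sides. *)
Lemma powR_concave q t x y : 0 < q -> q <= 1 -> 0 <= t <= 1 -> 0 <= x -> 0 <= y ->
  t * x `^ q + (1 - t) * y `^ q <= (t * x + (1 - t) * y) `^ q.
Proof.
move=> q0 q1 t01 x0 y0; have /andP[t0 t1] := t01.
have xq0 := powR_ge0 x q; have yq0 := powR_ge0 y q.
have q1' : 1 <= q^-1 by rewrite invf_ge1.
have := powR_convex q1' t01 xq0 yq0.
rewrite -!powRrM !mulfV ?gt_eqF// !powRr1// => h.
have z0 : 0 <= t * x `^ q + (1 - t) * y `^ q by rewrite addr_ge0// mulr_ge0// subr_ge0.
have w0 : 0 <= t * x + (1 - t) * y by rewrite addr_ge0// mulr_ge0// subr_ge0.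
have := ge0_ler_powR (ltW q0) _ _ h; rewrite !nnegrE powR_ge0 => /(_ isT w0).
by rewrite -powRrM mulVf ?gt_eqF// powRr1.
Qed.

(** The middle points [x + h] and [x + h'] are barycentres of the two endpoints with exchanged
    weights. Adding the two convexity inequalities therefore gives the sign of the mixed second
    difference. *)
Let mid x h h' : 0 <= x -> 0 <= h -> 0 <= h' -> 0 < h + h' ->
  exists t, [/\ 0 <= t <= 1, x + h = t * x + (1 - t) * (x + h + h') &
             x + h' = (1 - t) * x + (1 - (1 - t)) * (x + h + h')].
Proof.
move=> x0 h0 h'0 hh; exists (h' / (h + h')); split.
- by rewrite divr_ge0//= ?(ltW hh)// ler_pdivrMr// mul1r lerDr.
- by field; rewrite gt_eqF.
- by field; rewrite gt_eqF.
Qed.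

Lemma powR_increment_ge q x h h' : 1 <= q -> 0 <= x -> 0 <= h -> 0 <= h' ->
  0 <= (x + h + h') `^ q - (x + h') `^ q - (x + h) `^ q + x `^ q.
Proof.
move=> q1 x0 h0 h'0.
have [hh|hh] := ltP 0 (h + h'); last first.
  have -> : h = 0 by lra.
  have -> : h' = 0 by lra.
  by rewrite !addr0; lra.
have [t [t01 e1 e2]] := mid x0 h0 h'0 hh.
have t01' : 0 <= 1 - t <= 1 by case/andP: t01 => ? ?; apply/andP; split; lra.
have y0 : 0 <= x + h + h' by rewrite !addr_ge0.
have := powR_convex q1 t01 x0 y0; have := powR_convex q1 t01' x0 y0.
rewrite -e1 -e2; lra.
Qed.

Lemma powR_increment_le q x h h' : 0 < q -> q <= 1 -> 0 <= x -> 0 <= h -> 0 <= h' ->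
  (x + h + h') `^ q - (x + h') `^ q - (x + h) `^ q + x `^ q <= 0.
Proof.
move=> q0 q1 x0 h0 h'0.
have [hh|hh] := ltP 0 (h + h'); last first.
  have -> : h = 0 by lra.
  have -> : h' = 0 by lra.
  by rewrite !addr0; lra.
have [t [t01 e1 e2]] := mid x0 h0 h'0 hh.
have t01' : 0 <= 1 - t <= 1 by case/andP: t01 => ? ?; apply/andP; split; lra.
have y0 : 0 <= x + h + h' by rewrite !addr_ge0.
have := powR_concave q0 q1 t01 x0 y0; have := powR_concave q0 q1 t01' x0 y0.
rewrite -e1 -e2; lra.
Qed.

End PowerIncrements.

Section IncrementCovariance.
Context {R : realType}.
Variable H : R.
Hypothesis H0 : 0 < H.
Implicit Types (s u v : R).

(** The covariance of the increments over [[s, u]] and [[s', u']], additive in each of the two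
    intervals. *)
Definition inc_cov s u s' u' : R :=
  fbm_cov H u u' - fbm_cov H u s' - (fbm_cov H s u' - fbm_cov H s s').

Lemma fbm_covC s u : fbm_cov H s u = fbm_cov H u s.
Proof. by rewrite /fbm_cov distrC; ring. Qed.

Lemma inc_covC s u s' u' : inc_cov s u s' u' = inc_cov s' u' s u.
Proof.
rewrite /inc_cov (fbm_covC u' u) (fbm_covC u' s) (fbm_covC s' u) (fbm_covC s' s); ring.
Qed.

Lemma inc_cov_diag s u : s <= u -> inc_cov s u s u = (u - s) `^ (2 * H).
Proof.
move=> su; rewrite /inc_cov /fbm_cov !subrr !normr0 powR0 ?mulf_neq0 ?gt_eqF//.
rewrite (ger0_norm (_ : 0 <= u - s)) ?subr_ge0// [`|s - u|]distrC.
rewrite (ger0_norm (_ : 0 <= u - s)) ?subr_ge0//; lra.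
Qed.

Lemma inc_covE s u s' u' : s <= u -> u <= s' -> s' <= u' ->
  inc_cov s u s' u' = 2^-1 * ((s' - u + (u - s) + (u' - s')) `^ (2 * H) -
   (s' - u + (u' - s')) `^ (2 * H) - (s' - u + (u - s)) `^ (2 * H) + (s' - u) `^ (2 * H)).
Proof.
move=> su us' su'; rewrite /inc_cov /fbm_cov.
rewrite !(ger0_norm (_ : 0 <= _ - _)) ?subr_ge0//; try lra.
have -> : s' - u + (u - s) + (u' - s') = u' - s by ring.
have -> : s' - u + (u' - s') = u' - u by ring.
have -> : s' - u + (u - s) = s' - s by ring.
lra.
Qed.

(* Fractional increments over disjoint intervals are positively correlated for
   [2 H >= 1] and negatively correlated for [2 H <= 1]. *)
Definition cov_sign : R := if 1 <= 2 * H then 1 else -1.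

Lemma inc_cov_sign s u s' u' : s <= u -> u <= s' -> s' <= u' ->
  0 <= cov_sign * inc_cov s u s' u'.
Proof.
move=> su us' su'; rewrite inc_covE// /cov_sign.
have h1 : 0 <= s' - u by rewrite subr_ge0.
have h2 : 0 <= u - s by rewrite subr_ge0.
have h3 : 0 <= u' - s' by rewrite subr_ge0.
case: ifPn => h.
  by rewrite mul1r mulr_ge0 ?invr_ge0// powR_increment_ge.
rewrite mulN1r oppr_ge0 pmulr_rle0 ?invr_gt0//.
by rewrite powR_increment_le ?mulr_gt0// ltW// ltNge.
Qed.

(** Enlarging the ordered intervals adds covariances of ordered increments, all of the same sign, so
    nothing can cancel. *)
Lemma inc_cov_mono s u v s' u' v' : s <= u -> u <= v -> v <= s' -> s' <= u' -> u' <= v' ->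
  `|inc_cov s u s' u'| <= cov_sign * inc_cov s v s' v'.
Proof.
move=> su uv vs' su' uv'.
have us' := le_trans uv vs'; have sv := le_trans su uv.
have -> : `|inc_cov s u s' u'| = cov_sign * inc_cov s u s' u'.
  have := inc_cov_sign su us' su'; rewrite /cov_sign; case: ifP => _.
    by rewrite !mul1r => ?; rewrite ger0_norm.
  by rewrite !mulN1r oppr_ge0 => ?; rewrite ler0_norm.
have -> : inc_cov s v s' v' = inc_cov s u s' u' + inc_cov s u u' v' + inc_cov u v s' v'.
  by rewrite /inc_cov; ring.
have h1 := inc_cov_sign su (le_trans us' su') uv'.
have h2 := inc_cov_sign uv vs' (le_trans su' uv').
by rewrite [leRHS]mulrDr [X in _ <= X + _]mulrDr -[leRHS]addrA lerDl addr_ge0.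
Qed.

Variables (Delta : R) (n : nat).
Hypothesis D0 : 0 < Delta.
Let s (k : nat) : R := k%:R * Delta.

(* Off the diagonal the sign is constant, so the increments can be enlarged to the
   full blocks, after which the double sum telescopes. *)
Lemma inc_cov_sum (u e : 'I_n -> R) : (forall k : 'I_n, s k <= u k <= s k.+1) ->
  (forall k, `|e k| <= 1) ->
  \sum_k \sum_l e k * e l * inc_cov (s k) (u k) (s l) (u l) <=
  2 * Delta `^ (2 * H) * n%:R `^ Num.max (2 * H) 1.
Proof.
move=> su e1; pose q := 2 * H; have q0 : 0 < q by rewrite mulr_gt0.
have sS k : s k.+1 - s k = Delta by rewrite /s -natr1; ring.
have sle k : s k <= s k.+1 by rewrite -subr_ge0 sS ltW.
have smono k l : (k <= l)%N -> s k <= s l.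
  by move=> kl; rewrite /s ler_wpM2r ?ler_nat// ltW.
pose C k l := inc_cov (s k) (s k.+1) (s l) (s l.+1).
have diagC k : C k k = Delta `^ q by rewrite /C inc_cov_diag// sS.
have offdiag (k l : 'I_n) : k != l -> `|inc_cov (s k) (u k) (s l) (u l)| <= cov_sign * C k l.
  move=> kl; wlog : k l kl / (k < l)%N => [hw|klt].
    have := kl; rewrite neq_ltn => /orP[/hw -> //|lk].
    rewrite inc_covC (_ : C k l = C l k); last exact: inc_covC.
    by apply: hw => //; rewrite eq_sym.
  have /andP[h1 h2] := su k; have /andP[h3 h4] := su l.
  by apply: inc_cov_mono => //; exact: smono.
have total : \sum_(k < n) \sum_(l < n) C k l = (n%:R * Delta) `^ q.
  have inner k : \sum_(l < n) C k l = inc_cov (s k) (s k.+1) 0 (s n).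
    have G m : \sum_(l < m) C k l = inc_cov (s k) (s k.+1) 0 (s m).
      elim: m => [|m IH].
        by rewrite big_ord0 /s mul0r /inc_cov; ring.
      by rewrite big_ord_recr/= IH /C /inc_cov; ring.
    exact: G.
  under eq_bigr do rewrite inner.
  have G m : \sum_(k < m) inc_cov (s k) (s k.+1) 0 (s n) = inc_cov 0 (s m) 0 (s n).
    elim: m => [|m IH].
      by rewrite big_ord0 /s mul0r /inc_cov; ring.
    by rewrite big_ord_recr/= IH /inc_cov; ring.
  rewrite G inc_cov_diag ?subr0// /s mulr_ge0// ltW//.
(* For [2 * H < 1] the diagonal enters [cov_sign * C] with the wrong sign, and the correction
   restores it at a cost of [2 * Delta ^ (2 H)] per block, hence the order [n]. For [2 * H >= 1] the
   correction is 0. *)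
have bound : \sum_k \sum_l e k * e l * inc_cov (s k) (u k) (s l) (u l) <=
   \sum_(k < n) (\sum_(l < n) cov_sign * C k l + (1 - cov_sign) * Delta `^ q).
  apply: ler_sum => k _; rewrite (bigD1 k)//= [in leRHS](bigD1 k)//= diagC.
  have h1 : e k * e k * inc_cov (s k) (u k) (s k) (u k) <= Delta `^ q.
    have /andP[h1 h2] := su k; rewrite inc_cov_diag//.
    have h3 : u k - s k <= Delta by rewrite -(sS k) lerB.
    have h4 : (u k - s k) `^ q <= Delta `^ q.
      by apply: ge0_ler_powR => //; rewrite ?nnegrE ?subr_ge0// ltW.
    apply: le_trans h4; rewrite ler_piMl ?powR_ge0// -expr2.
    by rewrite -(real_normK (num_real _)) expr_le1.
  have h2 : \sum_(l < n | l != k) e k * e l * inc_cov (s k) (u k) (s l) (u l) <=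
      \sum_(l < n | l != k) cov_sign * C k l.
    apply: ler_sum => l lk; apply: le_trans (ler_norm _) _.
    apply: le_trans (offdiag k l _); last by rewrite eq_sym.
    by rewrite normrM ler_piMl// normrM mulr_ile1.
  apply: le_trans (lerD h1 h2) _.
  rewrite addrAC mulrBl mul1r addrCA subrr addr0.
  lra.
apply: le_trans bound _.
rewrite big_split/= sumr_const card_ord.
under eq_bigr do rewrite -mulr_sumr.
rewrite -mulr_sumr total powRM// ?(ltW D0)// -[X in _ + X]mulr_natr.
set Dq := Delta `^ q; set N : R := n%:R.
have Dq0 : 0 <= Dq by exact: powR_ge0.
have [n0|n0] := posnP n.
  rewrite /N n0 mulr0n powR0 ?gt_eqF// !mulr0 mul0r mulr0 addr0.
  by rewrite !mulr_ge0 ?powR_ge0.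
have N1 : 1 <= N by rewrite ler1n.
have Nq0 : 0 <= N `^ q by exact: powR_ge0.
rewrite /cov_sign -/q; have [h|h] := leP 1 q.
  rewrite !mul1r subrr mul0r mul0r addr0 -mulrA.
  have := mulr_ge0 Dq0 Nq0; lra.
rewrite powRr1 ?ler0n//.
have := mulr_ge0 Nq0 Dq0; nra.
Qed.

End IncrementCovariance.

(** * Contractivity of the Euler scheme *)

(** Cauchy-Schwarz from the positivity of a binary quadratic form, used for the Euclidean product as
    well as for a degenerate [S]. When [Z = 0] and [Y] is not 0, the form would take the value
    -1. *)
Lemma discriminant_le (R : rcfType) (X Y Z : R) : 0 <= X -> 0 <= Z ->
  (forall a c, 0 <= a ^+ 2 * X - 2 * a * c * Y + c ^+ 2 * Z) ->
  Y <= Num.sqrt X * Num.sqrt Z.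
Proof.
move=> X0 Z0 h; rewrite -sqrtrM// (le_trans (ler_norm _))// -sqrtr_sqr ler_wsqrtr//.
have [Zgt|Zle] := ltP 0 Z.
  have := h Z Y; have -> : Z ^+ 2 * X - 2 * Z * Y * Y + Y ^+ 2 * Z = Z * (X * Z - Y ^+ 2) by ring.
  by rewrite pmulr_rge0// subr_ge0.
have {}Z0 : Z = 0 by apply/eqP; rewrite eq_le Zle.
have [->|Y0] := eqVneq Y 0; first by rewrite expr0n/= Z0 mulr0.
have := h 1 ((X + 1) / (2 * Y)); rewrite Z0.
have -> : 1 ^+ 2 * X - 2 * 1 * ((X + 1) / (2 * Y)) * Y + ((X + 1) / (2 * Y)) ^+ 2 * 0 = -1.
  by field.
by rewrite lerNr oppr0 ler10.
Qed.

Section EuclideanNorm.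
Context {R : realType} {d : nat}.
Implicit Types (x y : 'cV[R]_d) (k : R).

Lemma dotcvC x y : dotcv x y = dotcv y x.
Proof. by apply: eq_bigr => i _; rewrite mulrC. Qed.

Lemma dotcvDr x y z : dotcv x (y + z) = dotcv x y + dotcv x z.
Proof. by rewrite -big_split/=; apply: eq_bigr => i _; rewrite mxE mulrDr. Qed.

Lemma dotcvZr k x y : dotcv x (k *: y) = k * dotcv x y.
Proof. by rewrite mulr_sumr; apply: eq_bigr => i _; rewrite mxE mulrCA. Qed.

Lemma dotcvDl x y z : dotcv (x + y) z = dotcv x z + dotcv y z.
Proof. by rewrite dotcvC dotcvDr !(dotcvC z). Qed.

Lemma dotcvZl k x y : dotcv (k *: x) y = k * dotcv x y.
Proof. by rewrite dotcvC dotcvZr dotcvC. Qed.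

Lemma dotcv_ge0 x : 0 <= dotcv x x.
Proof. by apply: sumr_ge0 => i _; rewrite -expr2 sqr_ge0. Qed.

Lemma enorm_ge0 x : 0 <= enorm x.
Proof. exact: sqrtr_ge0. Qed.

Lemma enorm_sqr x : enorm x ^+ 2 = dotcv x x.
Proof. by rewrite sqr_sqrtr// dotcv_ge0. Qed.

Lemma le_enorm x k : 0 <= k -> dotcv x x <= k ^+ 2 -> enorm x <= k.
Proof.
move=> k0 h; rewrite -(ger0_norm k0) -sqrtr_sqr ler_wsqrtr//.
Qed.

Lemma enorm0 : enorm (0 : 'cV[R]_d) = 0.
Proof. by rewrite /enorm /dotcv big1 ?sqrtr0// => i _; rewrite mxE mul0r. Qed.

Lemma dotcv_CS x y : dotcv x y <= enorm x * enorm y.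
Proof.
have h (a c : R) : 0 <= a ^+ 2 * dotcv x x - 2 * a * c * dotcv x y + c ^+ 2 * dotcv y y.
  have := dotcv_ge0 (a *: x + (- c) *: y).
  rewrite !(dotcvDl, dotcvDr, dotcvZl, dotcvZr) (dotcvC y x); lra.
by apply: discriminant_le => //; exact: dotcv_ge0.
Qed.

Lemma enormD x y : enorm (x + y) <= enorm x + enorm y.
Proof.
apply: le_enorm; first by rewrite addr_ge0// enorm_ge0.
rewrite !(dotcvDl, dotcvDr) (dotcvC y x) -!enorm_sqr; have := dotcv_CS x y; lra.
Qed.

Lemma enormZ k x : enorm (k *: x) = `|k| * enorm x.
Proof. by rewrite /enorm dotcvZl dotcvZr mulrA -expr2 sqrtrM ?sqr_ge0// sqrtr_sqr. Qed.

Lemma enormN x : enorm (- x) = enorm x.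
Proof. by rewrite -scaleN1r enormZ normrN normr1 mul1r. Qed.

Lemma enorm_sum (I : Type) (s : seq I) (u : I -> 'cV[R]_d) :
  enorm (\sum_(i <- s) u i) <= \sum_(i <- s) enorm (u i).
Proof.
elim: s => [|i s IH]; first by rewrite !big_nil enorm0.
by rewrite !big_cons (le_trans (enormD _ _))// lerD2l.
Qed.

Lemma le_coord_enorm x i : `|x i 0| <= enorm x.
Proof.
rewrite -sqrtr_sqr ler_wsqrtr// /dotcv (bigD1 i)//= -expr2 lerDl.
by apply: sumr_ge0 => j _; rewrite -expr2 sqr_ge0.
Qed.

Lemma enorm_le_sum x : enorm x <= \sum_i `|x i 0|.
Proof.
have -> : x = \sum_i x i 0 *: delta_mx i 0.
  apply/matrixP => i j; rewrite summxE (bigD1 i)//= big1.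
    by rewrite !mxE ord1 !eqxx mulr1 addr0.
  by move=> k ki; rewrite !mxE eq_sym (negbTE ki) mulr0.
apply: le_trans (enorm_sum _ _) _.
apply: ler_sum => i _; rewrite enormZ; set y := \sum_i _.
have -> : y i 0 = x i 0.
  rewrite /y summxE (bigD1 i)//= big1.
    by rewrite !mxE !eqxx mulr1 addr0.
  by move=> k ki; rewrite !mxE eq_sym (negbTE ki) mulr0.
rewrite ler_piMr//; apply: le_enorm => //.
rewrite /dotcv (bigD1 i)//= big1 ?addr0; first by rewrite !mxE !eqxx !mulr1 expr1n.
by move=> k ki; rewrite !mxE (negbTE ki) mul0r.
Qed.

Lemma mulmx_enorm_le (A : 'M[R]_d) : exists2 C : R, 0 < C &
  forall x, enorm (A *m x) <= C * \sum_i `|x i 0|.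
Proof.
(* The summand 1 keeps the constant positive for a zero matrix. *)
exists (1 + \sum_i \sum_j `|A i j|).
  by rewrite ltr_wpDr// sumr_ge0// => i _; rewrite sumr_ge0.
move=> x; apply: le_trans (enorm_le_sum _) _.
apply: (@le_trans _ _ ((\sum_i \sum_j `|A i j|) * \sum_i `|x i 0|)); last first.
  by rewrite ler_wpM2r ?lerDr// sumr_ge0.
rewrite mulr_suml; apply: ler_sum => i _; rewrite mxE mulr_suml.
apply: le_trans (ler_norm_sum _ _ _) _; apply: ler_sum => j _.
rewrite normrM ler_wpM2l// (bigD1 j)//= lerDl sumr_ge0//.
Qed.

End EuclideanNorm.

Section Euler.
Context {R : realType} {d : nat}.
Variables (b : 'cV[R]_d -> 'cV[R]_d) (alpha L : R).
Hypothesis alpha_gt0 : 0 < alpha.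
Hypothesis L_gt0 : 0 < L.
Hypothesis b_contractive : forall y z : 'cV[R]_d,
  dotcv (b y - b z) (y - z) <= - alpha * enorm (y - z) ^+ 2.
Hypothesis b_lipschitz : forall y z : 'cV[R]_d,
  enorm (b y - b z) <= L * enorm (y - z).
Variables (x0 : 'cV[R]_d) (tau : R).
Hypothesis tau_gt0 : 0 < tau.
Hypothesis tau_alpha : alpha * tau <= 1.
Hypothesis tau_L : L ^+ 2 * tau <= alpha.
Implicit Types (eta beta : nat -> 'cV[R]_d).

(* The scheme for the difference of the solution and the noise [beta], which
   makes the dependence on the noise pathwise Lipschitz. *)
Fixpoint eulerV beta (j : nat) : 'cV[R]_d :=
  if j is j'.+1 then eulerV beta j' + tau *: b (eulerV beta j' + beta j') else x0.

Definition eulerY beta j := eulerV beta j + beta j.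

(** By contractivity and [L ^+ 2 * tau <= alpha], one step multiplies the squared distance of two
    schemes with the same noise by at most [1 - 2 * alpha * tau + alpha * tau], which is at most
    [rho ^+ 2]. *)
Let rho : R := 1 - alpha * tau / 2.

Let rho_ge0 : 0 <= rho.
Proof. by rewrite /rho subr_ge0 ler_pdivrMr// mul1r; apply: le_trans tau_alpha _; rewrite ler1n. Qed.

Let step_contraction (y D : 'cV[R]_d) :
  enorm (D + tau *: (b (y + D) - b y)) <= rho * enorm D.
Proof.
apply: le_enorm; first by rewrite mulr_ge0// enorm_ge0.
have h1 := b_contractive (y + D) y; have h2 := b_lipschitz (y + D) y.
rewrite (_ : y + D - y = D) in h1 h2; last by rewrite addrAC subrr add0r.
move: (b (y + D) - b y) h1 h2 => W h1 h2.
rewrite !(dotcvDl, dotcvDr, dotcvZl, dotcvZr) (dotcvC D W) -!enorm_sqr.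
set e := enorm D in h1 h2 *; set v := enorm W in h2 *.
set c := dotcv W D in h1 *.
have e0 : 0 <= e by exact: enorm_ge0.
have v0 : 0 <= v by exact: enorm_ge0.
have h3 : v ^+ 2 <= L ^+ 2 * e ^+ 2.
  by rewrite -exprMn lerXn2r ?nnegrE// mulr_ge0// ltW.
have h4 : tau * (tau * v ^+ 2) <= tau * (alpha * e ^+ 2).
  rewrite ler_wpM2l ?(ltW tau_gt0)//.
  apply: (@le_trans _ _ (tau * (L ^+ 2 * e ^+ 2))).
    by rewrite ler_wpM2l// ltW.
  by rewrite mulrA [tau * _]mulrC ler_wpM2r// sqr_ge0.
have h5 : tau * c <= tau * (- alpha * e ^+ 2) by rewrite ler_wpM2l// ltW.
have h6 : 0 <= (alpha * tau / 2) ^+ 2 * e ^+ 2 by rewrite mulr_ge0// sqr_ge0.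
rewrite /rho; nra.
Qed.

Section Perturbation.
Variables (beta eta : nat -> 'cV[R]_d).
Let D j := eulerY (fun j => beta j + eta j) j - eulerY beta j.

Let D_V j : D j = eulerV (fun j => beta j + eta j) j - eulerV beta j + eta j.
Proof. by rewrite /D /eulerY; apply/matrixP => i k; rewrite !mxE; ring. Qed.

Let c0 := 1 + 2 * L / alpha.

(** Once the noise increment since the start of the block is subtracted, the difference is
    contracted by [rho] at each step, up to a forcing [tau * L * gam]. The geometric series sums to
    [2 * L / alpha * gam], and putting the increment back gives [c0]. *)
Lemma euler_block (j0 p : nat) (gam : R) : 0 <= gam ->
  (forall i, (i <= p)%N -> enorm (eta (j0 + i)%N - eta j0) <= gam) ->
  forall i, (i <= p)%N -> enorm (D (j0 + i)%N) <= rho ^+ i * enorm (D j0) + c0 * gam.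
Proof.
move=> gam0 Hg.
pose U i := D (j0 + i)%N - (eta (j0 + i)%N - eta j0).
have US i : U i.+1 = U i + tau *: (b (eulerY beta (j0 + i) + U i) - b (eulerY beta (j0 + i)))
   + tau *: (b (eulerY beta (j0 + i) + U i + (eta (j0 + i)%N - eta j0)) - b (eulerY beta (j0 + i) + U i)).
  set y := eulerY beta (j0 + i).
  have -> : y + U i + (eta (j0 + i)%N - eta j0) = eulerY (fun j => beta j + eta j) (j0 + i).
    by rewrite /U /D -/y; apply/matrixP => a c; rewrite !mxE; ring.
  rewrite /U !D_V addnS /=.
  rewrite -[eulerV beta (j0 + i) + beta (j0 + i)%N]/(eulerY beta (j0 + i)) -/y.
  rewrite -/(eulerY (fun j => beta j + eta j) (j0 + i)).
  by apply/matrixP => a c; rewrite !mxE; ring.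
have HU i : (i <= p)%N -> enorm (U i) <= rho ^+ i * enorm (D j0) + 2 * L / alpha * gam.
  elim: i => [|i IH] ip.
    rewrite /U addn0 subrr subr0 expr0 mul1r lerDl mulr_ge0// divr_ge0 ?mulr_ge0// ltW//.
  rewrite US; apply: le_trans (enormD _ _) _.
  have h1 := step_contraction (eulerY beta (j0 + i)) (U i).
  have h2 : enorm (tau *: (b (eulerY beta (j0 + i) + U i + (eta (j0 + i)%N - eta j0)) -
      b (eulerY beta (j0 + i) + U i))) <= tau * (L * gam).
    rewrite enormZ gtr0_norm// ler_wpM2l ?(ltW tau_gt0)//.
    apply: le_trans (b_lipschitz _ _) _; rewrite ler_wpM2l ?(ltW L_gt0)//.
    rewrite [_ + U i + _]addrC addrK; exact: Hg (ltnW ip).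
  apply: le_trans (lerD h1 h2) _.
  apply: (@le_trans _ _ (rho * (rho ^+ i * enorm (D j0) + 2 * L / alpha * gam) + tau * (L * gam))).
    by rewrite lerD2r ler_wpM2l// IH// ltnW.
  rewrite le_eqVlt; apply/orP; left; apply/eqP.
  by rewrite exprS /rho; field; rewrite gt_eqF.
move=> i ip.
have -> : D (j0 + i)%N = U i + (eta (j0 + i)%N - eta j0).
  by rewrite /U; apply/matrixP => a c; rewrite !mxE; ring.
apply: le_trans (enormD _ _) _; apply: le_trans (lerD (HU i ip) (Hg i ip)) _.
rewrite /c0 mulrDl mul1r; lra.
Qed.

(** Since [(1 - x) * (1 + (p+1) * x) <= 1 + p * x]. The resulting bound on [rho ^+ p] depends on
    [p * tau] only, that is on the block length and not on the mesh. *)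
Lemma rho_exp p : rho ^+ p * (1 + p%:R * (alpha * tau / 2)) <= 1.
Proof.
set x := alpha * tau / 2.
have xge0 : 0 <= x by rewrite divr_ge0// mulr_ge0// ltW.
elim: p => [|p IH]; first by rewrite expr0 mul0r addr0 mul1r.
apply: le_trans IH; rewrite exprSr -mulrA ler_wpM2l ?exprn_ge0//.
rewrite -natr1 /rho -/x.
have : 0 <= p%:R * (x ^+ 2) by rewrite mulr_ge0// sqr_ge0.
have := sqr_ge0 x; nra.
Qed.

(** The differences at block ends satisfy [a (k+1) <= q * a k + c0 * gam k] with [a 0 = 0], so their
    sum is at most [c0 / (1 - q)] times the sum of [gam], where [1 / (1 - q) = 1 + 2 / Dl]. The
    points inside the blocks cost one more [c0]. *)
Lemma euler_blocks (n p : nat) (gam : nat -> R) : (0 < p)%N -> eta 0%N = 0 ->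
  (forall k, 0 <= gam k) ->
  (forall k i, (k < n)%N -> (i <= p)%N -> enorm (eta (k * p + i)%N - eta (k * p)%N) <= gam k) ->
  forall (w : nat -> R), (forall i, 0 <= w i) -> \sum_(i < p) w i = 1 ->
  \sum_(k < n) \sum_(i < p) w i * enorm (D (k * p + i.+1)%N) <=
  c0 * (2 + 2 / (alpha * (p%:R * tau))) * \sum_(k < n) gam k.
Proof.
move=> p0 eta0 gam0 Hg w w0 w1.
pose a k := enorm (D (k * p)%N).
pose Dl := alpha * (p%:R * tau).
have Dl0 : 0 < Dl by rewrite mulr_gt0// mulr_gt0// ltr0n.
pose q := (1 + Dl / 2)^-1.
have q0 : 0 < q by rewrite invr_gt0 ltr_pwDl// divr_ge0// ltW.
have rq : rho ^+ p <= q.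
  rewrite /q -[leRHS]mul1r ler_pdivlMr ?ltr_pwDl// ?divr_ge0 ?(ltW Dl0)//.
  have := rho_exp p; rewrite (_ : p%:R * (alpha * tau / 2) = Dl / 2)// /Dl; ring.
have rho1 i : rho ^+ i <= 1.
  apply: exprn_ile1 => //; rewrite /rho lerBlDr lerDl divr_ge0// mulr_ge0// ltW//.
have c00 : 0 <= c0 by rewrite /c0 addr_ge0// divr_ge0 ?mulr_ge0// ltW.
have a0 : a 0%N = 0.
  by rewrite /a mul0n D_V/= subrr add0r eta0 enorm0.
have aS k : (k < n)%N -> a k.+1 <= q * a k + c0 * gam k.
  move=> kn; have := euler_block (gam0 k) (fun i ip => Hg k i kn ip) (leqnn p).
  rewrite -mulSnr => /le_trans; apply; rewrite lerD2r ler_wpM2r// enorm_ge0//.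
have asum m : (m <= n)%N -> \sum_(k < m) a k + a m / (1 - q) <= c0 / (1 - q) * \sum_(k < m) gam k.
  have q1 : 0 < 1 - q.
    by rewrite subr_gt0 invf_lt1 ?ltrDl ?divr_gt0// ltr_pwDl// divr_ge0// ltW.
  elim: m => [|m IH] mn; first by rewrite !big_ord0 a0 mul0r mulr0 addr0.
  rewrite !big_ord_recr/= mulrDr; apply: le_trans (lerD (IH (ltnW mn)) (lexx _)).
  rewrite -!addrA lerD2l.
  apply: (@le_trans _ _ (a m + (q * a m + c0 * gam m) / (1 - q))).
    by rewrite lerD2l ler_wpM2r ?invr_ge0 ?(ltW q1)// aS.
  rewrite le_eqVlt; apply/orP; left; apply/eqP; field; rewrite gt_eqF//.
have q1E : (1 - q)^-1 = 1 + 2 / Dl.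
  rewrite /q; field; rewrite (gt_eqF Dl0)/= gt_eqF//; lra.
have q1 : 0 < 1 - q.
  by rewrite subr_gt0 invf_lt1 ?ltrDl ?divr_gt0// ltr_pwDl// divr_ge0// ltW.
apply: (@le_trans _ _ (\sum_(k < n) (a k + c0 * gam k))).
  apply: ler_sum => k _.
  rewrite -[leRHS]mul1r -w1 mulr_suml; apply: ler_sum => i _.
  rewrite ler_wpM2l//.
  apply: le_trans (euler_block (gam0 k) (fun i ip => Hg k i (ltn_ord k) ip) (ltn_ord i)) _.
  by rewrite lerD2r ler_piMl// enorm_ge0.
rewrite big_split/= -mulr_sumr.
have := asum n (leqnn n); rewrite q1E.
have : 0 <= a n * (1 + 2 / Dl).
  by rewrite mulr_ge0 ?enorm_ge0// addr_ge0// divr_ge0// ltW.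
rewrite -/Dl; set s := \sum_(k < n) a k; set g := \sum_(k < n) gam k; set c := 2 / Dl.
lra.
Qed.

End Perturbation.
End Euler.

Lemma bil_CS (R : rcfType) (I : finType) (S : I -> I -> R) (a g : I -> R) :
  (forall i j, S i j = S j i) -> (forall c, 0 <= \sum_i \sum_j c i * S i j * c j) ->
  \sum_i \sum_j a i * S i j * g j <=
  Num.sqrt (\sum_i \sum_j a i * S i j * a j) * Num.sqrt (\sum_i \sum_j g i * S i j * g j).
Proof.
move=> Ssym S0; apply: discriminant_le => // k c.
have := S0 (fun i => k * a i + (- c) * g i).
set Z := \sum_i _; suff -> : Z = k ^+ 2 * (\sum_i \sum_j a i * S i j * a j) -
    2 * k * c * (\sum_i \sum_j a i * S i j * g j) + c ^+ 2 * (\sum_i \sum_j g i * S i j * g j) by [].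
have sw : \sum_i \sum_j a i * S i j * g j = \sum_i \sum_j g i * S i j * a j.
  rewrite exchange_big/=; apply: eq_bigr => i _; apply: eq_bigr => j _.
  by rewrite Ssym; ring.
transitivity (k ^+ 2 * (\sum_i \sum_j a i * S i j * a j) -
    k * c * (\sum_i \sum_j a i * S i j * g j) - k * c * (\sum_i \sum_j g i * S i j * a j) +
    c ^+ 2 * (\sum_i \sum_j g i * S i j * g j)); last by rewrite -sw; ring.
rewrite /Z !mulr_sumr -!sumrN -!big_split/=; apply: eq_bigr => i _.
rewrite !mulr_sumr -!sumrN -!big_split/=; apply: eq_bigr => j _; ring.
Qed.

Lemma sum_sign (R : realDomainType) (x : R) : `|x| = (if 0 <= x then 1 else -1) * x.
Proof.
case: ifPn => h; first by rewrite mul1r ger0_norm.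
by rewrite mulN1r ltr0_norm// ltNge.
Qed.

Section EulerFunctional.
Context {R : realType} {d : nat}.
Variables (b : 'cV[R]_d -> 'cV[R]_d) (alpha L H : R) (sigma : 'M[R]_d).
Hypothesis alpha_gt0 : 0 < alpha.
Hypothesis L_gt0 : 0 < L.
Hypothesis H_gt0 : 0 < H.
Hypothesis b_contractive : forall y z : 'cV[R]_d,
  dotcv (b y - b z) (y - z) <= - alpha * enorm (y - z) ^+ 2.
Hypothesis b_lipschitz : forall y z : 'cV[R]_d,
  enorm (b y - b z) <= L * enorm (y - z).
Variables (s0 : R).
Hypothesis s0_gt0 : 0 < s0.
Hypothesis sigma_le : forall x : 'cV[R]_d, enorm (sigma *m x) <= s0 * \sum_i `|x i 0|.
Variables (x0 : 'cV[R]_d) (n p : nat) (Delta : R).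
Hypothesis n_gt0 : (0 < n)%N.
Hypothesis p_gt0 : (0 < p)%N.
Hypothesis Delta_gt0 : 0 < Delta.
Let tau := Delta / p%:R.
Let N := (n * p)%N.
Let I := ('I_d * 'I_N.+1)%type.

Definition grid (j : 'I_N.+1) : R := j%:R * tau.
(* [inord j] is a junk index for [j] beyond the grid, where [noise] is never used. *)
Definition noise (z : I -> R) (j : nat) : 'cV[R]_d := sigma *m (\col_i z (i, inord j)).
Definition eulerZ (z : I -> R) (j : nat) : 'cV[R]_d := eulerY b x0 tau (noise z) j.

Variables (f : 'cV[R]_d -> R) (w : nat -> R) (l : R).
Hypothesis l_ge0 : 0 <= l.
Hypothesis f_lip : forall x y, `|f x - f y| <= l * enorm (x - y).
Hypothesis w_ge0 : forall i, 0 <= w i.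
Hypothesis w_sum1 : \sum_(i < p) w i = 1.

(** The weights treat both statements at once: all mass on the last index of a block samples at the
    block ends, equal weights give a time average. *)
Definition functional (z : I -> R) : R :=
  n%:R^-1 * \sum_(k < n) \sum_(i < p) w i * f (eulerZ z (k * p + i.+1)%N).

Lemma functional_bounded M : (forall x, `|f x| <= M) -> forall z, `|functional z| <= M.
Proof.
move=> fM z; rewrite /functional normrM ger0_norm ?invr_ge0//.
rewrite mulrC ler_pdivrMr ?ltr0n//.
apply: le_trans (ler_norm_sum _ _ _) _.
apply: (@le_trans _ _ (\sum_(k < n) M)); last by rewrite sumr_const card_ord mulr_natr.
apply: ler_sum => k _; apply: le_trans (ler_norm_sum _ _ _) _.
rewrite -[leRHS]mul1r -w_sum1 mulr_suml; apply: ler_sum => i _.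
by rewrite normrM (ger0_norm (w_ge0 _)) ler_wpM2l.
Qed.

Lemma functional_diff z z' : `|functional z - functional z'| <=
  l / n%:R * \sum_(k < n) \sum_(i < p) w i *
     enorm (eulerZ z (k * p + i.+1)%N - eulerZ z' (k * p + i.+1)%N).
Proof.
rewrite /functional -mulrBr normrM ger0_norm ?invr_ge0// [l / _]mulrC -mulrA.
rewrite ler_wpM2l ?invr_ge0// mulr_sumr -sumrB.
apply: le_trans (ler_norm_sum _ _ _) _; apply: ler_sum => k _.
rewrite mulr_sumr -sumrB; apply: le_trans (ler_norm_sum _ _ _) _; apply: ler_sum => i _.
by rewrite -mulrBr normrM (ger0_norm (w_ge0 _)) mulrCA ler_wpM2l.
Qed.

Lemma noiseD z h : noise (fun i => z i + h i) = fun j => noise z j + noise h j.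
Proof.
apply/funext => j; rewrite /noise -mulmxDr; congr (_ *m _).
by apply/matrixP => i k; rewrite !mxE.
Qed.

Lemma noise_diff z j j' : enorm (noise z j - noise z j') <=
  s0 * \sum_i `|z (i, inord j) - z (i, inord j')|.
Proof.
rewrite /noise -mulmxBr; apply: le_trans (sigma_le _) _.
by rewrite ler_wpM2l ?(ltW s0_gt0)//; apply: ler_sum => i _; rewrite !mxE.
Qed.

(** A crude bound, growing with [j], for measurability and for the constant [Q] of
    [gaussian_concentration], which is absent from its conclusion. *)
Lemma eulerZ_lip j : exists2 Q : R, 0 <= Q & forall z z' : I -> R,
  enorm (eulerZ z j - eulerZ z' j) <= Q * l1 z z'.
Proof.
have nz k z z' : enorm (noise z k - noise z' k) <= s0 * l1 z z'.
  rewrite /noise -mulmxBr; apply: le_trans (sigma_le _) _.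
  rewrite ler_wpM2l ?(ltW s0_gt0)// /l1 sum_pairE; apply: ler_sum => i _.
  by rewrite !mxE (bigD1 (inord k))//= lerDl sumr_ge0.
have tau0 : 0 < tau by rewrite divr_gt0// ltr0n.
have [Q Q0 HQ] : exists2 Q : R, 0 <= Q & forall z z' : I -> R,
    enorm (eulerV b x0 tau (noise z) j - eulerV b x0 tau (noise z') j) <= Q * l1 z z'.
  elim: j => [|j [Q Q0 IH]].
    by exists 0 => // z z'; rewrite /= subrr enorm0 mul0r.
  exists (Q + tau * (L * (Q + s0))).
    by rewrite addr_ge0// mulr_ge0 ?(ltW tau0)// mulr_ge0 ?(ltW L_gt0)// addr_ge0// ltW.
  move=> z z' /=; set V := eulerV _ _ _ _ _; set V' := eulerV _ _ _ _ _.
  have -> : V + tau *: b (V + noise z j) - (V' + tau *: b (V' + noise z' j)) =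
     (V - V') + tau *: (b (V + noise z j) - b (V' + noise z' j)).
    by apply/matrixP => a c; rewrite !mxE; ring.
  rewrite mulrDl; apply: le_trans (enormD _ _) _; apply: lerD; first exact: IH.
  rewrite enormZ gtr0_norm// -[leRHS]mulrA ler_wpM2l ?(ltW tau0)//.
  apply: le_trans (b_lipschitz _ _) _; rewrite -[leRHS]mulrA ler_wpM2l ?(ltW L_gt0)//.
  have -> : V + noise z j - (V' + noise z' j) = (V - V') + (noise z j - noise z' j).
    by apply/matrixP => a c; rewrite !mxE; ring.
  rewrite mulrDl; apply: le_trans (enormD _ _) _; apply: lerD; first exact: IH.
  exact: nz.
exists (Q + s0); first by rewrite addr_ge0// ltW.
move=> z z'; rewrite /eulerZ /eulerY.
set V := eulerV _ _ _ _ _; set V' := eulerV _ _ _ _ _.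
have -> : V + noise z j - (V' + noise z' j) = (V - V') + (noise z j - noise z' j).
  by apply/matrixP => a c; rewrite !mxE; ring.
by rewrite mulrDl; apply: le_trans (enormD _ _) _; apply: lerD; [exact: HQ|exact: nz].
Qed.

Lemma functional_lip1 : exists Q, lip1 Q functional.
Proof.
pose q j := sval (cid2 (eulerZ_lip j)).
have q0 j : 0 <= q j by rewrite /q; case: cid2.
have Hq j z z' : enorm (eulerZ z j - eulerZ z' j) <= q j * l1 z z' by rewrite /q; case: cid2.
exists (l / n%:R * \sum_(k < n) \sum_(i < p) w i * q (k * p + i.+1)%N); split.
  rewrite mulr_ge0 ?divr_ge0//; apply: sumr_ge0 => k _; apply: sumr_ge0 => i _.
  by rewrite mulr_ge0.
move=> z z'; apply: le_trans (functional_diff z z') _.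
rewrite -[leRHS]mulrA ler_wpM2l ?divr_ge0// mulr_suml; apply: ler_sum => k _.
rewrite mulr_suml; apply: ler_sum => i _.
by rewrite -mulrA ler_wpM2l.
Qed.

Hypothesis tau_alpha : alpha * tau <= 1.
Hypothesis tau_L : L ^+ 2 * tau <= alpha.

Let S : I -> I -> R := fbmS H grid.
Hypothesis S_ge0 : forall c, 0 <= bil S c c.

Let S_sym (i j : I) : S i j = S j i.
Proof. by rewrite /S /fbmS eq_sym fbm_covC. Qed.

(** The constant of [euler_blocks] for blocks of length [Delta], times the bound [s0] on [sigma]. *)
Definition euler_const : R :=
  (1 + 2 * L / alpha) * (2 + 2 / (alpha * Delta)) * s0.

(* Bounds the variation in the Cameron-Martin directions [app S g]: the sum over
   blocks of the oscillations of [app S g] is [bil S a g] for a vector [a] of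
   signs, and Cauchy-Schwarz for [S] leaves [bil S a a], i.e. inc_cov_sum. *)
Lemma functional_CM (z g : I -> R) :
  functional (fun i => z i + app S g i) - functional z <=
  l / n%:R * euler_const *
    Num.sqrt (d%:R * (2 * Delta `^ (2 * H) * n%:R `^ Num.max (2 * H) 1)) * Num.sqrt (bil S g g).
Proof.
set h := app S g.
have tau0 : 0 < tau by rewrite divr_gt0// ltr0n.
have ptau : p%:R * tau = Delta by rewrite /tau mulrC divfK// pnatr_eq0 -lt0n.
(* [J i k] is the place in block [k] where coordinate [i] of [h] is farthest from its value at the
   start of the block. *)
have [J HJ] : exists J : 'I_d -> nat -> 'I_p.+1, forall i k (j : 'I_p.+1),
    `|h (i, inord (k * p + j)%N) - h (i, inord (k * p)%N)| <=
    `|h (i, inord (k * p + J i k)%N) - h (i, inord (k * p)%N)|.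
  exists (fun i k => [arg max_(j > ord0)
    `|h (i, inord (k * p + j)%N) - h (i, inord (k * p)%N)|]%O) => i k j.
  by case: Order.TotalTheory.arg_maxP => // j' _ Hj'; exact: Hj'.
pose gam k := s0 * \sum_i `|h (i, inord (k * p + J i k)%N) - h (i, inord (k * p)%N)|.
have gam0 k : 0 <= gam k by rewrite mulr_ge0 ?(ltW s0_gt0)// sumr_ge0.
(* The fractional Brownian motion starts at 0, so its covariance with time 0, and with it every
   Cameron-Martin direction, vanishes there. *)
have eta0 : noise h 0%N = 0.
  rewrite /noise (_ : \col_i _ = 0) ?mulmx0//.
  apply/matrixP => i k; rewrite !mxE /h /app big1// => q _.
  rewrite /S /fbmS/=; case: eqP => [_|]; last by rewrite mul0r.
  rewrite /fbm_cov /grid inordK// mul0r powR0 ?mulf_neq0 ?gt_eqF// subr0 addr0.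
  have t0 : 0 <= q.2%:R * tau by rewrite mulr_ge0// ltW.
  by rewrite (ger0_norm t0) subrr mulr0 mul0r.
have Hg k i : (k < n)%N -> (i <= p)%N ->
    enorm (noise h (k * p + i)%N - noise h (k * p)%N) <= gam k.
  move=> kn ip; apply: le_trans (noise_diff _ _ _) _.
  rewrite ler_wpM2l ?(ltW s0_gt0)//; apply: ler_sum => i' _.
  have := HJ i' k (inord i); rewrite inordK//.
have step1 := euler_blocks alpha_gt0 L_gt0 b_contractive b_lipschitz x0 tau0 tau_alpha
  tau_L (noise z) p_gt0 eta0 gam0 Hg w_ge0 w_sum1.
rewrite ptau in step1.
have step2 : functional (fun i => z i + h i) - functional z <=
   l / n%:R * ((1 + 2 * L / alpha) * (2 + 2 / (alpha * Delta)) * \sum_(k < n) gam k).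
  apply: le_trans (ler_norm _) _; apply: le_trans (functional_diff _ _) _.
  rewrite ler_wpM2l ?divr_ge0//.
  apply: le_trans step1; rewrite /eulerZ noiseD; exact: lexx.
apply: le_trans step2 _.
have cst_ge0 : 0 <= (1 + 2 * L / alpha) * (2 + 2 / (alpha * Delta)).
  by rewrite mulr_ge0 ?addr_ge0 ?divr_ge0 ?mulr_ge0// ltW.
have ln_ge0 : 0 <= l / n%:R by rewrite divr_ge0.
set A := Num.sqrt (d%:R * _); set B := Num.sqrt _.
suff fin : \sum_(k < n) gam k <= s0 * (A * B).
  apply: le_trans (ler_wpM2l ln_ge0 (ler_wpM2l cst_ge0 fin)) _.
  rewrite /euler_const; set c := 1 + 2 * L / alpha; set c' := 2 + _.
  by rewrite le_eqVlt; apply/orP; left; apply/eqP; ring.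
pose e (i : 'I_d) (k : nat) : R := if 0 <= h (i, inord (k * p + J i k)%N) - h (i, inord (k * p)%N) then 1 else -1.
have e1 i k : `|e i k| <= 1 by rewrite /e; case: ifP; rewrite ?normrN normr1.
(* A combination of point masses whose pairing with a function is a signed sum of its increments;
   paired with [app S g] it gives the sum of the oscillations, and [bil S a a] becomes a sum of
   [inc_cov]. *)
pose a (q : I) : R := \sum_(k < n) e q.1 k *
  ((q.2 == inord (k * p + J q.1 k)%N)%:R - (q.2 == inord (k * p)%N)%:R).
have pairing (F : I -> R) : \sum_q a q * F q =
    \sum_i \sum_(k < n) e i k * (F (i, inord (k * p + J i k)%N) - F (i, inord (k * p)%N)).
  rewrite sum_pairE; apply: eq_bigr => i _; rewrite /a/=.
  under eq_bigr do rewrite mulr_suml.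
  rewrite exchange_big/=; apply: eq_bigr => k _.
  have D (j0 : 'I_N.+1) : \sum_j (j == j0)%:R * F (i, j) = F (i, j0).
    rewrite (bigD1 j0)//= eqxx mul1r big1 ?addr0// => j /negbTE ->.
    by rewrite mul0r.
  rewrite mulrBr -!D !mulr_sumr -sumrB; apply: eq_bigr => j _; ring.
have sumgam : \sum_(k < n) gam k = s0 * bil S a g.
  rewrite /gam -mulr_sumr bil_app pairing exchange_big/=; congr (_ * _).
  by apply: eq_bigr => i _; apply: eq_bigr => k _; rewrite sum_sign.
rewrite sumgam ler_wpM2l ?(ltW s0_gt0)//.
apply: le_trans (bil_CS a g S_sym S_ge0) _.
rewrite ler_wpM2r ?sqrtr_ge0// ler_wsqrtr//.
rewrite -/(bil S a a) bil_app pairing.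
apply: (@le_trans _ _ (\sum_(i < d) (2 * Delta `^ (2 * H) * n%:R `^ Num.max (2 * H) 1))); last first.
  by rewrite sumr_const card_ord [leRHS]mulr_natl.
apply: ler_sum => i _.
have gridE k (j : 'I_p.+1) : (k < n)%N -> grid (inord (k * p + j)) = k%:R * Delta + j%:R * tau.
  move=> kn; rewrite /grid inordK; last first.
    rewrite ltnS /N; apply: (@leq_trans (k * p + p)%N).
      by rewrite leq_add2l -ltnS.
    by rewrite -mulSnr leq_mul2r kn orbT.
  by rewrite natrD natrM mulrDl -mulrA ptau.
have gridE0 k : (k < n)%N -> grid (inord (k * p)) = k%:R * Delta.
  by move=> kn; have := gridE k ord0 kn; rewrite addn0 mul0r addr0.
have appE (q : I) : app S a q = \sum_i' \sum_(k < n) e i' k *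
    (S q (i', inord (k * p + J i' k)%N) - S q (i', inord (k * p)%N)).
  by rewrite -pairing; apply: eq_bigr => q' _; rewrite mulrC.
have SE1 i' (j j' : 'I_N.+1) : S (i', j) (i', j') = fbm_cov H (grid j) (grid j').
  by rewrite /S /fbmS eqxx.
have SE0 i' i2 (j j' : 'I_N.+1) : i' != i2 -> S (i2, j) (i', j') = 0.
  by move=> /negbTE hi; rewrite /S /fbmS eq_sym hi.
pose u (k : 'I_n) := k%:R * Delta + (J i k)%:R * tau.
have su (k : 'I_n) : k%:R * Delta <= u k <= k.+1%:R * Delta.
  rewrite /u lerDl mulr_ge0 ?(ltW tau0)//= -natr1 mulrDl mul1r lerD2l -ptau.
  by rewrite ler_wpM2r ?(ltW tau0)// ler_nat -ltnS.
apply: le_trans (inc_cov_sum H_gt0 Delta_gt0 su (fun k => e1 i k)).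
rewrite le_eqVlt; apply/orP; left; apply/eqP.
apply: eq_bigr => k _; rewrite !appE -sumrB (bigD1 i)//= [X in _ * (_ + X)]big1 ?addr0.
  rewrite -sumrB mulr_sumr; apply: eq_bigr => l' _.
  rewrite !SE1 (gridE k (J i k) (ltn_ord k)) (gridE l' (J i l') (ltn_ord l')).
  by rewrite (gridE0 k (ltn_ord k)) (gridE0 l' (ltn_ord l')) -/(u k) -/(u l') /inc_cov; ring.
move=> i' ii'; rewrite -sumrB big1// => l' _.
by rewrite !(SE0 _ _ _ _ ii') !subrr.
Qed.

End EulerFunctional.

(** * Convergence of the Euler scheme *)

Section HalfLine.
Context {R : realType}.
Implicit Types (g : R -> R) (s t T e r : R).

(** Continuity relative to [[0, +oo[], since nothing is known of the processes at negative times. *)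
Definition cont0 g := forall t, 0 <= t -> forall e, 0 < e ->
  exists2 r, 0 < r & forall s, 0 <= s -> `|t - s| < r -> `|g t - g s| < e.

Lemma within_cont0 g : {within `[0, +oo[, continuous g} -> cont0 g.
Proof.
move=> /subspace_continuousP cg t t0 e e0.
have /cg/cvgrPdist_lt/(_ _ e0) : [set` `[0, +oo[] t by rewrite /= in_itv/= t0.
rewrite /within/= => /nbhs_ballP[r r0 Hr]; exists r => // s s0 ts.
by apply: Hr => //=; rewrite in_itv/= s0.
Qed.

Lemma cont0_within g T : cont0 g -> {within `[0, T], continuous g}.
Proof.
move=> cg; apply/subspace_continuousP => t /=; rewrite in_itv/= => /andP[t0 _].
apply/cvgrPdist_lt => e e0; have [r r0 Hr] := cg t t0 e e0.
rewrite /within/=; apply/nbhs_ballP; exists r => //= s ts; rewrite in_itv/= => /andP[s0 _].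
exact: Hr.
Qed.

Lemma cont0_unif g T : cont0 g -> forall e, 0 < e -> exists2 r, 0 < r &
  forall s t, 0 <= s <= T -> 0 <= t <= T -> `|s - t| < r -> `|g s - g t| < e.
Proof.
move=> cg e e0.
have /near_covering_withinP nc : near_covering `[0, T]%classic.
  by apply/compact_near_coveringP; exact: segment_compact.
pose Q (r s : R) := forall t, 0 <= t <= T -> `|s - t| < r -> `|g s - g t| < e.
have /nc : forall s, `[0, T]%classic s -> \forall s' \near s & r \near 0^'+, `[0, T]%classic s' -> Q r s'.
  move=> s /=; rewrite in_itv/= => /andP[s0 sT].
  have [r r0 Hr] := cg s s0 (e / 2) ltac:(by rewrite divr_gt0).
  exists (ball s (r / 2), [set x | x < r / 2]) => /=.
    split; first by apply: nbhsx_ballx; rewrite divr_gt0.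
    by apply: nbhs_right_lt; rewrite divr_gt0.
  move=> [a b] /= []; rewrite /ball/= => sa br; rewrite in_itv/= => /andP[a0 aT] t /andP[t0 tT] at_.
  have h1 : `|g s - g a| < e / 2 by apply: Hr => //; move: sa r0; clear; lra.
  have h2 : `|g s - g t| < e / 2.
    apply: Hr => //; rewrite -(subrK a s) -addrA; apply: le_lt_trans (ler_normD _ _) _.
    by move: sa at_ br; clear; lra.
  rewrite -(subrK (g s) (g a)) -addrA; apply: le_lt_trans (ler_normD _ _) _.
  by rewrite distrC; move: h1 h2; clear; lra.
move=> near0; have [r [r0 Hr]] := filter_ex (filterI (nbhs_right_gt 0) near0).
by exists r => // s t sT; apply: Hr; rewrite /= in_itv.
Qed.

Lemma cont0_lip d (y : 'I_d -> R -> R) (G : 'cV[R]_d -> R) K :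
  (forall i, cont0 (y i)) -> (forall u v, `|G u - G v| <= K * enorm (u - v)) ->
  cont0 (fun t => G (\col_i y i t)).
Proof.
(* [K] may be nonpositive and [d] may be 0; both are enlarged before dividing by them. *)
move=> cy GK t t0 e e0; pose K' : R := `|K| + 1.
have K'0 : 0 < K' by rewrite /K' ltr_wpDl.
have D0 : 0 < d%:R + 1 :> R by rewrite ltr_wpDl.
have e'0 : 0 < e / (K' * (d%:R + 1)) by rewrite divr_gt0 ?mulr_gt0.
pose r i : R := sval (cid2 (cy i t t0 _ e'0)).
have r0 i : 0 < r i by rewrite /r; case: cid2.
have Hr i s : 0 <= s -> `|t - s| < r i -> `|y i t - y i s| < e / (K' * (d%:R + 1)).
  by rewrite /r; case: cid2 => /= x _; apply.
exists (\big[Num.min/(1 : R)]_i r i); first by apply: lt_bigmin => // i _; exact: r0.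
move=> s s0 tsr; have ts i : `|t - s| < r i by apply: (lt_le_trans tsr); exact: bigmin_le.
apply: le_lt_trans (GK _ _) _.
apply: (@le_lt_trans _ _ (K' * (d%:R * (e / (K' * (d%:R + 1)))))).
  apply: (@le_trans _ _ (K' * enorm (\col_i y i t - \col_i y i s))).
    by rewrite ler_wpM2r ?enorm_ge0// /K' (le_trans (ler_norm _))// lerDl.
  rewrite ler_wpM2l ?(ltW K'0)//; apply: le_trans (enorm_le_sum _) _.
  apply: (@le_trans _ _ (\sum_(i < d) (e / (K' * (d%:R + 1))))); last first.
    by rewrite sumr_const card_ord mulr_natl.
  by apply: ler_sum => i _; rewrite !mxE; apply/ltW/Hr => //; exact: ts.
have -> : K' * (d%:R * (e / (K' * (d%:R + 1)))) = d%:R / (d%:R + 1) * e.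
  by field; rewrite !gt_eqF.
by rewrite gtr_pMl// ltr_pdivrMr// mul1r ltrDl.
Qed.

Lemma cont0_integrable g s t : cont0 g -> 0 <= s ->
  lebesgue_measure.-integrable `[s, t] (EFin \o g).
Proof.
move=> cg s0; apply: continuous_compact_integrable; first exact: segment_compact.
apply: continuous_subspaceW (cont0_within (T := t) cg) => x /=.
by rewrite in_itv/= => /andP[sx xt]; rewrite in_itv/= xt (le_trans s0).
Qed.

Lemma cont0_integrable_oc g s t : cont0 g -> 0 <= s ->
  lebesgue_measure.-integrable `]s, t] (EFin \o g).
Proof.
move=> cg s0; apply: integrableS (cont0_integrable t cg s0) => //.
by apply: subset_itvr; rewrite bnd_simp.
Qed.

Lemma cont0_cst k : cont0 (cst k).
Proof. by move=> x _ r r0; exists 1 => // y _ _; rewrite subrr normr0. Qed.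

(** The local error estimate shared by the Riemann sums and the Euler scheme. *)
Lemma cont0_increment g s t c e : cont0 g -> 0 <= s -> s <= t ->
  (forall x, s <= x <= t -> `|g x - c| <= e) ->
  `|\int[lebesgue_measure]_(x in `[0, t]) g x - \int[lebesgue_measure]_(x in `[0, s]) g x
    - (t - s) * c| <= (t - s) * e.
Proof.
move=> cg s0 st gc.
have gi := cont0_integrable_oc t cg s0.
have ci k := cont0_integrable_oc t (@cont0_cst k) s0.
have cgc : cont0 (fun x => g x - c).
  move=> x x0 r r0; have [q q0 Hq] := cg x x0 r r0; exists q => // y y0 xy.
  by rewrite opprB addrA subrK; exact: Hq.
have gci := cont0_integrable_oc t cgc s0.
have mu : fine (lebesgue_measure (`]s, t]%classic : set R)) = t - s.
  rewrite lebesgue_measure_itv/= lte_fin; case: ltP => // ts.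
  by move: st; rewrite le_eqVlt ltNge ts orbF => /eqP ->; rewrite subrr.
rewrite Rintegral_itvB ?bnd_simp//; last exact: cont0_integrable.
have -> : (t - s) * c = \int[lebesgue_measure]_(x in `]s, t]) (cst c x) by rewrite Rintegral_cst// mu mulrC.
rewrite -RintegralB//.
have -> : (t - s) * e = \int[lebesgue_measure]_(x in `]s, t]) (cst e x) by rewrite Rintegral_cst// mu mulrC.
apply: (@le_trans _ _ (\int[lebesgue_measure]_(x in `]s, t]) `|g x - c|)).
  exact: le_normr_Rintegral.
apply: le_Rintegral => //; first exact: (integrable_abse gci).
by move=> x /=; rewrite in_itv/= => /andP[sx xt]; apply: gc; rewrite xt ltW.
Qed.

Lemma riemann_sum g T : cont0 g -> 0 < T ->
  (fun p => T / p%:R * \sum_(j < p) g (j.+1%:R * (T / p%:R))) @ \oo -->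
    \int[lebesgue_measure]_(x in `[0, T]) g x.
Proof.
move=> cg T0; apply/cvgrPdist_le => e e0.
have [r r0 Hr] := cont0_unif T cg (divr_gt0 e0 T0).
near=> p.
have p0 : (0 < p)%N by near: p; exact: nbhs_infty_gt.
have p0' : 0 < p%:R :> R by rewrite ltr0n.
have Tp : T / p%:R < r.
  rewrite ltr_pdivrMr// mulrC -ltr_pdivrMr//; near: p; exact: nbhs_infty_gtr.
set tau := T / p%:R.
have tau0 : 0 < tau by rewrite divr_gt0.
have jtau j : (j <= p)%N -> j%:R * tau <= T.
  by move=> jp; rewrite /tau mulrCA ger_pMr// ler_pdivrMr// mul1r ler_nat.
have key j : (j <= p)%N -> `|\int[lebesgue_measure]_(x in `[0, j%:R * tau]) g x
   - tau * \sum_(i < j) g (i.+1%:R * tau)| <= j%:R * tau * (e / T).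
  elim: j => [|j IH jp].
    rewrite big_ord0 mulr0 !mul0r set_itv1.
    by rewrite Rintegral_set1 subrr normr0.
  have j0 : 0 <= j%:R * tau by rewrite mulr_ge0// ltW.
  have E1 : j.+1%:R * tau - j%:R * tau = tau by rewrite -mulrBl -natrB// subSnn mul1r.
  have le1 : j%:R * tau <= j.+1%:R * tau by rewrite -subr_ge0 E1 ltW.
  have := @cont0_increment g (j%:R * tau) (j.+1%:R * tau) (g (j.+1%:R * tau)) (e / T) cg j0 le1.
  rewrite E1 => /(_ _)/wrap[x /andP[x1 x2]|inc].
    apply/ltW/Hr; first by rewrite (le_trans j0 x1)/= (le_trans x2)// jtau.
      by rewrite jtau// (le_trans j0).
    rewrite distrC ger0_norm ?subr_ge0//; apply: le_lt_trans Tp.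
    by rewrite -[leRHS]E1 lerB.
  rewrite big_ord_recr/= mulrDr.
  have {}IH := IH (ltnW jp).
  have -> : j.+1%:R * tau * (e / T) = j%:R * tau * (e / T) + tau * (e / T).
    by rewrite -mulrDl; congr (_ * _); rewrite -[X in _ = _ + X]E1 addrC subrK.
  apply: le_trans (lerD IH inc); apply: le_trans (ler_normD _ _); rewrite le_eqVlt; apply/orP; left.
  apply/eqP; congr `|_|.
  set a := Rintegral _ _ _; set c := Rintegral _ _ _; set s := \sum_(_ < _) _.
  by move: a c s => a c s; ring.
have := key p (leqnn p).
have -> : p%:R * tau = T by rewrite /tau; field; rewrite gt_eqF.
by rewrite [X in _ <= X]mulrC divfK ?gt_eqF.
Unshelve. all: end_near. Qed.

Lemma cont0_dominated (h_ : nat -> R -> R) h G T : (forall n, cont0 (h_ n)) ->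
  (forall t, 0 <= t <= T -> h_ ^~ t @ \oo --> h t) ->
  lebesgue_measure.-integrable `[0, T] (EFin \o G) ->
  (forall n t, 0 <= t <= T -> `|h_ n t| <= G t) ->
  lebesgue_measure.-integrable `[0, T] (EFin \o h) /\
  \int[lebesgue_measure]_(t in `[0, T]) h_ n t @[n --> \oo] -->
  \int[lebesgue_measure]_(t in `[0, T]) h t.
Proof.
move=> ch hh iG hG.
have ih n := cont0_integrable T (ch n) (lexx 0).
have mh n : measurable_fun `[0, T] (h_ n) by have /measurable_int/measurable_EFinP := ih n.
have := @dominated_convergence _ _ R lebesgue_measure `[0, T]%classic (measurable_itv _)
  (fun n => EFin \o h_ n) (EFin \o h) (EFin \o G).
case => //.
- by move=> n; apply/measurable_EFinP; exact: mh.
- by apply/measurable_EFinP; apply: (measurable_fun_cvg mh) => x /=; rewrite in_itv; exact: hh.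
- apply: aeW => t /=; rewrite in_itv => tT; apply: cvg_EFin; first exact: nearW.
  exact: hh.
- by apply: aeW => t n /=; rewrite in_itv => tT; rewrite lee_fin hG.
move=> i1 _ i3; split=> //; apply: fine_cvg; rewrite /Rintegral fineK//.
exact: integrable_fin_num.
Qed.

End HalfLine.

Section EulerError.
Context {R : realType} {d : nat}.
Variables (b : 'cV[R]_d -> 'cV[R]_d) (L : R).
Hypothesis L_gt0 : 0 < L.
Hypothesis b_lipschitz : forall y z : 'cV[R]_d, enorm (b y - b z) <= L * enorm (y - z).
Variables (x0 : 'cV[R]_d) (y : 'I_d -> R -> R) (beta : R -> 'cV[R]_d).
Let Y t : 'cV[R]_d := \col_i y i t.
Hypothesis y_cont : forall i, cont0 (y i).
Hypothesis y_eq : forall t, 0 <= t ->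
  Y t = x0 + \col_i (\int[lebesgue_measure]_(s in `[0, t]) (b (Y s) i 0)) + beta t.

(** A discrete Gronwall argument for each path. Uniform continuity of the drift along the solution
    makes the local error at most [tau * d * (e / c)]; the step factors [1 + tau * L] amplify it by
    at most [expR (L * T)] in total, and [c] absorbs this. No rate is claimed. *)
Lemma euler_error T e : 0 < T -> 0 < e -> exists2 r, 0 < r &
  forall tau, 0 < tau < r -> forall j : nat, j%:R * tau <= T ->
  enorm (eulerY b x0 tau (fun j => beta (j%:R * tau)) j - Y (j%:R * tau)) <= e.
Proof.
move=> T0 e0.
have cb i : cont0 (fun t => b (Y t) i 0).
  apply: (cont0_lip (G := fun u => b u i 0) (K := L)) => // u v.
  have -> : b u i 0 - b v i 0 = (b u - b v) i 0 by rewrite !mxE.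
  by apply: le_trans (le_coord_enorm _ _) _.
pose c : R := expR (L * T) * (T * d%:R) + 1.
have c0 : 0 < c by rewrite /c ltr_wpDl// !mulr_ge0 ?expR_ge0// ltW.
have eta0 : 0 < e / c by rewrite divr_gt0.
pose r i : R := sval (cid2 (cont0_unif T (cb i) eta0)).
have r0 i : 0 < r i by rewrite /r; case: cid2.
have Hr i s t : 0 <= s <= T -> 0 <= t <= T -> `|s - t| < r i ->
    `|b (Y s) i 0 - b (Y t) i 0| < e / c.
  by rewrite /r; case: cid2 => /= x _; apply.
exists (\big[Num.min/(1 : R)]_i r i); first by apply: lt_bigmin => // i _; exact: r0.
move=> tau /andP[tau0 taur].
have {}taur i : tau < r i by apply: (lt_le_trans taur); exact: bigmin_le.
pose v t := x0 + \col_i (\int[lebesgue_measure]_(s in `[0, t]) (b (Y s) i 0)) : 'cV[R]_d.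
set bt := fun j : nat => beta (j%:R * tau).
have key (j : nat) : j%:R * tau <= T -> enorm (eulerV b x0 tau bt j - v (j%:R * tau)) <=
   (1 + tau * L) ^+ j * (j%:R * tau * (d%:R * (e / c))).
  elim: j => [_|j IH jT].
    rewrite /= !mul0r mulr0 /v (_ : \col_i _ = 0) ?addr0 ?subrr ?enorm0//.
    by apply/matrixP => i k; rewrite !mxE set_itv1 Rintegral_set1.
  have j0 : 0 <= j%:R * tau by rewrite mulr_ge0// ltW.
  have E1 : j.+1%:R * tau - j%:R * tau = tau by rewrite -mulrBl -natrB// subSnn mul1r.
  have le1 : j%:R * tau <= j.+1%:R * tau by rewrite -subr_ge0 E1 ltW.
  have {}IH := IH (le_trans le1 jT).
  rewrite /=; set V := eulerV _ _ _ _ _.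
  have Yj : Y (j%:R * tau) = v (j%:R * tau) + bt j by rewrite y_eq.
  have inc : enorm (v (j.+1%:R * tau) - v (j%:R * tau) - tau *: b (Y (j%:R * tau))) <= tau * (d%:R * (e / c)).
    apply: le_trans (enorm_le_sum _) _.
    apply: (@le_trans _ _ (\sum_(i < d) tau * (e / c))); last first.
      by rewrite sumr_const card_ord -[leLHS]mulr_natl mulrCA.
    apply: ler_sum => i _.
    have := @cont0_increment _ (fun t => b (Y t) i 0) (j%:R * tau) (j.+1%:R * tau) (b (Y (j%:R * tau)) i 0) (e / c) (cb i) j0 le1.
    rewrite E1 => /(_ _)/wrap[x /andP[x1 x2]|].
      apply/ltW/Hr; first by rewrite (le_trans j0 x1)/= (le_trans x2).
        by rewrite (le_trans le1)// j0.
      rewrite ger0_norm ?subr_ge0//; apply: le_lt_trans (taur i).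
      by rewrite -[leRHS]E1 lerB.
    congr (_ <= _); congr `|_|; rewrite /v !mxE.
    by move: (\int[lebesgue_measure]_(x in _) _) => A1; move: (\int[lebesgue_measure]_(x in _) _) => A2; ring.
  rewrite (_ : _ - _ = (V - v (j%:R * tau)) + tau *: (b (V + bt j) - b (Y (j%:R * tau))) -
     (v (j.+1%:R * tau) - v (j%:R * tau) - tau *: b (Y (j%:R * tau)))); last first.
    by rewrite scalerBr; apply/matrixP => i k; rewrite !mxE; ring.
  have bj : enorm (tau *: (b (V + bt j) - b (Y (j%:R * tau)))) <= tau * L * enorm (V - v (j%:R * tau)).
    rewrite enormZ gtr0_norm// -mulrA ler_wpM2l ?(ltW tau0)//.
    apply: le_trans (b_lipschitz _ _) _; rewrite Yj.
    by rewrite opprD addrACA subrr addr0.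
  apply: le_trans (enormD _ _) _; rewrite enormN.
  apply: le_trans (lerD (le_trans (enormD _ _) (lerD (lexx _) bj)) inc) _.
  move: (enorm _) IH => E IH.
  set q := d%:R * (e / c) in IH *.
  have q0 : 0 <= q by rewrite mulr_ge0// ltW.
  have h1 : 1 <= (1 + tau * L) ^+ j.+1 by rewrite exprn_ege1// lerDl mulr_ge0// ltW.
  apply: (@le_trans _ _ ((1 + tau * L) * ((1 + tau * L) ^+ j * (j%:R * tau * q)) + (1 + tau * L) ^+ j.+1 * (tau * q))).
    apply: lerD.
      have a0 : 0 <= 1 + tau * L by rewrite addr_ge0// mulr_ge0// ltW.
      by rewrite -[X in X + _]mul1r -mulrDl ler_wpM2l.
    by rewrite -[leLHS]mul1r ler_wpM2r// mulr_ge0// ltW.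
  rewrite le_eqVlt; apply/orP; left; apply/eqP.
  by rewrite mulrA -exprS -mulrDr -[j.+1%:R]natr1; congr (_ * _); ring.
move=> j jT.
have -> : eulerY b x0 tau bt j - Y (j%:R * tau) = eulerV b x0 tau bt j - v (j%:R * tau).
  rewrite y_eq ?mulr_ge0// ?(ltW tau0)// /eulerY -/(v _) -/(bt j).
  by apply/matrixP => i k; rewrite !mxE; ring.
apply: le_trans (key j jT) _.
have p1 : (1 + tau * L) ^+ j <= expR (L * T).
  apply: (@le_trans _ _ (expR (tau * L) ^+ j)).
    by rewrite lerXn2r ?nnegrE ?addr_ge0 ?mulr_ge0 ?expR_ge0// ?(ltW tau0) ?(ltW L_gt0)// expR_ge1Dx.
  by rewrite -expRM_natl ler_expR mulrA [_ * L]mulrC ler_wpM2l// ltW.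
have q0 : 0 <= d%:R * (e / c) by rewrite mulr_ge0// ltW.
apply: (@le_trans _ _ (expR (L * T) * (T * (d%:R * (e / c))))).
  apply: ler_pM => //; first by rewrite exprn_ge0// addr_ge0// mulr_ge0// ltW.
    by apply: mulr_ge0 q0; rewrite mulr_ge0// ltW.
  by rewrite ler_wpM2r.
have -> : expR (L * T) * (T * (d%:R * (e / c))) = (c - 1) / c * e by rewrite /c; field; rewrite gt_eqF.
by rewrite ger_pMl// ler_pdivrMr// mul1r gerBl.
Qed.

End EulerError.

(** * Concentration for the solution *)

Section SubGaussian.
Context {disp : measure_display} {T : measurableType disp} {R : realType}.
Variable P : probability T R.
Implicit Types Z : T -> R.

(** Only [l >= 0] is asked, for the upper tail. The extended integral lets the bound pass to limits
    by Fatou's lemma before anything is known about integrability. *)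
Definition subG Z (k : R) := measurable_fun setT Z /\
  forall l, 0 <= l -> (\int[P]_w (expR (l * Z w))%:E <= (expR (k * l ^+ 2))%:E)%E.

Lemma measurable_expZ Z (l : R) : measurable_fun setT Z ->
  measurable_fun setT (fun w => expR (l * Z w)).
Proof. by move=> mZ; apply: measurableT_comp => //; exact: measurable_funM. Qed.

Lemma subG_limit (Z_ : nat -> T -> R) Z k : (forall n, subG (Z_ n) k) ->
  (forall w, Z_ ^~ w @ \oo --> Z w) -> subG Z k.
Proof.
move=> sZ cZ; have mZ n : measurable_fun setT (Z_ n) by case: (sZ n).
split; first by apply: (measurable_fun_cvg mZ) => x _; exact: cZ.
move=> l l0; apply: (fatou_le (f_ := fun n w => expR (l * Z_ n w))).
- by move=> n; exact: measurable_expZ.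
- by move=> n w; exact: expR_ge0.
- move=> w; have K : l * Z_ n w @[n --> \oo] --> l * Z w.
    by apply: cvgM; [exact: cvg_cst|exact: cZ].
  exact: (continuous_cvg _ (@continuous_expR R (l * Z w)) K).
- by move=> n; case: (sZ n) => _; apply.
Qed.

Lemma subG_chernoff Z k r : 0 < k -> 0 <= r -> subG Z k ->
  (P [set w | (r < Z w)%R] <= (expR (- (r ^+ 2 / (4 * k))))%:E)%E.
Proof.
move=> k0 r0 [mZ sZ].
(* The minimiser of [k * l ^+ 2 - l * r]. *)
pose l : R := r / (2 * k); have l0 : 0 <= l by rewrite divr_ge0// mulr_ge0// ltW.
have mA : measurable [set w | r < Z w].
  have := mZ measurableT `]r, +oo[%classic (measurable_itv _).
  rewrite setTI; congr measurable; apply/seteqP; split => x /=; by rewrite in_itv/= andbT.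
rewrite -[X in (P X <= _)%E]setIT -integral_indic//.
apply: (@le_trans _ _ (\int[P]_w ((expR (- (l * r)))%:E * (expR (l * Z w))%:E))%E).
  apply: ge0_le_integral => //.
  - by apply/measurable_EFinP; exact: measurable_indic.
  - by apply: emeasurable_funM => //; apply/measurable_EFinP; exact: measurable_expZ.
  move=> w _; rewrite -EFinM lee_fin -expRD indicE.
  case: (boolP (w \in _)) => [|_]; last by rewrite expR_ge0.
  rewrite inE/= => rZ; rewrite -[leLHS]expR0 ler_expR addrC -mulrBr mulr_ge0// subr_ge0 ltW//.
rewrite ge0_integralZl//; last by apply/measurable_EFinP; exact: measurable_expZ.
apply: le_trans (lee_wpmul2l _ (sZ l l0)) _; first by rewrite lee_fin expR_ge0.
rewrite -EFinM lee_fin -expRD ler_expR le_eqVlt; apply/orP; left; apply/eqP.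
by rewrite /l; field; rewrite gt_eqF.
Qed.

Lemma subG_wide Z k k' : k <= k' -> subG Z k -> subG Z k'.
Proof.
move=> kk [mZ sZ]; split=> // l l0; apply: le_trans (sZ l l0) _.
by rewrite lee_fin ler_expR ler_wpM2r// sqr_ge0.
Qed.

End SubGaussian.

Lemma cvg_sumr (R : realType) (I : Type) (s : seq I) (u : I -> nat -> R) (c : I -> R) :
  (forall i, u i @ \oo --> c i) -> \sum_(i <- s) u i n @[n --> \oo] --> \sum_(i <- s) c i.
Proof.
move=> uc; elim: s => [|i s IH].
  by rewrite big_nil; apply: cvg_near_cst; apply: nearW => n; rewrite big_nil.
rewrite big_cons (_ : (fun n => _) = fun n => u i n + \sum_(i <- s) u i n); last first.
  by apply/funext => n; rewrite big_cons.
by apply: cvgD => //; exact: uc.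
Qed.

Lemma sum_blocks (V : nmodType) n p (F : nat -> V) :
  \sum_(k < n) \sum_(i < p) F (k * p + i)%N = \sum_(j < n * p) F j.
Proof.
elim: n => [|n IH]; first by rewrite mul0n !big_ord0.
rewrite big_ord_recr/= IH mulSnr big_split_ord/=; congr (_ + _).
Qed.

Lemma enorm_dist (R : realType) d (u v : 'cV[R]_d) : `|enorm u - enorm v| <= enorm (u - v).
Proof.
rewrite ler_norml lerNl opprB !lerBlDr; apply/andP; split.
  by rewrite -(enormN (u - v)) opprB -{1}(subrK u v) enormD.
by rewrite -{1}(subrK v u) enormD.
Qed.

(** A discrete Gronwall bound from [enorm (b z) <= enorm (b 0) + L * enorm z]. It is linear in the
    noise bounds [c], so expectations can be taken. *)
Lemma eulerV_growth (R : realType) d (b : 'cV[R]_d -> 'cV[R]_d) x0 L tau beta (c : nat -> R) j :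
  0 <= L -> 0 <= tau -> (forall y z, enorm (b y - b z) <= L * enorm (y - z)) ->
  (forall i, enorm (beta i) <= c i) ->
  enorm (eulerV b x0 tau beta j) <=
  (1 + tau * L) ^+ j * (enorm x0 + \sum_(i < j) tau * (enorm (b 0) + L * c i)).
Proof.
move=> L0 tau0 bL betac.
have c0 i : 0 <= c i := le_trans (enorm_ge0 _) (betac i).
have a1 : 1 <= 1 + tau * L by rewrite lerDl mulr_ge0.
elim: j => [|j IH] /=; first by rewrite big_ord0 addr0 expr0 mul1r.
set V := eulerV _ _ _ _ _ in IH *.
have bV : enorm (b (V + beta j)) <= enorm (b 0) + L * (enorm V + c j).
  rewrite -(subrK (b 0) (b _)) addrC; apply: le_trans (enormD _ _) _.
  rewrite lerD2l; apply: le_trans (bL _ _) _; rewrite subr0 ler_wpM2l//.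
  by apply: le_trans (enormD _ _) _; rewrite lerD2l.
apply: le_trans (enormD _ _) _; rewrite enormZ ger0_norm//.
apply: le_trans (lerD (lexx _) (ler_wpM2l tau0 bV)) _.
rewrite big_ord_recr/=; set S := \sum_(_ < _) _ in IH *; set q := tau * (enorm (b 0) + L * c j).
have q0 : 0 <= q by rewrite mulr_ge0// addr_ge0 ?enorm_ge0// mulr_ge0.
have h : q <= (1 + tau * L) ^+ j.+1 * q by rewrite ler_peMl// exprn_ege1.
have -> : enorm V + tau * (enorm (b 0) + L * (enorm V + c j)) = (1 + tau * L) * enorm V + q.
  by rewrite /q; ring.
rewrite addrA mulrDr; apply: lerD => //.
by rewrite exprS -mulrA ler_wpM2l// (le_trans ler01).
Qed.

(** The scheme at [j] sees the noise up to [j] only, which hides the junk values of [noise] beyond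
    the grid. *)
Lemma eulerY_ext (R : realType) d (b : 'cV[R]_d -> 'cV[R]_d) x0 tau beta beta' j :
  (forall i, (i <= j)%N -> beta i = beta' i) ->
  eulerY b x0 tau beta j = eulerY b x0 tau beta' j.
Proof.
move=> bb; rewrite /eulerY bb//; congr (_ + _).
elim: j bb => [//|j IH] bb /=.
by rewrite IH => [|i ij]; rewrite bb// leqW.
Qed.

Section Solution.
Context {disp : measure_display} {T : measurableType disp} {R : realType}.
Variable P : probability T R.
Context {d : nat}.
Variables (b : 'cV[R]_d -> 'cV[R]_d) (alpha L H : R) (sigma : 'M[R]_d).
Hypothesis alpha_gt0 : 0 < alpha.
Hypothesis L_gt0 : 0 < L.
Hypothesis H_gt0 : 0 < H.
Hypothesis b_contractive : forall y z : 'cV[R]_d,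
  dotcv (b y - b z) (y - z) <= - alpha * enorm (y - z) ^+ 2.
Hypothesis b_lipschitz : forall y z : 'cV[R]_d,
  enorm (b y - b z) <= L * enorm (y - z).
Variables (s0 : R).
Hypothesis s0_gt0 : 0 < s0.
Hypothesis sigma_le : forall x : 'cV[R]_d, enorm (sigma *m x) <= s0 * \sum_i `|x i 0|.
Variables (x0 : 'cV[R]_d) (B Y : 'I_d -> R -> {RV P >-> R}).
Hypothesis fB : is_fbm H B.
Hypothesis sY : is_sde_solution b sigma x0 B Y.

Lemma sol_cont i w : cont0 (fun t => Y i t w).
Proof. by apply: within_cont0; exact: (sde_continuous sY). Qed.

Section Observable.
Variables (f : 'cV[R]_d -> R) (l : R).
Hypothesis f_lip : forall x y, `|f x - f y| <= l * enorm (x - y).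

Lemma obs_cont0 w : cont0 (fun t => f (vecp Y t w)).
Proof. by apply: (cont0_lip (y := fun i t => Y i t w)) f_lip => i; exact: sol_cont. Qed.

Hypothesis l_ge0 : 0 <= l.

Lemma obs_measurable t : measurable_fun setT (fun w => f (vecp Y t w)).
Proof.
have fl : lip1 l (fun z : 'I_d -> R => f (\col_i z i)).
  split=> // y z; apply: le_trans (f_lip _ _) _; rewrite ler_wpM2l//.
  by apply: le_trans (enorm_le_sum _) _; apply: ler_sum => i _; rewrite !mxE.
by apply: (lip1_measurable (X := fun i w => Y i t w) fl) => i; exact: measurable_funPT.
Qed.

End Observable.

Section Discretization.
Variables (n : nat) (Delta : R).
Hypothesis n_gt0 : (0 < n)%N.
Hypothesis Delta_gt0 : 0 < Delta.

Let X p (w : T) (q : 'I_d * 'I_(n * p).+1) : R := fbmX B (grid (n := n) (p := p) Delta) q w.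
Arguments X : clear implicits.

Lemma eulerZ_fbm p w j : (j <= n * p)%N ->
  eulerZ b sigma x0 (n := n) (p := p) Delta (X p w) j =
  eulerY b x0 (Delta / p%:R) (fun j => sigma *m vecp B (j%:R * (Delta / p%:R)) w) j.
Proof.
move=> jnp; apply: eulerY_ext => i ij; rewrite /noise; congr (_ *m _).
by apply/matrixP => k k'; rewrite !mxE /X /fbmX /grid/= inordK// ltnS (leq_trans ij).
Qed.

Lemma euler_cvg w e : 0 < e -> exists p0, forall p, (p0 < p)%N -> forall j, (j <= n * p)%N ->
  enorm (eulerZ b sigma x0 (n := n) (p := p) Delta (X p w) j - vecp Y (j%:R * (Delta / p%:R)) w) <= e.
Proof.
move=> e0.
have y_eq t : 0 <= t -> \col_i Y i t w =
    x0 + \col_i (\int[lebesgue_measure]_(s in `[0, t]) (b (\col_i0 Y i0 s w) i 0)) + sigma *m vecp B t w.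
  by move=> t0; exact: (sde_eq sY).
have T0 : 0 < n%:R * Delta by rewrite mulr_gt0// ltr0n.
have [r r0 Hr] := euler_error L_gt0 b_lipschitz (fun i => @sol_cont i w) y_eq T0 e0.
exists (Num.truncn (Delta / r)) => p p0p j jnp.
have pgt0 : 0 < p%:R :> R by rewrite ltr0n (leq_ltn_trans _ p0p).
have taur : 0 < Delta / p%:R < r.
  rewrite divr_gt0//= ltr_pdivrMr// mulrC -ltr_pdivrMr//.
  by apply: lt_le_trans (truncnS_gt _) _; rewrite ler_nat.
have jT : j%:R * (Delta / p%:R) <= n%:R * Delta.
  rewrite mulrCA mulrC ler_wpM2r ?(ltW Delta_gt0)// ler_pdivrMr// -natrM ler_nat//.
by rewrite eulerZ_fbm//; exact: Hr.
Qed.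

Variables (f : 'cV[R]_d -> R) (l : R).
Hypothesis f_lip : forall x y, `|f x - f y| <= l * enorm (x - y).
Hypothesis l_ge0 : 0 <= l.
Variable wt : nat -> nat -> R.
Hypothesis wt_ge0 : forall p i, 0 <= wt p i.
Hypothesis wt_sum1 : forall p, (0 < p)%N -> \sum_(i < p) wt p i = 1.

Let Phi p w := functional b sigma x0 (n := n) (p := p) Delta f (wt p) (X p w).
Let Psi p w := n%:R^-1 * \sum_(k < n) \sum_(i < p)
  wt p i * f (vecp Y ((k * p + i.+1)%:R * (Delta / p%:R)) w).

Lemma functional_cvg w (c : R) : Psi ^~ w @ \oo --> c -> Phi ^~ w @ \oo --> c.
Proof.
move=> Pc; suff K : Phi p w - Psi p w @[p --> \oo] --> (0 : R).
  rewrite (_ : Phi ^~ w = fun p => (Phi p w - Psi p w) + Psi p w).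
    by rewrite -[c]add0r; exact: cvgD.
  by apply/funext => p; rewrite subrK.
apply/cvgrPdist_le => e e0.
have e'0 : 0 < e / (l + 1) by rewrite divr_gt0// ltr_wpDl.
have [p0 Hp] := euler_cvg w e'0.
near=> p.
have p0p : (p0 < p)%N by near: p; exact: nbhs_infty_gt.
have pgt0 : (0 < p)%N by rewrite (leq_ltn_trans _ p0p).
rewrite sub0r normrN /Phi /functional /Psi -mulrBr normrM ger0_norm ?invr_ge0//.
rewrite mulrC ler_pdivrMr ?ltr0n// -sumrB.
apply: le_trans (ler_norm_sum _ _ _) _.
apply: (@le_trans _ _ (\sum_(k < n) e)); last by rewrite sumr_const card_ord mulr_natr.
apply: ler_sum => k _; rewrite -sumrB; apply: le_trans (ler_norm_sum _ _ _) _.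
apply: (@le_trans _ _ (\sum_(i < p) wt p i * e)); last by rewrite -mulr_suml wt_sum1// mul1r.
apply: ler_sum => i _; rewrite -mulrBr normrM (ger0_norm (wt_ge0 _ _)) ler_wpM2l//.
apply: le_trans (f_lip _ _) _.
have jnp : (k * p + i.+1 <= n * p)%N.
  apply: (@leq_trans (k * p + p)%N); first by rewrite leq_add2l.
  by rewrite -mulSnr leq_mul2r ltn_ord orbT.
apply: (@le_trans _ _ (l * (e / (l + 1)))).
  by rewrite ler_wpM2l//; exact: (Hp p p0p _ jnp).
by rewrite mulrA ler_pdivrMr ?ltr_wpDl// [l * e]mulrC ler_wpM2l// ?lerDl// ltW.
Unshelve. all: end_near. Qed.

(** The factor [2 * K ^+ 2] of [gaussian_concentration], with [K] the constant of
    [functional_CM]. *)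
Definition conc_var : R := 2 * (l / n%:R * euler_const alpha L s0 Delta *
  Num.sqrt (d%:R * (2 * Delta `^ (2 * H) * n%:R `^ Num.max (2 * H) 1))) ^+ 2.

Variable M : R.
Hypothesis f_le : forall x, `|f x| <= M.

Let X_meas p : forall q, measurable_fun setT (fun w => X p w q).
Proof. by move=> q; exact: measurable_funPT. Qed.

Let Phi_meas p : (0 < p)%N -> measurable_fun setT (Phi p).
Proof.
move=> p0; have [Q LQ] := functional_lip1 L_gt0 b_lipschitz s0_gt0 sigma_le x0 n p0 Delta_gt0
  l_ge0 f_lip (wt_ge0 p).
exact: (lip1_measurable (X := fun q w => X p w q) LQ).
Qed.

Let Phi_le p w : (0 < p)%N -> `|Phi p w| <= M.
Proof. by move=> p0; apply: functional_bounded => //; exact: wt_sum1. Qed.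

Lemma functional_subG p : (0 < p)%N -> alpha * (Delta / p%:R) <= 1 ->
  L ^+ 2 * (Delta / p%:R) <= alpha ->
  subG P (fun w => Phi p w - Ex P (Phi p)) conc_var.
Proof.
move=> p0 t1 t2.
have GX : gaussian_family P (fbmX B (grid (n := n) (p := p) Delta)) (fbmS H (grid (n := n) (p := p) Delta)).
  by apply: fbm_gaussian_family => // j; rewrite /grid mulr_ge0// divr_ge0// ltW.
have [Q LQ] := functional_lip1 L_gt0 b_lipschitz s0_gt0 sigma_le x0 n p0 Delta_gt0
  l_ge0 f_lip (wt_ge0 p).
have mZ : measurable_fun setT (fun w => Phi p w - Ex P (Phi p)).
  by apply: measurable_funB => //; exact: Phi_meas.
split=> // r r0.
have ec0 : 0 <= euler_const alpha L s0 Delta.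
  by rewrite /euler_const !mulr_ge0 ?addr_ge0 ?divr_ge0 ?mulr_ge0// ltW.
have := gaussian_concentration GX
  (functional_bounded b sigma x0 Delta n_gt0 (wt_ge0 p) (wt_sum1 p0) f_le) LQ
  (K := l / n%:R * euler_const alpha L s0 Delta *
   Num.sqrt (d%:R * (2 * Delta `^ (2 * H) * n%:R `^ Num.max (2 * H) 1))) _ _ r0.
move=> /(_ _ _)/wrap[||conc].
- by rewrite mulr_ge0 ?sqrtr_ge0// mulr_ge0// divr_ge0.
- move=> z g; apply: (functional_CM alpha_gt0 L_gt0 H_gt0 b_contractive b_lipschitz s0_gt0 sigma_le
    x0 p0 Delta_gt0 l_ge0 f_lip (wt_ge0 p) (wt_sum1 p0) t1 t2 _ z g) => c.
  exact: (gf_ge0 GX).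
rewrite -EFin_Ex; last first.
  apply: (@int1_bounded _ _ _ _ _ (expR (r * (M + M)))); first exact: measurable_expZ.
  move=> w; rewrite ger0_norm ?expR_ge0// ler_expR ler_wpM2l//.
  apply: le_trans (ler_norm _) _; apply: le_trans (ler_normB _ _) _; apply: lerD; first exact: Phi_le.
  have iPhi : int1 P (Phi p).
    by apply: (@int1_bounded _ _ _ _ _ M) => [|w']; [exact: Phi_meas|exact: Phi_le].
  apply: le_trans (Ex_norm iPhi) _; rewrite -[leRHS](Ex_cst P).
  by apply: le_Ex; [exact: int1_norm|exact: int1_cst|move=> w'; exact: Phi_le].
rewrite lee_fin; apply: le_trans conc _.
by rewrite ler_expR /conc_var le_eqVlt; apply/orP; left; apply/eqP; ring.
Qed.

Lemma functional_limit_subG (Z : T -> R) : (forall w, Psi ^~ w @ \oo --> Z w) ->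
  subG P (fun w => Z w - Ex P Z) conc_var.
Proof.
move=> PZ; have FZ w := functional_cvg (PZ w).
(* From [p0] on, the mesh meets both step-size conditions of the contraction; the sequence is
   shifted by [p0] so that they always hold. *)
pose p0 := (Num.truncn (Num.max (alpha * Delta) (L ^+ 2 * Delta / alpha))).+1.
have Hp m : [/\ (0 < m + p0)%N, alpha * (Delta / (m + p0)%:R) <= 1 & L ^+ 2 * (Delta / (m + p0)%:R) <= alpha].
  have h : Num.max (alpha * Delta) (L ^+ 2 * Delta / alpha) <= (m + p0)%:R.
    by apply/ltW/(lt_le_trans (truncnS_gt _)); rewrite ler_nat leq_addl.
  have h0 : (0 < m + p0)%N by rewrite addnS.
  move: h; rewrite ge_max => /andP[h1 h2]; split=> //.
    by rewrite mulrA ler_pdivrMr ?ltr0n// mul1r.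
  by rewrite mulrA ler_pdivrMr ?ltr0n// [leRHS]mulrC -ler_pdivrMr.
pose F m := Phi (m + p0).
have Fc w : F m w @[m --> \oo] --> Z w by have := FZ w; rewrite -(cvg_shiftn p0).
have F0 m : (0 < m + p0)%N by case: (Hp m).
have [_ EF] := Ex_cvg (fun m => Phi_meas (F0 m)) Fc (int1_cst P M) (fun m w => @Phi_le _ w (F0 m)).
apply: (@subG_limit _ _ _ _ (fun m w => F m w - Ex P (F m))).
  by move=> m; case: (Hp m) => *; exact: functional_subG.
by move=> w; apply: cvgB; [exact: Fc|exact: EF].
Qed.

End Discretization.

(** * First moment of the solution and truncation of observables *)

Section FirstMoment.

Let nse (t : R) (w : T) : R := s0 * \sum_i `|B i t w|.

Let nse_int t : 0 <= t -> int1 P (nse t).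
Proof.
move=> t0; apply: int1Z; apply: int1_sum => i _; apply: int1_norm.
by have [fBi _] := fB; exact: (fbm1_int (fBi i)).
Qed.

Let nse_Ex t T0 : 0 <= t <= T0 -> Ex P (nse t) <= s0 * (d%:R * (1 + T0 `^ (2 * H))).
Proof.
move=> /andP[t0 tT]; have [fBi _] := fB.
have iB i := fbm1_int (fBi i) t0.
rewrite ExZ; last by apply: int1_sum => i _; exact: int1_norm.
rewrite ler_wpM2l ?(ltW s0_gt0)// Ex_sum => [|i _]; last exact: int1_norm.
apply: (@le_trans _ _ (\sum_(i < d) (1 + T0 `^ (2 * H)))); last first.
  by rewrite sumr_const card_ord [leRHS]mulr_natl.
apply: ler_sum => i _.
have iB2 := fbm1_int_mul (fBi i) t0 t0.
apply: (@le_trans _ _ (Ex P (fun w => 1 + B i t w * B i t w))).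
  apply: le_Ex => [||w]; [exact: int1_norm|by apply: int1D; [exact: int1_cst|]|].
  rewrite -expr2 -[X in 1 + X](real_normK (num_real _)).
  have := sqr_ge0 (`|B i t w| - 1); have := normr_ge0 (B i t w); nra.
rewrite ExD ?Ex_cst//; last exact: int1_cst.
rewrite lerD2l (fbm1_Ex_mul (fBi i) t0 t0) /fbm_cov subrr normr0 powR0 ?subr0; last first.
  by rewrite mulf_neq0// gt_eqF.
rewrite -[t `^ _ + _](mulr2n) -[X in _ * X]mulr_natl mulKf// ge0_ler_powR// ?nnegrE//.
  by rewrite mulr_ge0// ltW.
exact: le_trans tT.
Qed.

Let nseP t w : enorm (sigma *m vecp B t w) <= nse t w.
Proof. by apply: le_trans (sigma_le _) _; under eq_bigr do rewrite mxE. Qed.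

(** The expectation of the bound of [eulerV_growth] plus the noise, where [|B| <= 1 + B ^+ 2] bounds
    the mean noise by the variance. It is uniform over times up to [T0]. *)
Definition moment_bound (T0 : R) : R :=
  expR (L * T0) * (enorm x0 + T0 * (enorm (b 0) + L * (s0 * (d%:R * (1 + T0 `^ (2 * H)))))) +
  s0 * (d%:R * (1 + T0 `^ (2 * H))).

Lemma sol_first_moment t T0 : 0 <= t <= T0 ->
  (\int[P]_w (enorm (vecp Y t w))%:E <= (moment_bound T0)%:E)%E.
Proof.
move=> /andP[t0 tT]; have T00 : 0 <= T0 := le_trans t0 tT.
set c2 := s0 * (d%:R * (1 + T0 `^ (2 * H))).
have c20 : 0 <= c2 by rewrite mulr_ge0 ?(ltW s0_gt0)// mulr_ge0// addr_ge0// powR_ge0.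
(* The scheme is run on a single block of length [t], which must be positive; time 0 is treated
   apart. *)
have [t00|tn0] := eqVneq t 0.
  have bound w : enorm (vecp Y t w) <= enorm x0 + nse t w.
    rewrite (sde_eq sY w t0) t00 -addrA; apply: le_trans (enormD _ _) _.
    rewrite lerD2l; apply: le_trans (enormD _ _) _; rewrite (_ : \col_i _ = 0).
      by rewrite enorm0 add0r nseP.
    by apply/matrixP => i k; rewrite !mxE set_itv1 Rintegral_set1.
  have ib : int1 P (fun w => enorm x0 + nse t w) by apply: int1D; [exact: int1_cst|exact: nse_int].
  apply: (@le_trans _ _ (\int[P]_w (enorm x0 + nse t w)%:E)%E).
    apply: ge0_le_integral => //.
    + by move=> w _; rewrite lee_fin enorm_ge0.
    + by apply/measurable_EFinP; apply: (obs_measurable (l := 1)) => // u v; rewrite mul1r enorm_dist.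
    + by case/integrableP: ib.
    + by move=> w _; rewrite lee_fin.
  rewrite -EFin_Ex// lee_fin ExD ?Ex_cst; [|exact: int1_cst|exact: nse_int].
  rewrite /moment_bound -/c2; apply: lerD; last by apply: nse_Ex; rewrite t0.
  rewrite -[leLHS]mul1r ler_pM ?enorm_ge0//.
    by rewrite -[leLHS]expR0 ler_expR mulr_ge0// ltW.
  by rewrite lerDl mulr_ge0// addr_ge0 ?enorm_ge0// mulr_ge0// ltW.
have {tn0}tgt0 : 0 < t by rewrite lt_neqAle eq_sym tn0.
pose X p (w : T) (q : 'I_d * 'I_(1 * p).+1) : R := fbmX B (grid (n := 1) (p := p) t) q w.
pose F p w := enorm (eulerZ b sigma x0 (n := 1) (p := p) t (X p w) p).
pose G p w := (1 + t / p%:R * L) ^+ p * (enorm x0 + \sum_(i < p) t / p%:R *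
  (enorm (b 0) + L * nse (i%:R * (t / p%:R)) w)) + nse (p%:R * (t / p%:R)) w.
have grid_ok p j : (0 < p)%N -> (j <= p)%N -> 0 <= j%:R * (t / p%:R) <= T0.
  move=> p0 jp; rewrite mulr_ge0 ?divr_ge0//=; apply: le_trans tT.
  by rewrite mulrCA ger_pMr// ler_pdivrMr ?ltr0n// mul1r ler_nat.
have FG p w : (0 < p)%N -> F p w <= G p w.
  move=> p0; rewrite /F eulerZ_fbm ?mul1n// /eulerY /G.
  apply: le_trans (enormD _ _) _; apply: lerD; last exact: nseP.
  apply: (@eulerV_growth _ _ _ _ _ _ _ (fun i => nse (i%:R * (t / p%:R)) w)) => //.
  - exact: ltW.
  - by rewrite divr_ge0.
have iS p : (0 < p)%N -> int1 P (fun w => \sum_(i < p) t / p%:R * (enorm (b 0) + L * nse (i%:R * (t / p%:R)) w)).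
  move=> p0; apply: int1_sum => i _; apply: int1Z; apply: int1D; first exact: int1_cst.
  by apply: int1Z; apply: nse_int; have /andP[] := grid_ok p i p0 (ltnW (ltn_ord i)).
have iS' p : (0 < p)%N -> int1 P (fun w => (1 + t / p%:R * L) ^+ p * (enorm x0 + \sum_(i < p) t / p%:R *
     (enorm (b 0) + L * nse (i%:R * (t / p%:R)) w))).
  by move=> p0; apply: int1Z; apply: int1D; [exact: int1_cst|exact: iS].
have iN p : (0 < p)%N -> int1 P (nse (p%:R * (t / p%:R))).
  by move=> p0; apply: nse_int; have /andP[] := grid_ok p p p0 (leqnn _).
have iG p : (0 < p)%N -> int1 P (G p) by move=> p0; apply: int1D; [exact: iS'|exact: iN].
have EG p : (0 < p)%N -> Ex P (G p) <= moment_bound T0.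
  move=> p0; rewrite /G ExD; [|exact: iS'|exact: iN]; rewrite /moment_bound -/c2.
  apply: lerD; last by apply: nse_Ex; exact: grid_ok.
  have tp0 : 0 <= t / p%:R by rewrite divr_ge0.
  rewrite ExZ; last by apply: int1D; [exact: int1_cst|exact: iS].
  rewrite ExD; [|exact: int1_cst|exact: iS].
  rewrite Ex_cst Ex_sum => [|i _]; last first.
    apply: int1Z; apply: int1D; first exact: int1_cst.
    by apply: int1Z; apply: nse_int; have /andP[] := grid_ok p i p0 (ltnW (ltn_ord i)).
  have term (i : 'I_p) : Ex P (fun w => t / p%:R * (enorm (b 0) + L * nse (i%:R * (t / p%:R)) w)) <=
      t / p%:R * (enorm (b 0) + L * c2).
    have gi := grid_ok p i p0 (ltnW (ltn_ord i)).
    have ini : int1 P (nse (i%:R * (t / p%:R))) by apply: nse_int; case/andP: gi.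
    rewrite ExZ; last by apply: int1D; [exact: int1_cst|exact: int1Z].
    rewrite ler_wpM2l// ExD; [|exact: int1_cst|exact: int1Z].
    by rewrite Ex_cst lerD2l ExZ// ler_wpM2l ?(ltW L_gt0)//; exact: nse_Ex.
  apply: ler_pM.
  - by rewrite exprn_ge0// addr_ge0// mulr_ge0// ltW.
  - rewrite addr_ge0 ?enorm_ge0// sumr_ge0// => i _; apply: Ex_ge0 => w.
    rewrite mulr_ge0// addr_ge0 ?enorm_ge0// mulr_ge0 ?(ltW L_gt0)//.
    by apply: le_trans (enorm_ge0 _) (nseP _ _).
  - apply: (@le_trans _ _ (expR (t / p%:R * L) ^+ p)).
      by rewrite lerXn2r ?nnegrE ?addr_ge0 ?mulr_ge0 ?expR_ge0// ?(ltW L_gt0)// expR_ge1Dx.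
    rewrite -expRM_natl ler_expR mulrA [_ * L]mulrC ler_wpM2l ?(ltW L_gt0)//.
    by have /andP[] := grid_ok p p p0 (leqnn _).
  - rewrite lerD2l; apply: le_trans (ler_sum _ (fun i _ => term i)) _.
    rewrite sumr_const card_ord -[leLHS]mulr_natl [leLHS]mulrA ler_wpM2r//.
      by rewrite addr_ge0 ?enorm_ge0// mulr_ge0// ltW.
    by have /andP[] := grid_ok p p p0 (leqnn _).
have mF p : (0 < p)%N -> measurable_fun setT (F p).
  move=> p0; have [Q Q0 HQ] := eulerZ_lip L_gt0 b_lipschitz s0_gt0 sigma_le x0 1 p0 tgt0 p.
  have LQ : lip1 Q (fun z => enorm (eulerZ b sigma x0 (n := 1) (p := p) t z p)).
    by split=> // z z'; apply: le_trans (enorm_dist _ _) (HQ z z').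
  by apply: (lip1_measurable (X := fun q w => X p w q) LQ) => q; exact: measurable_funPT.
apply: (fatou_le (f_ := fun p => F p.+1)).
- by move=> p; exact: mF.
- by move=> p w; exact: enorm_ge0.
- move=> w; rewrite (_ : (fun p => F p.+1 w) = (fun p => F (p + 1)%N w)); last first.
    by apply/funext => p; rewrite addn1.
  rewrite (cvg_shiftn 1 (F ^~ w)); apply/cvgrPdist_le => e e0.
  have [p0 Hp] := euler_cvg (n := 1) isT tgt0 w e0.
  near=> p.
  have p0p : (p0 < p)%N by near: p; exact: nbhs_infty_gt.
  have pgt0 : (0 < p)%N by rewrite (leq_ltn_trans _ p0p).
  have p1 : (p <= 1 * p)%N by rewrite mul1n.
  have := Hp p p0p p p1; rewrite mulrCA divff ?mulr1 ?pnatr_eq0 -?lt0n//.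
  by move=> h; rewrite distrC; apply: le_trans (enorm_dist _ _) h.
- move=> p; apply: le_trans (_ : ((Ex P (G p.+1))%:E <= _)%E); last by rewrite lee_fin EG.
  rewrite EFin_Ex; last exact: iG.
  apply: ge0_le_integral => //.
  + by move=> w _; rewrite lee_fin enorm_ge0.
  + by apply/measurable_EFinP; exact: mF.
  + by case/integrableP: (iG p.+1 isT).
  + by move=> w _; rewrite lee_fin FG.
Unshelve. all: end_near. Qed.

End FirstMoment.
Section Truncation.
Variables (f : 'cV[R]_d -> R) (l : R).
Hypothesis f_lip : forall x y, `|f x - f y| <= l * enorm (x - y).
Hypothesis l_ge0 : 0 <= l.

Definition clip (M : R) x : R := Num.max (- M) (Num.min (f x) M).

Lemma clip_bounded M x : 0 <= M -> `|clip M x| <= M.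
Proof. by move=> M0; rewrite /clip ler_norml le_max lexx/= ge_max ge_min lexx orbT andbT; lra. Qed.

Lemma clip_lip M x y : `|clip M x - clip M y| <= l * enorm (x - y).
Proof.
apply: le_trans (f_lip x y); rewrite /clip; move: (f x) (f y) => u v.
have maxd a p q : `|Num.max a p - Num.max a q| <= `|p - q| :> R.
  have := ler_norm (p - q); have := ler_norm (q - p); rewrite distrC => h1 h2.
  by rewrite ler_norml; case: (leP a p); case: (leP a q) => h3 h4; apply/andP; split; lra.
have mind a p q : `|Num.min p a - Num.min q a| <= `|p - q| :> R.
  have := ler_norm (p - q); have := ler_norm (q - p); rewrite distrC => h1 h2.
  by rewrite ler_norml; case: (leP p a); case: (leP q a) => h3 h4; apply/andP; split; lra.
exact: le_trans (maxd _ _ _) (mind _ _ _).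
Qed.

Lemma clip_norm M x : 0 <= M -> `|clip M x| <= `|f x|.
Proof.
move=> M0; rewrite /clip; move: (f x) => u.
have := ler_norm u; have := ler_norm (- u); rewrite normrN => h1 h2.
have [h3|h3] := leP u M; rewrite ler_norml.
  by case: (leP (- M) u) => h4; apply/andP; split; lra.
by case: (leP (- M) M) => h4; apply/andP; split; lra.
Qed.

Lemma clip_cvg x : clip n%:R x @[n --> \oo] --> f x.
Proof.
apply: cvg_near_cst; near=> n.
have h : `|f x| <= n%:R by near: n; exact: nbhs_infty_ger.
move: h; rewrite ler_norml /clip => /andP[h1 h2].
by rewrite min_l// max_r.
Unshelve. all: end_near. Qed.

Let obs t w := f (vecp Y t w).

Lemma obs_le t w : `|obs t w| <= `|f 0| + l * enorm (vecp Y t w).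
Proof.
rewrite /obs -(subrK (f 0) (f _)) addrC; apply: le_trans (ler_normD _ _) _.
by rewrite lerD2l; have := f_lip (vecp Y t w) 0; rewrite subr0.
Qed.

Lemma enorm_sol_int t : 0 <= t -> int1 P (fun w => enorm (vecp Y t w)).
Proof.
move=> t0; apply: (@int1_ge0_fin _ _ _ _ _ (moment_bound t)).
- by apply: (obs_measurable (l := 1)) => // u v; rewrite mul1r enorm_dist.
- by move=> w; exact: enorm_ge0.
- by apply: sol_first_moment; rewrite t0 lexx.
Qed.

Let bound_int t : 0 <= t -> int1 P (fun w => `|f 0| + l * enorm (vecp Y t w)).
Proof.
by move=> t0; apply: int1D; [exact: int1_cst|apply: int1Z; exact: enorm_sol_int].
Qed.

Lemma obs_int t : 0 <= t -> int1 P (obs t).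
Proof.
move=> t0; apply: int1_le (bound_int t0) => [|w]; last exact: obs_le.
exact: obs_measurable f_lip l_ge0 t.
Qed.

Lemma obs_Ex_le t T0 : 0 <= t <= T0 ->
  Ex P (fun w => `|obs t w|) <= `|f 0| + l * moment_bound T0.
Proof.
move=> tT; have /andP[t0 _] := tT.
apply: (@le_trans _ _ (Ex P (fun w => `|f 0| + l * enorm (vecp Y t w)))).
  by apply: le_Ex => [||w]; [apply: int1_norm; exact: obs_int|exact: bound_int|exact: obs_le].
have ie := enorm_sol_int t0.
rewrite ExD; [|exact: int1_cst|exact: int1Z].
rewrite Ex_cst lerD2l ExZ// ler_wpM2l// -lee_fin EFin_Ex//.
exact: sol_first_moment.
Qed.

Lemma clip_Ex_cvg t : 0 <= t ->
  Ex P (fun w => clip n%:R (vecp Y t w)) @[n --> \oo] --> Ex P (obs t).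
Proof.
move=> t0; have [] := @Ex_cvg _ _ _ P (fun n w => clip n%:R (vecp Y t w)) (obs t) (fun w => `|obs t w|).
- by move=> n; apply: (obs_measurable (l := l)) => // x y; exact: clip_lip.
- by move=> w; exact: clip_cvg.
- by apply: int1_norm; exact: obs_int.
- by move=> n w; exact: clip_norm.
- by [].
Qed.

Lemma centered_obsE t w : centered_obs Y f t w = obs t w - Ex P (obs t).
Proof. by rewrite /centered_obs unlock. Qed.

End Truncation.

(** Dominated convergence speaks of sequences, so a failure of continuity is first turned into a
    sequence of times converging to [t]. The continuity makes Riemann sums of the means converge. *)
Lemma cont0_Ex_obs (f : 'cV[R]_d -> R) l M : 0 <= l ->
  (forall x y, `|f x - f y| <= l * enorm (x - y)) -> (forall x, `|f x| <= M) ->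
  cont0 (fun t => Ex P (fun w => f (vecp Y t w))).
Proof.
move=> l0 fl fM t t0 e e0; apply: contrapT => H0.
have H1 n : exists s, 0 <= s /\ `|t - s| < n.+1%:R^-1 /\
    e <= `|Ex P (fun w => f (vecp Y t w)) - Ex P (fun w => f (vecp Y s w))|.
  apply: contrapT => H2; apply: H0; exists n.+1%:R^-1; first by rewrite invr_gt0.
  move=> s s0' ts; rewrite ltNge; apply/negP => H3; apply: H2; by exists s.
have {H1}[s Hs] := choice H1.
have [||||_ C] := @Ex_cvg _ _ _ P (fun n w => f (vecp Y (s n) w)) (fun w => f (vecp Y t w)) (fun=> M).
- by move=> n; exact: obs_measurable fl l0 _.
- move=> w; apply/cvgrPdist_lt => r r0.
  have [q q0 Hq] := obs_cont0 fl w t0 r0.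
  near=> n; have [sn0 [tsn _]] := Hs n; apply: Hq => //; apply: lt_trans tsn _.
  near: n; exact: near_infty_natSinv_lt (PosNum q0).
- exact: int1_cst.
- by move=> n w; exact: fM.
have /cvgrPdist_lt/(_ _ e0)[N _ /(_ N (leqnn N))] := C.
by have [_ [_]] := Hs N; rewrite /= leNgt => /negP.
Unshelve. all: end_near. Qed.

(** * Discrete and continuous averages of the solution *)

Section TimeAverages.
Variables (f : 'cV[R]_d -> R) (l : R).
Hypothesis f_lip : forall x y, `|f x - f y| <= l * enorm (x - y).
Hypothesis l_ge0 : 0 <= l.

Let obs (g : 'cV[R]_d -> R) t w := g (vecp Y t w).

Let obs_bounded_int g t M : (forall x y, `|g x - g y| <= l * enorm (x - y)) ->
  (forall x, `|g x| <= M) -> int1 P (obs g t).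
Proof.
by move=> gl gM; apply: (@int1_bounded _ _ _ _ _ M) => [|w]; [exact: obs_measurable gl l_ge0 _|exact: gM].
Qed.

Let clip_lip' M x y : `|clip f M x - clip f M y| <= l * enorm (x - y).
Proof. exact: clip_lip. Qed.

Let clip_bounded' n x : `|clip f n%:R x| <= n%:R.
Proof. exact: clip_bounded. Qed.

Lemma discrete_bounded_subG g M n Delta : (0 < n)%N -> 0 < Delta ->
  (forall x y, `|g x - g y| <= l * enorm (x - y)) -> (forall x, `|g x| <= M) ->
  subG P (fun w => n%:R^-1 * \sum_(k < n) (obs g (k.+1%:R * Delta) w - Ex P (obs g (k.+1%:R * Delta))))
    (conc_var n Delta l).
Proof.
move=> n0 D0 gl gM.
pose Z w := n%:R^-1 * \sum_(k < n) obs g (k.+1%:R * Delta) w.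
have iobs (k : nat) : int1 P (obs g (k.+1%:R * Delta)) by exact: obs_bounded_int gl gM.
have -> : (fun w => n%:R^-1 * \sum_(k < n) (obs g (k.+1%:R * Delta) w - Ex P (obs g (k.+1%:R * Delta)))) =
    fun w => Z w - Ex P Z.
  apply/funext => w; rewrite /Z ExZ; last by apply: int1_sum => i _; exact: iobs.
  by rewrite Ex_sum => [|i _]; [rewrite -mulrBr sumrB|exact: iobs].
(* All weight lies on the last point of each block, at time [(k + 1) * Delta], so [Psi] is constant
   for [p > 0]. *)
apply: (functional_limit_subG n0 D0 gl l_ge0 (wt := fun p i => (i.+1 == p)%:R) _ _ gM) => //.
  move=> [//|p] _; rewrite big_ord_recr/= eqxx big1 ?add0r// => i _.
  by rewrite eqSS ltn_eqF.
move=> w; suff E p : n%:R^-1 * \sum_(k < n) \sum_(i < p.+1) (i.+1 == p.+1)%:R *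
    g (vecp Y ((k * p.+1 + i.+1)%:R * (Delta / p.+1%:R)) w) = Z w.
  apply: cvg_near_cst; near=> p.
  have p0 : (0 < p)%N by near: p; exact: nbhs_infty_gt.
  by rewrite -(prednK p0).
congr (_ * _); apply: eq_bigr => k _.
rewrite big_ord_recr/= eqxx mul1r big1 ?add0r => [|i _]; last first.
  by rewrite eqSS ltn_eqF ?mul0r.
by rewrite -mulSnr natrM -mulrA [_ * (Delta / _)]mulrC divfK// pnatr_eq0.
Unshelve. all: end_near. Qed.

Lemma discrete_subG n Delta : (0 < n)%N -> 0 < Delta ->
  subG P (fun w => n%:R^-1 * \sum_(1 <= k < n.+1) centered_obs Y f (k%:R * Delta) w)
    (conc_var n Delta l).
Proof.
move=> n0 D0.
apply: (subG_limit (fun m => discrete_bounded_subG n0 D0 (clip_lip' m%:R) (clip_bounded' m))) => w.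
apply: cvgM; first exact: cvg_cst.
rewrite big_add1 big_mkord; apply: cvg_sumr => k.
rewrite centered_obsE; apply: cvgB; first exact: clip_cvg.
by apply: (clip_Ex_cvg f_lip) => //; rewrite mulr_ge0// ltW.
Qed.

Section Continuous.
Variables (n : nat) (S : R).
Hypothesis n_gt0 : (0 < n)%N.
Hypothesis S_gt0 : 0 < S.

(** The double sum over blocks is a Riemann sum with [n * p] cells, that is a subsequence of the
    usual one. *)
Let riemann_cvg h : cont0 h ->
  (fun p => n%:R^-1 * \sum_(k < n) \sum_(i < p) p%:R^-1 * h ((k * p + i.+1)%:R * (S / n%:R / p%:R)))
    @ \oo --> S^-1 * \int[lebesgue_measure]_(t in `[0, S]) h t.
Proof.
move=> ch; have n0 : n%:R != 0 :> R by rewrite pnatr_eq0 -lt0n.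
rewrite (_ : (fun p => _) = fun p => S^-1 * (S / (n * p)%:R * \sum_(j < n * p) h (j.+1%:R * (S / (n * p)%:R)))).
  apply: cvgM; first exact: cvg_cst.
  apply: (cvg_comp (muln n) (fun p => S / p%:R * \sum_(j < p) h (j.+1%:R * (S / p%:R)))).
    exact: cvg_mulnl.
  exact: riemann_sum.
apply/funext => p.
have sc A : S^-1 * (S / (n * p)%:R * A) = n%:R^-1 * (p%:R^-1 * A).
  by rewrite natrM invfM !mulrA mulVf ?mul1r// gt_eqF.
rewrite sc; congr (_ * _).
rewrite -(sum_blocks n p (fun j => h (j.+1%:R * (S / (n * p)%:R)))) mulr_sumr.
apply: eq_bigr => k _; rewrite mulr_sumr; apply: eq_bigr => i _.
by rewrite addnS (_ : S / (n * p)%:R = S / n%:R / p%:R)// natrM invfM mulrA.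
Qed.

(** The mean of the time average and the time integral of the means are limits of the same Riemann
    sums; their equality thus needs no joint measurability of the process. *)
Lemma continuous_bounded_subG g M :
  (forall x y, `|g x - g y| <= l * enorm (x - y)) -> (forall x, `|g x| <= M) ->
  subG P (fun w => S^-1 * \int[lebesgue_measure]_(t in `[0, S]) obs g t w -
      S^-1 * \int[lebesgue_measure]_(t in `[0, S]) Ex P (obs g t))
    (conc_var n (S / n%:R) l).
Proof.
move=> gl gM.
have D0 : 0 < S / n%:R by rewrite divr_gt0// ltr0n.
pose Z w := S^-1 * \int[lebesgue_measure]_(t in `[0, S]) obs g t w.
pose Psi p w := n%:R^-1 * \sum_(k < n) \sum_(i < p) p%:R^-1 *
  obs g ((k * p + i.+1)%:R * (S / n%:R / p%:R)) w.
have PZ w : Psi ^~ w @ \oo --> Z w by apply: riemann_cvg; exact: obs_cont0 gl w.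
have w1 p : (0 < p)%N -> \sum_(i < p) (p%:R^-1 : R) = 1.
  by move=> p0; rewrite sumr_const card_ord -[LHS]mulr_natl divff// pnatr_eq0 -lt0n.
have io t : int1 P (obs g t) by exact: obs_bounded_int gl gM.
have mo t : measurable_fun setT (obs g t) by exact: obs_measurable gl l_ge0 _.
have iSS p : int1 P (fun w => \sum_(k < n) \sum_(i < p) p%:R^-1 *
    obs g ((k * p + i.+1)%:R * (S / n%:R / p%:R)) w).
  by apply: int1_sum => k _; apply: int1_sum => i _; exact: int1Z.
have EPsi p : Ex P (Psi p) = n%:R^-1 * \sum_(k < n) \sum_(i < p) p%:R^-1 *
    Ex P (obs g ((k * p + i.+1)%:R * (S / n%:R / p%:R))).
  rewrite /Psi ExZ//; congr (_ * _); rewrite Ex_sum => [|k _]; last first.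
    by apply: int1_sum => i _; exact: int1Z.
  apply: eq_bigr => k _; rewrite Ex_sum => [|i _]; last exact: int1Z.
  by apply: eq_bigr => i _; rewrite ExZ.
have M0 : 0 <= M := le_trans (normr_ge0 _) (gM 0).
have [||_ EZ] := @Ex_cvg _ _ _ P Psi Z (fun=> M) _ PZ (int1_cst P M) _.
- by move=> p; apply: int1_measurable; exact: int1Z.
- move=> p w; rewrite /Psi normrM ger0_norm ?invr_ge0// mulrC ler_pdivrMr ?ltr0n//.
  apply: le_trans (ler_norm_sum _ _ _) _.
  apply: (@le_trans _ _ (\sum_(k < n) M)); last by rewrite sumr_const card_ord mulr_natr.
  apply: ler_sum => k _; apply: le_trans (ler_norm_sum _ _ _) _.
  case: (posnP p) => [->|p0]; first by rewrite big_ord0.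
  apply: (@le_trans _ _ (\sum_(i < p) p%:R^-1 * M)); last by rewrite -mulr_suml w1// mul1r.
  by apply: ler_sum => i _; rewrite normrM ger0_norm ?invr_ge0// ler_wpM2l ?invr_ge0//; exact: gM.
have EZ' : Ex P (Psi p) @[p --> \oo] --> S^-1 * \int[lebesgue_measure]_(t in `[0, S]) Ex P (obs g t).
  rewrite (_ : (fun p => _) = fun p => n%:R^-1 * \sum_(k < n) \sum_(i < p) p%:R^-1 *
    Ex P (obs g ((k * p + i.+1)%:R * (S / n%:R / p%:R)))); last by apply/funext.
  by apply: (riemann_cvg (h := fun t => Ex P (obs g t))); exact: cont0_Ex_obs l_ge0 gl gM.
rewrite -(cvg_unique _ EZ EZ')//.
apply: (functional_limit_subG n_gt0 D0 gl l_ge0 (wt := fun p i => p%:R^-1) _ w1 gM PZ).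
by move=> p _; rewrite invr_ge0.
Qed.

Lemma continuous_subG :
  subG P (fun w => S^-1 * \int[lebesgue_measure]_(t in `[0, S]) centered_obs Y f t w)
    (conc_var n (S / n%:R) l).
Proof.
have S0 : 0 <= S := ltW S_gt0.
have f_cont w := obs_cont0 f_lip w.
have cl_cont m w : cont0 (fun t => clip f m%:R (vecp Y t w)).
  by exact: obs_cont0 (clip_lip' m%:R) w.
have iE : forall t, 0 <= t <= S -> Ex P (obs (clip f m%:R) t) @[m --> \oo] --> Ex P (obs f t).
  by move=> t /andP[t0 _]; exact: (clip_Ex_cvg f_lip).
(* The truncated means are dominated by a constant, because the moment bound is uniform on
   [[0, S]]. *)
have [|ig cg] := @cont0_dominated _ (fun m t => Ex P (obs (clip f m%:R) t)) (fun t => Ex P (obs f t))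
  (cst (`|f 0| + l * moment_bound S)) S
  (fun m => cont0_Ex_obs l_ge0 (clip_lip' m%:R) (clip_bounded' m)) iE
  (cont0_integrable S (@cont0_cst _ _) (lexx 0)) _.
  move=> m t tS; have /andP[t0 _] := tS.
  apply: le_trans (Ex_norm (obs_bounded_int t (clip_lip' m%:R) (clip_bounded' m))) _.
  apply: le_trans (obs_Ex_le f_lip l_ge0 tS).
  apply: le_Ex => [||w].
  - by apply: int1_norm; exact: obs_bounded_int (clip_lip' m%:R) (clip_bounded' m).
  - by apply: int1_norm; exact: (obs_int f_lip).
  - exact: clip_norm.
apply: (subG_limit (fun m => continuous_bounded_subG (clip_lip' m%:R) (clip_bounded' m))) => w.
have if_ : lebesgue_measure.-integrable `[0, S] (EFin \o (fun t => obs f t w)).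
  exact: (cont0_integrable S (f_cont w) (lexx 0)).
have -> : S^-1 * \int[lebesgue_measure]_(t in `[0, S]) centered_obs Y f t w =
    S^-1 * \int[lebesgue_measure]_(t in `[0, S]) obs f t w -
    S^-1 * \int[lebesgue_measure]_(t in `[0, S]) Ex P (obs f t).
  rewrite -mulrBr -RintegralB//; congr (_ * _).
  by apply: eq_Rintegral => t _; rewrite centered_obsE.
apply: cvgB; last by apply: cvgM; [exact: cvg_cst|exact: cg].
apply: cvgM; first exact: cvg_cst.
have [| | |_ C] := @cont0_dominated _ (fun m t => clip f m%:R (vecp Y t w)) (fun t => obs f t w)
  (fun t => `|obs f t w|) S (fun m => cl_cont m w) _ _ _; last exact: C.
- by move=> t _; exact: clip_cvg.
- exact: (integrable_abse if_).
- by move=> m t _; exact: clip_norm.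
Qed.

End Continuous.
End TimeAverages.

End Solution.

(** * Lipschitz constants and the final bounds *)

Section LipschitzConstant.
Context {R : realType} {d : nat}.
Implicit Types (f : 'cV[R]_d -> R) (x y : 'cV[R]_d).

Lemma enorm_eq0 x : enorm x = 0 -> x = 0.
Proof.
move=> x0; apply/matrixP => i j; rewrite ord1 mxE; apply/eqP; rewrite -normr_eq0 eq_le normr_ge0.
by rewrite andbT -[leRHS]x0 le_coord_enorm.
Qed.

Lemma enorm_gt0 x y : x != y -> 0 < enorm (x - y).
Proof.
by move=> xy; rewrite lt_neqAle enorm_ge0 andbT eq_sym; apply: contraNneq xy => /enorm_eq0/subr0_eq ->.
Qed.

Lemma lip_ge0 f : lipschitz_fun f -> 0 <= lip f.
Proof.
move=> [K HK]; rewrite /lip; set S := [set q | _].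
(* In dimension 0 there are no two distinct points, and [sup] of the empty set is 0. *)
have [->|/set0P[q Sq]] := eqVneq S set0; first by rewrite sup0.
have hS : has_sup S.
  split; first by exists q.
  by exists K => _ [x [y [xy ->]]]; rewrite ler_pdivrMr ?HK ?enorm_gt0.
apply: le_trans (sup_upper_bound hS Sq).
by case: Sq => x [y [_ ->]]; rewrite divr_ge0// enorm_ge0.
Qed.

Lemma lip_le f : lipschitz_fun f -> forall x y, `|f x - f y| <= lip f * enorm (x - y).
Proof.
move=> [K HK] x y; have [->|xy] := eqVneq x y; first by rewrite !subrr normr0 enorm0 mulr0.
rewrite -ler_pdivrMr ?enorm_gt0// /lip; apply: sup_upper_bound; last by exists x, y.
split; first by exists (`|f x - f y| / enorm (x - y)); exists x, y.
by exists K => _ [u [v [uv ->]]]; rewrite ler_pdivrMr ?HK ?enorm_gt0.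
Qed.

End LipschitzConstant.

Lemma euler_const_ge0 (R : realType) (alpha L s0 Delta : R) : 0 < alpha -> 0 < L -> 0 < s0 ->
  0 <= Delta -> 0 <= euler_const alpha L s0 Delta.
Proof.
move=> a0 L0 s0' D0; rewrite /euler_const !mulr_ge0 ?(ltW s0')//.
  by rewrite addr_ge0// divr_ge0 ?mulr_ge0// ltW.
by rewrite addr_ge0// divr_ge0 ?mulr_ge0// ltW.
Qed.

(** With [m = max (2 H) 1] and [e = 2 - m], the powers of [n] multiply to [n ^ m * n ^ e = n ^ 2],
    so [conc_var] is [4 * euler_const ^+ 2 * d * Delta ^ (2 H) * l ^+ 2 / n ^ e]. The hypothesis
    exchanges [n] for the horizon [N]. *)
Lemma conc_var_le (R : realType) (d n : nat) (alpha L H s0 Delta l C N : R) :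
  (0 < n)%N -> 0 < N ->
  4 * euler_const alpha L s0 Delta ^+ 2 * d%:R * Delta `^ (2 * H) *
    N `^ (2 - Num.max (2 * H) 1) <= C * n%:R `^ (2 - Num.max (2 * H) 1) ->
  conc_var (d := d) alpha L H s0 n Delta l <= C * l ^+ 2 / N `^ (2 - Num.max (2 * H) 1).
Proof.
move=> n0 N0 le; have n0' : 0 < n%:R :> R by rewrite ltr0n.
rewrite ler_pdivlMr ?powR_gt0//.
have Dp : 0 <= d%:R * (2 * Delta `^ (2 * H) * n%:R `^ Num.max (2 * H) 1).
  by rewrite !mulr_ge0// powR_ge0.
have E : n%:R `^ Num.max (2 * H) 1 * n%:R `^ (2 - Num.max (2 * H) 1) = n%:R ^+ 2 :> R.
  rewrite -powRD; last by rewrite (gt_eqF n0') implybT.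
  by rewrite addrC subrK -powR_mulrn// ltW.
set e := 2 - _ in le E *; set m := Num.max _ _ in Dp E *.
have np : 0 < n%:R `^ e by rewrite powR_gt0.
rewrite -(ler_pM2r np) /conc_var exprMn sqr_sqrtr// -/m.
move: (euler_const alpha L s0 Delta) le => ec le.
have -> : 2 * ((l / n%:R * ec) ^+ 2 * (d%:R * (2 * Delta `^ (2 * H) * n%:R `^ m))) * N `^ e * n%:R `^ e =
   l ^+ 2 * (4 * ec ^+ 2 * d%:R * Delta `^ (2 * H) * N `^ e) * ((n%:R `^ m * n%:R `^ e) / n%:R ^+ 2).
  by field; rewrite gt_eqF.
rewrite E divff ?mulr1 ?expf_neq0 ?gt_eqF//.
have -> : C * l ^+ 2 * n%:R `^ e = l ^+ 2 * (C * n%:R `^ e) by ring.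
by rewrite ler_wpM2l// sqr_ge0.
Qed.

Lemma subG_conc_bound (disp : measure_display) (T : measurableType disp) (R : realType)
  (P : probability T R) (d : nat) (Z : T -> R) (H C N : R) (f : 'cV[R]_d -> R) (r : R) :
  0 < C -> 0 < N -> 0 <= r -> 0 <= lip f ->
  (lip f = 0 -> forall w, Z w = 0) ->
  subG P Z (C * lip f ^+ 2 / N `^ (2 - Num.max (2 * H) 1)) ->
  (P [set w | (r < Z w)%R] <= (conc_bound H C N f r)%:E)%E.
Proof.
move=> C0 N0 r0 l0 Z0 sZ; rewrite /conc_bound; case: eqP => [f0|/eqP f0].
  rewrite (_ : [set w | _] = set0) ?measure0 ?lee_fin; first by case: ifP.
  by apply/seteqP; split=> w //=; rewrite Z0// ltNge r0.
have lp : 0 < lip f by rewrite lt_neqAle eq_sym f0.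
have Np : 0 < N `^ (2 - Num.max (2 * H) 1) by rewrite powR_gt0.
have k0 : 0 < C * lip f ^+ 2 / N `^ (2 - Num.max (2 * H) 1).
  by rewrite divr_gt0// mulr_gt0// exprn_gt0.
apply: le_trans (subG_chernoff k0 r0 sZ) _; rewrite lee_fin ler_expR lerN2 le_eqVlt.
by apply/orP; left; apply/eqP; field; rewrite !gt_eqF.
Qed.

Lemma centered_obs0 (disp : measure_display) (T : measurableType disp) (R : realType)
  (P : probability T R) (d : nat) (Y : 'I_d -> R -> {RV P >-> R}) (f : 'cV[R]_d -> R) t w :
  lipschitz_fun f -> lip f = 0 -> centered_obs Y f t w = 0.
Proof.
move=> fl f0; have fc x : f x = f 0.
  apply/eqP; rewrite -subr_eq0 -normr_eq0 eq_le normr_ge0 andbT.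
  by have := lip_le fl x 0; rewrite f0 mul0r.
rewrite centered_obsE fc (_ : (fun w => _) = fun=> f 0); last by apply/funext => w'.
by rewrite Ex_cst subrr.
Qed.

Theorem theorem2p3 (R : realType) (d : nat) (b : 'cV[R]_d -> 'cV[R]_d)
    (alpha L : R) (H : R) (sigma : 'M[R]_d)
    (H_gt0 : 0 < H) (H_lt1 : H < 1) (alpha_gt0 : 0 < alpha) (L_gt0 : 0 < L)
    (b_continuous : continuous b)
    (b_contractive : forall y z : 'cV[R]_d,
       dotcv (b y - b z) (y - z) <= - alpha * enorm (y - z) ^+ 2)
    (b_lipschitz : forall y z : 'cV[R]_d,
       enorm (b y - b z) <= L * enorm (y - z)) :
  (forall Delta : R, 0 < Delta ->
   exists C : R, 0 < C /\
     forall (disp : measure_display) (Omega : measurableType disp)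
       (P : probability Omega R) (x : 'cV[R]_d)
       (B Y : 'I_d -> R -> {RV P >-> R}),
     is_fbm H B -> is_sde_solution b sigma x B Y ->
     forall (n : nat) (f : 'cV[R]_d -> R) (r : R),
       (1 <= n)%N -> lipschitz_fun f -> 0 <= r ->
       (P [set w | (r < n%:R^-1 *
             \sum_(1 <= k < n.+1) centered_obs Y f (k%:R * Delta) w)%R]
        <= (conc_bound H C n%:R f r)%:E)%E)
  /\
  (exists C : R, 0 < C /\
     forall (disp : measure_display) (Omega : measurableType disp)
       (P : probability Omega R) (x : 'cV[R]_d)
       (B Y : 'I_d -> R -> {RV P >-> R}),
     is_fbm H B -> is_sde_solution b sigma x B Y ->
     forall (T : R) (f : 'cV[R]_d -> R) (r : R),
       1 <= T -> lipschitz_fun f -> 0 <= r ->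
       (P [set w | (r < T^-1 *
             \int[lebesgue_measure]_(t in `[0%R, T]) centered_obs Y f t w)%R]
        <= (conc_bound H C T f r)%:E)%E).
Proof.
have [s0 s0_gt0 sigma_le] := mulmx_enorm_le sigma.
split=> [Delta D0|].
  (* The constant that [conc_var_le] asks for; the summand 1 keeps it positive when [d = 0]. *)
  pose C : R := 4 * euler_const alpha L s0 Delta ^+ 2 * d%:R * Delta `^ (2 * H) + 1.
  have C0 : 0 < C by rewrite ltr_wpDl// mulr_ge0 ?powR_ge0// mulr_ge0// mulr_ge0// sqr_ge0.
  exists C; split=> // disp Omega P x B Y fB sY n f r n1 fl r0.
  have n0 : 0 < n%:R :> R by rewrite ltr0n.
  apply: subG_conc_bound => //; first exact: lip_ge0.
    by move=> f0 w; rewrite big1 ?mulr0// => k _; exact: centered_obs0.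
  apply: subG_wide (discrete_subG alpha_gt0 L_gt0 H_gt0 b_contractive b_lipschitz s0_gt0 sigma_le
    fB sY (lip_le fl) (lip_ge0 fl) n1 D0).
  by apply: conc_var_le => //; rewrite ler_wpM2r ?powR_ge0// /C lerDl.
pose e : R := 2 - Num.max (2 * H) 1.
have e0 : 0 <= e by rewrite subr_ge0 ge_max; apply/andP; split; lra.
(* The block length [T / n] lies in [[1, 2]]: [euler_const] is largest at length 1, the power
   [2 * H] of the length is largest at 2, and [T <= 2 * n] with [e >= 0] gives the factor
   [2 ^ e]. *)
pose C : R := 4 * euler_const alpha L s0 1 ^+ 2 * d%:R * 2 `^ (2 * H) * 2 `^ e + 1.
have C1 : 0 <= 4 * euler_const alpha L s0 1 ^+ 2 * d%:R by rewrite mulr_ge0// mulr_ge0// sqr_ge0.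
have C0 : 0 < C by rewrite ltr_wpDl// mulr_ge0 ?powR_ge0// mulr_ge0 ?powR_ge0.
exists C; split=> // disp Omega P x B Y fB sY T f r T1 fl r0.
have T0 : 0 < T := lt_le_trans ltr01 T1.
pose n := Num.truncn T.
have n1 : (0 < n)%N by rewrite /n truncn_gt_nat.
have n0 : 0 < n%:R :> R by rewrite ltr0n.
have nT : n%:R <= T by rewrite truncn_le// ltW.
have T2 : T <= 2 * n%:R.
  apply/ltW/(lt_le_trans (truncnS_gt T)); rewrite -/n -natr1 mulr2n mulrDl mul1r lerD2l.
  by rewrite ler1n.
apply: subG_conc_bound => //; first exact: lip_ge0.
  move=> f0 w; rewrite (_ : \int[_]_(_ in _) _ = 0) ?mulr0//.
  under eq_Rintegral do rewrite centered_obs0//.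
  by rewrite Rintegral_cst// mul0r.
apply: subG_wide (continuous_subG alpha_gt0 L_gt0 H_gt0 b_contractive b_lipschitz s0_gt0 sigma_le
  fB sY (lip_le fl) (lip_ge0 fl) n1 T0).
apply: conc_var_le => //; rewrite -/e.
have D1 : 1 <= T / n%:R by rewrite ler_pdivlMr// mul1r.
have D2 : T / n%:R <= 2 by rewrite ler_pdivrMr.
have ec : euler_const alpha L s0 (T / n%:R) <= euler_const alpha L s0 1.
  rewrite /euler_const ler_wpM2r ?(ltW s0_gt0)// ler_wpM2l//.
    by rewrite addr_ge0// divr_ge0 ?mulr_ge0// ltW.
  rewrite lerD2l ler_wpM2l// lef_pV2 ?posrE ?mulr1//; last by rewrite mulr_gt0// divr_gt0.
  by rewrite ler_peMr// ltW.
have ec0 : 0 <= euler_const alpha L s0 (T / n%:R) by rewrite euler_const_ge0// divr_ge0// ltW.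
apply: (@le_trans _ _ (4 * euler_const alpha L s0 1 ^+ 2 * d%:R * 2 `^ (2 * H) * (2 `^ e * n%:R `^ e))).
  have H20 : 0 <= 2 * H by rewrite mulr_ge0// ltW.
  have C1' : 0 <= 4 * euler_const alpha L s0 (T / n%:R) ^+ 2 * d%:R by rewrite mulr_ge0// mulr_ge0// sqr_ge0.
  apply: ler_pM; rewrite ?powR_ge0//; first by rewrite mulr_ge0 ?powR_ge0.
    apply: ler_pM; rewrite ?powR_ge0//.
      by rewrite ler_wpM2r// ler_wpM2l// lerXn2r// nnegrE// (le_trans ec0).
    by rewrite ge0_ler_powR// nnegrE// divr_ge0// ltW.
  by rewrite -powRM// ge0_ler_powR// nnegrE ?mulr_ge0// ltW.
by rewrite mulrA ler_wpM2r ?powR_ge0// /C lerDl.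
Qed.
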